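(* Let $\mu=1$ and $L=2$ and consider exact (noiseless, $\sigma^2=0$) gradient oracles. (i) For every integer $d\ge1$ there are constants $0<c_d\le C_d<\infty$ depending only on $d$ such that for every $R\ge64$ and every $0<\varepsilon\le1/10$, the noiseless expected minimax cost on $\mathcal C_d(2,1;0,R)$ satisfies $$c_d\log(1+R)\ \le\ \inf_{\mathcal A}\ \sup_{f\in\mathcal C_d(2,1;0,R)}\mathbb E_f[T]\ \le\ C_d\log(1+R),$$ where the infimum is over algorithms whose output law is within TV distance $\varepsilon$ of $\nu_f$ for every $f\in\mathcal C_d(2,1;0,R)$. (ii) For every $d\ge1$ and every $0<\varepsilon\le1/10$, $$\inf_{\mathcal A}\ \sup_{f\in\mathcal U_d(2,1)}\mathbb E_f[T]=+\infty,$$ where the infimum is over algorithms whose output law is within TV distance $\varepsilon$ of $\nu_f$ for every $f\in\mathcal U_d(2,1)$.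
   Context: Norms are Euclidean and logarithms natural. For $0<\mu\le L$, $\mathcal U_d(L,\mu)$ is the set of all $f\in C^1(\mathbb R^d)$ with $\frac\mu2\|x-y\|^2\le f(x)-f(y)-\langle\nabla f(y),x-y\rangle\le\frac L2\|x-y\|^2$ for all $x,y\in\mathbb R^d$; $\mathcal C_d(L,\mu;x_0,R)$ is the subset of those $f$ whose unique minimizer lies in the closed ball $\mathbb B(x_0,R)=\{x:\|x-x_0\|\le R\}$. The target is $\nu_f(dx)=Z_f^{-1}e^{-f(x)}dx$, $Z_f=\int_{\mathbb R^d}e^{-f}$. $\|P-Q\|_{\mathrm{TV}}=\sup_D|P(D)-Q(D)|$. Algorithms. An algorithm is a measurable, almost surely terminating randomized procedure whose rules depend only on the public parameters ($d$, $L$, $\mu$, $\varepsilon$, and in (i) also $R$), not on $f$ except through replies. It makes sequential queries: at the $t$-th query it selects $x_t\in\mathbb R^d$ from previous queries, replies and internal randomness, and receives a reply $g_t$, equal to $\nabla f(x_t)$ almost surely. No other information on $f$ is available; exact real arithmetic and internal random generation are free. The number of queries $T$ must be a stopping time for $\mathcal F_t=\sigma(x_1,g_1,\dots,x_t,g_t)$, $\mathcal F_0=\{\varnothing,\Omega\}$; the output may additionally use private randomness. The infimum of the empty set is $+\infty$. *)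

(* Defs.v *)
From HB Require Import structures.
From mathcomp Require Import all_boot all_order all_algebra.
From mathcomp Require Import all_classical all_reals all_analysis.

Set Implicit Arguments.
Unset Strict Implicit.
Unset Printing Implicit Defensive.
Import Order.TTheory GRing.Theory Num.Theory.
Import numFieldNormedType.Exports.
Local Open Scope classical_set_scope.
Local Open Scope ring_scope.

(** R^d is ['rV[R]_d]. Its Borel sigma-algebra is presented as the sigma-algebra
    generated by the coordinates, as the library does for [n.-tuple T]. *)

Fact rV_display : measure_display. Proof. exact: default_measure_display. Qed.

Section measurable_rV.
Context {R : realType} (d : nat).

Let coords : 'I_d -> 'rV[R]_d -> R := fun i v => v ord0 i.

Let rV_set0 : g_sigma_preimage coords set0.
Proof. exact: sigma_algebra0. Qed.

Let rV_setC A : g_sigma_preimage coords A -> g_sigma_preimage coords (~` A).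
Proof. exact: sigma_algebraC. Qed.

Let rV_bigcup (F : _^nat) : (forall i, g_sigma_preimage coords (F i)) ->
  g_sigma_preimage coords (\bigcup_i (F i)).
Proof. exact: sigma_algebra_bigcup. Qed.

HB.instance Definition _ := @isMeasurable.Build rV_display
  'rV[R]_d (g_sigma_preimage coords) rV_set0 rV_setC rV_bigcup.

Lemma measurable_coord (i : 'I_d) :
  measurable_fun [set: 'rV[R]_d] (fun v : 'rV[R]_d => v ord0 i).
Proof.
move=> _ Y mY; rewrite setTI; apply: sub_sigma_algebra => /=.
rewrite -bigcup_seq/=; exists i => /=; first by rewrite mem_index_enum.
by exists Y => //; rewrite setTI.
Qed.

Lemma measurable_fun_rVP d1 (T1 : measurableType d1) (f : T1 -> 'rV[R]_d) :
  (forall i, measurable_fun [set: T1] (fun x => f x ord0 i)) ->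
  measurable_fun [set: T1] f.
Proof.
move=> mf; pose G := \big[setU/set0]_(i < d)
  preimage_set_system setT (coords i) measurable.
have mE : @measurable _ 'rV[R]_d = <<s G >> by [].
have mG : preimage_set_system setT f G `<=` measurable; last first.
  exact: (measurability G mE mG).
move=> A [B].
rewrite /G -bigcup_seq => -[i _ [Y mY <-]] <-.
by rewrite setTI -[X in measurable X]setTI setTI; exact: mf.
Qed.

End measurable_rV.

(** Lebesgue measure on R^d, by recursion on d: point mass on R^0, and the image
    of the product measure under (x, v) |-> (x, v_1, ..., v_d) on R^(d+1). *)
Section lebesgue_rV_step.
Context {R : realType} (d : nat).

Definition consrV (p : measurableTypeR R * 'rV[R]_d) : 'rV[R]_d.+1 :=
  row_mx (p.1%:M : 'rV[R]_1) p.2.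

Lemma consrV0 p : consrV p ord0 ord0 = p.1.
Proof.
have := row_mxEl (p.1%:M : 'rV[R]_1) p.2 ord0 ord0.
by rewrite [RHS]mxE eqxx mulr1n => <-; congr (row_mx _ _ _ _); exact/val_inj.
Qed.

Lemma consrVS p (i : 'I_d) : consrV p ord0 (lift ord0 i) = p.2 ord0 i.
Proof.
rewrite -(row_mxEr (p.1%:M : 'rV[R]_1) p.2 ord0 i).
by congr (row_mx _ _ _ _); exact/val_inj.
Qed.

Lemma measurable_consrV : measurable_fun setT consrV.
Proof.
apply: measurable_fun_rVP => i.
have [j ->|->] := unliftP ord0 i.
  rewrite (_ : (fun _ => _) = (fun v : 'rV[R]_d => v ord0 j) \o snd).
    by apply: measurableT_comp => //; exact: measurable_coord.
  by apply/funext => p; rewrite consrVS.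
rewrite (_ : (fun _ => _) = fst) //.
by apply/funext => p; rewrite consrV0.
Qed.

Definition unconsrV (v : 'rV[R]_d.+1) : measurableTypeR R * 'rV[R]_d :=
  (v ord0 ord0, \row_i v ord0 (lift ord0 i)).

Lemma consrVK : cancel consrV unconsrV.
Proof.
move=> [x v]; rewrite /unconsrV consrV0; congr pair.
by apply/rowP => i; rewrite mxE consrVS.
Qed.

Lemma measurable_unconsrV : measurable_fun setT unconsrV.
Proof.
apply/measurable_fun_pair; first exact: measurable_coord.
apply: measurable_fun_rVP => i.
under eq_fun do rewrite mxE.
exact: measurable_coord.
Qed.

Variable mu : {sigma_finite_measure set 'rV[R]_d -> \bar R}.

Definition lebesgue_step : set 'rV[R]_d.+1 -> \bar R :=
  pushforward (lebesgue_measure \x mu)%E consrV.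

Let mconsrV := measurable_consrV.

Let lebesgue_step0 : lebesgue_step set0 = 0%E.
Proof. exact: measure0. Qed.

Let lebesgue_step_ge0 B : (0 <= lebesgue_step B)%E.
Proof. exact: measure_ge0. Qed.

Let lebesgue_step_sigma_additive : semi_sigma_additive lebesgue_step.
Proof. exact: measure_semi_sigma_additive. Qed.

HB.instance Definition _ := isMeasure.Build _ _ _ lebesgue_step
  lebesgue_step0 lebesgue_step_ge0 lebesgue_step_sigma_additive.

Let lebesgue_step_sigma_finite : sigma_finite setT lebesgue_step.
Proof.
have /sigma_finiteP[F [TF ndF Foo]] := sigma_finiteT (@lebesgue_measure R).
have /sigma_finiteP[G [TG ndG Goo]] := sigma_finiteT mu.
have muE i : lebesgue_step (unconsrV @^-1` (F i `*` G i)) =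
    (lebesgue_measure (F i) * mu (G i))%E.
  have [[mF _] [mG _]] := (Foo i, Goo i).
  rewrite -product_measure1E// /lebesgue_step /pushforward -comp_preimage.
  by rewrite (_ : unconsrV \o consrV = idfun)//; apply/funext; exact: consrVK.
exists (fun i => unconsrV @^-1` (F i `*` G i)).
  apply/esym/seteqP; split => // v _.
  have [[n _ Fn] [k _ Gk]] : (\bigcup_i F i) (unconsrV v).1 /\
      (\bigcup_i G i) (unconsrV v).2 by rewrite -TF -TG.
  exists (maxn n k) => //; split.
  - by move: (unconsrV v).1 Fn; exact/subsetPset/ndF/leq_maxl.
  - by move: (unconsrV v).2 Gk; exact/subsetPset/ndG/leq_maxr.
move=> i; have [[mF ?] [mG ?]] := (Foo i, Goo i); split.
  rewrite -[X in measurable X]setTI; apply: measurable_unconsrV => //.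
  exact: measurableX.
by rewrite muE lte_mul_pinfty// ge0_fin_numE.
Qed.

HB.instance Definition _ := @Measure_isSigmaFinite.Build _ _ _
  lebesgue_step lebesgue_step_sigma_finite.

End lebesgue_rV_step.

Fixpoint lebesgue_rV {R : realType} (d : nat) :
    {sigma_finite_measure set 'rV[R]_d -> \bar R} :=
  match d with
  | 0 => @dirac _ 'rV[R]_0 0 R
  | d'.+1 => @lebesgue_step R d' (@lebesgue_rV R d')
  end.

Lemma lebesgue_rV_box {R : realType} (d : nat) (A : 'I_d -> set R) :
  (forall i, measurable (A i)) ->
  lebesgue_rV d [set v | forall i, A i (v ord0 i)] =
    (\prod_(i < d) (lebesgue_measure (A i) : \bar R))%E.
Proof.
elim: d A => [|d IHd] A mA /=.
  by rewrite big_ord0 diracE mem_set// => -[].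
have mB : measurable [set v : 'rV[R]_d | forall i, A (lift ord0 i) (v ord0 i)].
  have -> : [set v : 'rV[R]_d | forall i, A (lift ord0 i) (v ord0 i)] =
      \big[setI/setT]_(i < d)
        ((fun v : 'rV[R]_d => v ord0 i) @^-1` A (lift ord0 i)).
    rewrite -bigcap_seq; apply/seteqP; split => v /= Av i; last first.
      by apply: Av => /=; rewrite mem_index_enum.
    by move=> _; exact: Av.
  apply: bigsetI_measurable => i _.
  by rewrite -[X in measurable X]setTI; exact: measurable_coord.
rewrite big_ord_recl -IHd// -product_measure1E//; last exact: mA.
rewrite /lebesgue_step /pushforward; congr (_ _).
apply/seteqP; split => -[x v] /=.
  move=> Av; split; first by have := Av ord0; rewrite consrV0.
  by move=> i; have := Av (lift ord0 i); rewrite consrVS.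
move=> [Ax Av] i; have [j ->|->] := unliftP ord0 i.
  by rewrite consrVS.
by rewrite consrV0.
Qed.

(** The library norm [`|x|] of ['rV[R]_d] is the sup norm, hence the
    separate [enorm]; topology and differentiability are the same for both. *)
Section gradient.
Context {R : realType} {d : nat}.
Implicit Types (x y : 'rV[R]_d) (f : 'rV[R]_d -> R).

Definition dotp x y : R := \sum_(i < d) x ord0 i * y ord0 i.

Definition enorm x : R := Num.sqrt (dotp x x).

Definition grad f x : 'rV[R]_d := \row_(i < d) 'D_(delta_mx ord0 i) f x.

Definition C1 f : Prop := (forall x, differentiable f x) /\ continuous (grad f).

Definition minimizer f x : Prop := forall y, f x <= f y.

End gradient.

Definition smooth_strongly_convex {R : realType} (d : nat) (L mu : R) :
    set ('rV[R]_d -> R) :=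
  [set f | C1 f /\
    forall x y,
      mu / 2 * enorm (x - y) ^+ 2 <= f x - f y - dotp (grad f y) (x - y)
        <= L / 2 * enorm (x - y) ^+ 2].

Definition centered_class {R : realType} (d : nat) (L mu : R)
    (x0 : 'rV[R]_d) (r : R) : set ('rV[R]_d -> R) :=
  [set f | smooth_strongly_convex L mu f /\
    exists x, unique (minimizer f) x /\ enorm (x - x0) <= r].

Section target.
Context {R : realType} {d : nat}.
Local Open Scope ereal_scope.

Definition partition_function (f : 'rV[R]_d -> R) : \bar R :=
  \int[lebesgue_rV d]_x (expR (- f x))%:E.

Definition gibbs (f : 'rV[R]_d -> R) (D : set 'rV[R]_d) : \bar R :=
  ((fine (partition_function f))^-1)%:E *
    \int[lebesgue_rV d]_(x in D) (expR (- f x))%:E.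

Definition tv_dist (P Q : set 'rV[R]_d -> \bar R) : \bar R :=
  ereal_sup [set `|P D - Q D| | D in measurable].

End target.

(** A randomized first-order procedure. All internal randomness, including the
    private randomness of the output, is carried by a point of an arbitrary
    probability space. A transcript of length [t] is the tuple of the first [t]
    pairs (query, reply), most recent first. [stop] receives the seed as well;
    that the number of queries is a stopping time for the transcripts is imposed
    in [admissible]. *)
Record algorithm (R : realType) (d : nat) := Algorithm {
  seed_disp : measure_display ;
  seed : measurableType seed_disp ;
  seed_law : probability seed R ;
  query : forall t, seed * t.-tuple ('rV[R]_d * 'rV[R]_d) -> 'rV[R]_d ;
  stop : forall t, seed * t.-tuple ('rV[R]_d * 'rV[R]_d) -> bool ;
  output : forall t, seed * t.-tuple ('rV[R]_d * 'rV[R]_d) -> 'rV[R]_d ;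
  measurable_query : forall t, measurable_fun setT (@query t) ;
  measurable_stop : forall t, measurable_fun setT (@stop t) ;
  measurable_output : forall t, measurable_fun setT (@output t) }.

Section run.
Context {R : realType} {d : nat}.
Variables (A : algorithm R d) (f : 'rV[R]_d -> R).

(** Noiseless oracle: the reply to a query [x] is [grad f x]. Queries are defined
    for all [t]; only those up to the stopping time are counted. *)
Fixpoint transcript (t : nat) (w : seed A) : t.-tuple ('rV[R]_d * 'rV[R]_d) :=
  match t with
  | 0 => [tuple]
  | s.+1 => let h := transcript s w in
            let x := query (w, h) in
            [the s.+1.-tuple _ of (x, grad f x) :: h]
  end.

Definition stop_time (w : seed A) : option nat :=
  match pselect (exists t, stop (w, transcript t w)) with
  | left ex => Some (ex_minn ex)
  | right _ => None
  end.

Definition num_queries (w : seed A) : \bar R :=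
  if stop_time w is Some t then t%:R%:E else +oo%E.

Definition final (w : seed A) : 'rV[R]_d :=
  if stop_time w is Some t then output (w, transcript t w) else 0.

Definition output_law : set 'rV[R]_d -> \bar R :=
  pushforward (seed_law A) final.

(** The sigma-algebra generated by the first [t] queries and replies. *)
Definition history (t : nat) : set (set (seed A)) :=
  preimage_set_system setT (transcript t) measurable.

Definition is_stopping_time (T : seed A -> \bar R) : Prop :=
  forall t : nat, history t [set w | (T w <= t%:R%:E)%E].

Definition expected_queries : \bar R := (\int[seed_law A]_w num_queries w)%E.

End run.

Section minimax.
Context {R : realType} {d : nat}.
Local Open Scope ereal_scope.

Definition admissible (F : set ('rV[R]_d -> R)) (eps : R) (A : algorithm R d) :
    Prop :=
  forall f, F f ->
    [/\ {ae seed_law A, forall w, num_queries f w < +oo},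
        is_stopping_time f (@num_queries _ _ A f) &
        tv_dist (output_law A f) (gibbs f) <= eps%:E].

Definition minimax_cost (F : set ('rV[R]_d -> R)) (eps : R) : \bar R :=
  ereal_inf [set c | exists2 A : algorithm R d, admissible F eps A &
                     c = ereal_sup [set expected_queries A f | f in F]].

End minimax.

(* Main.v *)
From HB Require Import structures.
Require Import Defs.
From mathcomp Require Import all_boot all_order all_algebra.
From mathcomp Require Import all_classical all_reals all_analysis.
From mathcomp Require Import measurable_realfun ring lra zify.

Set Implicit Arguments.
Unset Strict Implicit.
Unset Printing Implicit Defensive.
Import Order.TTheory GRing.Theory Num.Theory.
Import numFieldNormedType.Exports.
Local Open Scope classical_set_scope.
Local Open Scope ring_scope.

(* Upper bound: O(log R) steps of gradient descent reach a point [y] with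
   [f y - min f <= 1]. From there the target is sampled by rejection from the
   standard Gaussian centred at [y - grad f y]: for the proposal [y + u], the
   density ratio is [exp (- e)] up to a constant factor, where
     e = f (y + u) - f y - <grad f y, u> - |u|^2 / 2
       = \int_0^1 <grad f (y + t u) - grad f y - t u, u> dt
   lies in [0, |u|^2 / 2]. Function values are not observed, so the coin of
   probability [exp (- e)] is tossed by Poisson thinning: a Poisson number of
   tests, each of which queries the gradient at a uniform point of the segment
   [y, y + u]. The acceptance probability is bounded below, so the expected number
   of queries after the descent is bounded, and truncating the procedure at a large
   number of steps changes the output law by at most [eps].

   Lower bound: words [b] of length [m ~ log R] index the leaves of a tree of
   intervals shrinking by a factor 8. In its first coordinate the function [f_b] is
   a fixed quadratic outside an interval and descends into the child chosen by the
   next bit of [b], so that the reply to a query depends only on the depth at which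
   [b] leaves the branch followed by the query point. The measures [nu_(f_b)] are
   concentrated on disjoint slabs. For a fixed seed, at most [2^t (3/2)^m] of the
   [2^m] words can be found within [t] queries, whence [t] must be of order [m].
   Letting [R] tend to infinity gives (ii). *)

(** * Strongly convex functions and their Gibbs measures *)

(** Rejection is exact, so in the upper bound [eps] only decides after how many blocks of randomness
    the run is cut. A finite product law therefore suffices as seed law, and the expected number of
    rounds is bounded independently of the cut. Every expectation of the sampler is estimated by a
    function of its state that does not increase on average. One such function, with the indicator
    of a set as reward, bounds the output law from above, and the complement of the set supplies the
    other inequality; a second, with unit cost per round, bounds the waiting time. The randomness is
    private while the stopping rule must be readable off the transcript, so every working query is
    followed by one that announces whether to stop; this doubles the cost. In the lower bound all
    slopes must stay in [1, 2]. The base slope 3/2 leaves room to move the zero of the derivative by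
    [l / 8] to either side with slopes 21/16 and 7/4. Counting words for a fixed seed and then
    integrating over the seed disposes of randomisation. The budget of [m / 4] queries works because
    2^(1/4) * 3/2 < 2. *)

Section dotp.
Context {R : realType} {d : nat}.
Implicit Types x y z : 'rV[R]_d.

Lemma dotpC x y : dotp x y = dotp y x.
Proof. by apply: eq_bigr => i _; rewrite mulrC. Qed.

Lemma dotpDl x y z : dotp (x + y) z = dotp x z + dotp y z.
Proof. by rewrite -big_split; apply: eq_bigr => i _; rewrite !mxE mulrDl. Qed.

Lemma dotpZl a x y : dotp (a *: x) y = a * dotp x y.
Proof. by rewrite mulr_sumr; apply: eq_bigr => i _; rewrite !mxE mulrA. Qed.

Lemma dotpNl x y : dotp (- x) y = - dotp x y.
Proof. by rewrite -scaleN1r dotpZl mulN1r. Qed.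

Lemma dotpDr x y z : dotp x (y + z) = dotp x y + dotp x z.
Proof. by rewrite dotpC dotpDl !(dotpC x). Qed.

Lemma dotpZr a x y : dotp x (a *: y) = a * dotp x y.
Proof. by rewrite dotpC dotpZl dotpC. Qed.

Lemma dotpNr x y : dotp x (- y) = - dotp x y.
Proof. by rewrite dotpC dotpNl dotpC. Qed.

Lemma dotp0l x : dotp 0 x = 0.
Proof. by rewrite -(scale0r 0) dotpZl mul0r. Qed.

Lemma dotp0r x : dotp x 0 = 0.
Proof. by rewrite dotpC dotp0l. Qed.

Definition dotpE := (dotpDl, dotpDr, dotpNl, dotpNr, dotpZl, dotpZr).

Lemma dotp_ge0 x : 0 <= dotp x x.
Proof. by apply: sumr_ge0 => i _; rewrite -expr2 sqr_ge0. Qed.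

Lemma dotp_eq0 x : dotp x x = 0 -> x = 0.
Proof.
move=> /eqP; rewrite psumr_eq0; last by move=> i _; rewrite -expr2 sqr_ge0.
move=> /allP h; apply/rowP => i; rewrite mxE; apply/eqP.
by have := h i (mem_index_enum _); rewrite /= -expr2 sqrf_eq0.
Qed.

Lemma enorm_sqr x : enorm x ^+ 2 = dotp x x.
Proof. by rewrite sqr_sqrtr// dotp_ge0. Qed.

Lemma dotp_sub_le x y : dotp (x - y) (x - y) <= 2 * dotp x x + 2 * dotp y y.
Proof.
have := dotp_ge0 (x + y); rewrite !dotpE (dotpC y x); lra.
Qed.

End dotp.

Section class_facts.
Context {R : realType} {d : nat}.
Variable f : 'rV[R]_d -> R.
Hypothesis hf : smooth_strongly_convex 2 1 f.
Implicit Types x y z u : 'rV[R]_d.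

Lemma ssc_lower x y :
  dotp (x - y) (x - y) / 2 <= f x - f y - dotp (grad f y) (x - y).
Proof.
by have [_ /(_ x y)/andP[+ _]] := hf; rewrite enorm_sqr mul1r mulrC.
Qed.

Lemma ssc_upper x y :
  f x - f y - dotp (grad f y) (x - y) <= dotp (x - y) (x - y).
Proof.
by have [_ /(_ x y)/andP[_]] := hf; rewrite enorm_sqr divff ?mul1r.
Qed.

(** The step 1/2 = 1/L minimises the quadratic upper bound at [x]. *)
Lemma gradient_step x :
  f (x - 2^-1 *: grad f x) <= f x - dotp (grad f x) (grad f x) / 4.
Proof.
have := ssc_upper (x - 2^-1 *: grad f x) x.
rewrite [_ - x]addrC addKr !dotpE; lra.
Qed.

Lemma grad_minimizer x : minimizer f x -> grad f x = 0.
Proof.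
move=> fx; apply: dotp_eq0; apply/eqP; rewrite eq_le dotp_ge0 andbT.
have := gradient_step x; have := fx (x - 2^-1 *: grad f x); lra.
Qed.

(** Polyak-Lojasiewicz inequality: the quadratic lower bound at [x] is smallest at [x - grad f x],
    which is the nonnegativity of the square introduced in the proof. *)
Lemma gradient_dominated x y : f x - f y <= dotp (grad f x) (grad f x) / 2.
Proof.
have := ssc_lower y x; have := dotp_ge0 (grad f x + (y - x)).
rewrite [dotp (_ + _) _]dotpDl ![dotp _ (_ + (y - x))]dotpDr.
rewrite (dotpC (y - x) (grad f x)); lra.
Qed.

Lemma gradient_step_contraction x y :
  f (x - 2^-1 *: grad f x) - f y <= (f x - f y) / 2.
Proof. have := gradient_step x; have := gradient_dominated x y; lra. Qed.

Lemma minimizer_dist x y : minimizer f x ->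
  dotp (y - x) (y - x) <= 2 * (f y - f x).
Proof.
move=> fx; have := ssc_lower y x; rewrite (grad_minimizer fx) dotp0l; lra.
Qed.

Lemma minimizer_gap x y : minimizer f x -> f y - f x <= dotp (y - x) (y - x).
Proof.
by move=> fx; have := ssc_upper y x; rewrite (grad_minimizer fx) dotp0l subr0.
Qed.

(** A gradient step from [y] gains a quarter of the squared gradient and cannot go below the
    minimum. *)
Lemma grad_gap x y : minimizer f x ->
  dotp (grad f y) (grad f y) <= 4 * (f y - f x).
Proof.
move=> fx; have := gradient_step y; have := fx (y - 2^-1 *: grad f y); lra.
Qed.

(** Sum of the lower bounds for the pair [x], [x + u] taken in both orders. *)
Lemma grad_monotone x u :
  dotp u u <= dotp (grad f (x + u) - grad f x) u.
Proof.
have := ssc_lower (x + u) x; have := ssc_lower x (x + u).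
rewrite opprD addrA subrr sub0r [x + u]addrC addrK [u + x]addrC !dotpE; lra.
Qed.

Lemma grad_lipschitz_dir x u :
  dotp (grad f (x + u) - grad f x) u <= 2 * dotp u u.
Proof.
have := ssc_upper (x + u) x; have := ssc_upper x (x + u).
rewrite opprD addrA subrr sub0r [x + u]addrC addrK [u + x]addrC !dotpE; lra.
Qed.

End class_facts.

(** * Measurability of continuous functions on R^d *)

Section measurable_continuous.
Context {R : realType}.

Lemma measurable_floor_eq (k : int) :
  measurable [set x : measurableTypeR R | Num.floor x = k].
Proof.
rewrite (_ : [set _ | _] = `[k%:~R, (k + 1)%:~R[%classic).
  exact: measurable_itv.
apply/seteqP; split => x /=; rewrite in_itv/=.
  by move=> <-; rewrite floor_le floorD1_gt.
by move=> kx; exact/floor_def.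
Qed.

(** The preimage of any set is a union of countably many level sets of [k], whatever [F] is. *)
Lemma measurable_funT_countable d (T : measurableType d) (I : countType)
    (k : T -> I) (F : I -> R) :
  (forall i, measurable [set x | k x = i]) -> measurable_fun setT (F \o k).
Proof.
move=> mk _ Y mY; rewrite setTI.
rewrite (_ : _ @^-1` _ = \bigcup_n
   (if @unpickle I n is Some i then
      (if F i \in Y then [set x | k x = i] else set0) else set0)).
  apply: bigcupT_measurable => n; case: unpickle => // i.
  by case: ifP => // _; exact: mk.
apply/seteqP; split => x /=.
  by move=> Yx; exists (pickle (k x)) => //; rewrite pickleK mem_set.
by case=> n _; case: unpickle => // i; case: ifPn => // /set_mem Yi /= ->.
Qed.

(** The sigma-algebra is generated by the coordinates, so open sets are avoided: [f] is the
    pointwise limit of its values at the points of the grid of mesh [1 / (n + 1)] obtained by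
    rounding each coordinate down, and each approximation takes countably many values. *)
Lemma continuous_measurable_rV d (f : 'rV[R]_d -> R) :
  continuous f -> measurable_fun [set: 'rV[R]_d] f.
Proof.
move=> cf.
pose k n (x : 'rV[R]_d) : 'rV[int]_d := \row_i Num.floor (n.+1%:R * x ord0 i).
pose D n (z : 'rV[int]_d) : 'rV[R]_d := \row_i ((z ord0 i)%:~R / n.+1%:R).
apply: (@measurable_fun_cvg _ _ _ _ (fun n => (f \o D n) \o k n)) => [n|x _].
  apply: measurable_funT_countable => z.
  rewrite (_ : [set _ | _] = \big[setI/setT]_(i < d)
      ((fun x : 'rV[R]_d => n.+1%:R * x ord0 i) @^-1`
        [set x : measurableTypeR R | Num.floor x = z ord0 i])).
    apply: bigsetI_measurable => i _; rewrite -[X in measurable X]setTI.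
    apply: measurable_funM => //; first exact: measurable_coord.
    exact: measurable_floor_eq.
  rewrite -bigcap_seq; apply/seteqP; split => x /=.
    by move=> <- i _; rewrite mxE.
  by move=> h; apply/rowP => i; rewrite mxE; apply: h; rewrite /= mem_index_enum.
apply: (cvg_comp (fun n => D n (k n x)) f); last exact: cf.
apply/cvg_ballP => e e0; near=> n; split => // i j.
rewrite !mxE (ord1 i) /ball/=.
have n0 : (0 : R) < n.+1%:R by [].
rewrite -{1}[x ord0 j](mulfK (lt0r_neq0 n0)) -mulrBl normrM normfV.
rewrite [ `|n.+1%:R|]gtr0_norm// ltr_pdivrMr//.
rewrite [x ord0 j * _]mulrC.
set a := n.+1%:R * x ord0 j.
have := floor_le a; have := floorD1_gt a; rewrite intrD => h1 h2.
have : 1 < e * n.+1%:R.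
  rewrite mulrC -ltr_pdivrMr// div1r; apply: (@lt_le_trans _ _ n%:R).
    by near: n; exact: nbhs_infty_gtr.
  by rewrite ler_nat.
by rewrite ger0_norm; lra.
Unshelve. all: by end_near. Qed.

End measurable_continuous.

(** * Lebesgue and Gaussian integrals on R^d *)

Section integral_rV.
Context {R : realType}.
Local Open Scope ereal_scope.

Lemma ge0_integral_rVS d (h : 'rV[R]_d.+1 -> \bar R) :
  measurable_fun setT h -> (forall v, 0 <= h v) ->
  \int[lebesgue_rV d.+1]_v h v =
  \int[lebesgue_measure]_x \int[lebesgue_rV d]_v h (consrV (x, v)).
Proof.
move=> mh h0.
rewrite [LHS](_ : _ = \int[pushforward (lebesgue_measure \x lebesgue_rV d)
  (@consrV R d)]_v h v)//.
rewrite (ge0_integral_pushforward (@measurable_consrV R d))//.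
rewrite preimage_setT fubini_tonelli1//=.
exact: measurableT_comp mh (@measurable_consrV R d).
Qed.

Lemma measurable_shift (a : R) :
  measurable_fun setT ((fun x => x + a)%R : measurableTypeR R -> measurableTypeR R).
Proof. exact: measurable_funD. Qed.

(** By uniqueness of the measure that gives half-open intervals their length. *)
Lemma lebesgue_measure_shift (a : R) (A : set (measurableTypeR R)) :
  measurable A ->
  lebesgue_measure A = pushforward lebesgue_measure (fun x : R => x + a)%R A.
Proof.
pose s : {mfun measurableTypeR R >-> measurableTypeR R} :=
  HB.pack (fun x : measurableTypeR R => (x + a)%R)
    (isMeasurableFun.Build _ _ _ _ _ (measurable_shift a)).
move=> mA; apply: (@lebesgue_measure_unique R (pushforward lebesgue_measure s)) => //.
move=> _ [[x y] _ <-].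
rewrite [RHS](_ : _ = lebesgue_measure `](x - a)%R, (y - a)%R]%classic).
  by rewrite !lebesgue_measure_itv/= !lte_fin ltrD2r -!EFinB opprB addrA subrK.
congr lebesgue_measure.
by apply/seteqP; split => z/=; rewrite !in_itv/= ltrBlDr lerBrDr.
Qed.

Lemma ge0_integral_shift (a : R) (h : R -> \bar R) :
  measurable_fun setT h -> (forall x, 0 <= h x) ->
  \int[lebesgue_measure]_x h (x + a)%R = \int[lebesgue_measure]_x h x.
Proof.
move=> mh h0.
have := ge0_integral_pushforward (measurable_shift a) lebesgue_measure
  measurableT mh (fun x _ => h0 x).
rewrite preimage_setT => <-.
apply: eq_measure_integral => [|mf A mA _]; first exact: measurable_shift.
exact/esym/(lebesgue_measure_shift a mA).
Qed.

Lemma consrV_add d (p : measurableTypeR R * 'rV[R]_d) (a : 'rV[R]_d.+1) :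
  (consrV p + a = consrV (p.1 + (unconsrV a).1, p.2 + (unconsrV a).2))%R.
Proof.
apply/rowP => i; rewrite mxE; have [j ->|->] := unliftP ord0 i.
  by rewrite !consrVS/= !mxE.
by rewrite !consrV0.
Qed.

Lemma measurable_rV_add d (a : 'rV[R]_d) :
  measurable_fun [set: 'rV[R]_d] (fun v => v + a)%R.
Proof.
apply: measurable_fun_rVP => i; under eq_fun do rewrite mxE.
by apply: measurable_funD => //; exact: measurable_coord.
Qed.

Lemma ge0_integral_rV_shift d (a : 'rV[R]_d) (h : 'rV[R]_d -> \bar R) :
  measurable_fun setT h -> (forall x, 0 <= h x) ->
  \int[lebesgue_rV d]_x h (x + a)%R = \int[lebesgue_rV d]_x h x.
Proof.
elim: d a h => [|d IHd] a h mh h0.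
  by apply: eq_integral => x _; congr h; apply/rowP => -[].
have mha : measurable_fun [set: 'rV[R]_d.+1] (fun v => h (v + a)%R).
  exact: measurableT_comp mh (measurable_rV_add a).
rewrite (ge0_integral_rVS mha (fun v => h0 _)).
rewrite (ge0_integral_rVS mh h0).
transitivity (\int[lebesgue_measure]_x \int[lebesgue_rV d]_v
    h (consrV ((x + (unconsrV a).1)%R, v))).
  apply: eq_integral => x _.
  under eq_integral do rewrite consrV_add/=.
  apply: (IHd _ (fun v => h (consrV ((x + (unconsrV a).1)%R, v)))) => //.
  apply: (measurable_fun_pair2 (f := h \o @consrV R d)).
  exact: measurableT_comp mh (@measurable_consrV R d).
apply: (@ge0_integral_shift _
  (fun x => \int[lebesgue_rV d]_v h (consrV (x, v)))).
  apply: (measurable_fun_fubini_tonelli_F (h \o @consrV R d)) => [|x]; last exact: h0.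
  exact: (measurableT_comp mh (@measurable_consrV R d)).
by move=> x; apply: integral_ge0.
Qed.

Lemma dotp_consrV d (p : measurableTypeR R * 'rV[R]_d) :
  (dotp (consrV p) (consrV p) = p.1 ^+ 2 + dotp p.2 p.2)%R.
Proof.
rewrite /dotp big_ord_recl consrV0 expr2; congr (_ + _)%R.
by apply: eq_bigr => i _; rewrite consrVS.
Qed.

Lemma measurable_dotp d1 (T : measurableType d1) d (f g : T -> 'rV[R]_d) :
  measurable_fun setT f -> measurable_fun setT g ->
  measurable_fun setT (fun x => dotp (f x) (g x)).
Proof.
move=> mf mg; apply: measurable_sum => i.
apply: measurable_funM.
  exact: (measurableT_comp (measurable_coord i) mf).
exact: (measurableT_comp (measurable_coord i) mg).
Qed.

Definition gaussian d (b : R) (v : 'rV[R]_d) : R := expR (- (b * dotp v v)).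

Lemma measurable_gaussian d (b : R) : measurable_fun setT (@gaussian d b).
Proof.
apply: measurableT_comp => //; apply: measurableT_comp => //.
apply: measurable_funM => //.
by apply: measurable_dotp.
Qed.

Lemma gaussian_consrV d b (p : measurableTypeR R * 'rV[R]_d) :
  gaussian b (consrV p) = (expR (- (b * p.1 ^+ 2)) * gaussian b p.2)%R.
Proof. by rewrite /gaussian dotp_consrV mulrDr opprD expRD. Qed.

Lemma integral_gaussian1 (b : R) : (0 < b)%R ->
  exists2 I : R, (0 < I)%R &
    \int[lebesgue_measure]_x (expR (- (b * x ^+ 2)))%:E = I%:E.
Proof.
(* The density proportional to [expR (- (b * x ^+ 2))] is the centred normal one of variance
   [1 / (2 b)], whose total mass is known. *)
move=> b0; pose s : R := Num.sqrt (2 * b)^-1.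
have s0 : s != 0%R by rewrite lt0r_neq0// sqrtr_gt0 invr_gt0 mulr_gt0.
exists (normal_peak s)^-1%R; first by rewrite invr_gt0 normal_peak_gt0.
have k0 : (0 < normal_peak s)%R := normal_peak_gt0 s0.
transitivity ((normal_peak s)^-1%R%:E *
    ((normal_peak s)%:E * \int[lebesgue_measure]_x (expR (- (b * x ^+ 2)))%:E)).
  by rewrite muleA -EFinM mulVf ?lt0r_neq0// mul1e.
rewrite -[RHS]mule1 -(integral_normal_pdf 0 s) -ge0_integralZl//=.
- congr (_ * _); apply: eq_integral => x _.
  rewrite normal_pdfE// -EFinM; congr ((_ * expR _)%:E).
  rewrite subr0 sqr_sqrtr ?invr_ge0 ?mulr_ge0// 1?ltW//.
  by field; lra.
- apply/measurable_EFinP; apply: measurableT_comp => //.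
  by apply: measurableT_comp => //; apply: measurable_funM => //; exact: measurable_funX.
- by rewrite lee_fin normal_peak_ge0.
Qed.

Lemma integral_gaussian d (b : R) : (0 < b)%R ->
  exists2 I : R, (0 < I)%R & \int[lebesgue_rV d]_v (gaussian b v)%:E = I%:E.
Proof.
move=> b0; elim: d => [|d [I I0 IH]].
  exists 1%R => //; rewrite integral_dirac//; last first.
    by apply/measurable_EFinP; exact: measurable_gaussian.
  by rewrite diracT mul1e /gaussian dotp0l mulr0 oppr0 expR0.
have [J J0 HJ] := integral_gaussian1 b0.
exists (J * I)%R; first exact: mulr_gt0.
rewrite ge0_integral_rVS; first last.
- by move=> v; rewrite lee_fin expR_ge0.
- by apply/measurable_EFinP; exact: measurable_gaussian.
transitivity (\int[lebesgue_measure]_x ((expR (- (b * x ^+ 2)))%:E * I%:E)).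
  apply: eq_integral => x _; rewrite -IH -ge0_integralZl//.
  - by apply: eq_integral => v _; rewrite gaussian_consrV.
  - by apply/measurable_EFinP; exact: measurable_gaussian.
  - by move=> v _; rewrite lee_fin expR_ge0.
rewrite ge0_integralZr ?HJ ?EFinM//.
- apply/measurable_EFinP; apply: measurableT_comp => //.
  by apply: measurableT_comp => //; apply: measurable_funM => //; exact: measurable_funX.
- by rewrite lee_fin ltW.
Qed.

End integral_rV.

(** * The excess of a function along a segment *)

Section gradient_calculus.
Context {R : realType} {d : nat}.
Variable f : 'rV[R]_d -> R.
Implicit Types (x y u : 'rV[R]_d).

Lemma derive_dotp_grad x u : differentiable f x -> 'D_u f x = dotp (grad f x) u.
Proof.
move=> df; rewrite deriveE// {1}(row_sum_delta u) linear_sum/=.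
by apply: eq_bigr => i _; rewrite linearZ/= mxE deriveE// mulrC.
Qed.

Lemma is_derive_ray x u (t : R) : differentiable f (x + t *: u) ->
  is_derive t 1 (fun s : R => f (x + s *: u)) (dotp (grad f (x + t *: u)) u).
Proof.
move=> df; rewrite -derive_dotp_grad//.
have H : (fun h : R => h^-1 *: (((fun s : R => f (x + s *: u)) \o shift t) (h *: 1)
            - f (x + t *: u))) =
    (fun h : R => h^-1 *: ((f \o shift (x + t *: u)) (h *: u) - f (x + t *: u))).
  apply/funext => h /=; congr (_ *: (f _ - _)).
  by rewrite scalerDl -[h *: 1]/(h * 1) mulr1 addrCA.
have dR : derivable f (x + t *: u) u := diff_derivable df.
by apply: DeriveDef; rewrite /derivable /derive H.
Qed.

End gradient_calculus.

Section excess.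
Context {R : realType} {d : nat}.
Variable f : 'rV[R]_d -> R.
Hypothesis hf : smooth_strongly_convex 2 1 f.
Implicit Types (x y u : 'rV[R]_d).

Let df x : differentiable f x. Proof. by have [[]] := hf. Qed.
Let cg : continuous (grad f). Proof. by have [[]] := hf. Qed.

Lemma ssc_measurable : measurable_fun setT f.
Proof.
by apply: continuous_measurable_rV => x; exact: differentiable_continuous.
Qed.

Lemma measurable_grad : measurable_fun setT (grad f).
Proof.
apply: measurable_fun_rVP => i; apply: continuous_measurable_rV => x.
apply: (@cvg_comp _ _ _ (grad f) (fun v : 'rV[R]_d => v ord0 i)).
  exact: cg.
exact: coord_continuous.
Qed.

(** This is the Bregman divergence of [f] minus half the squared norm, a convex function with
    1-Lipschitz gradient. *)
Definition excess y u := f (y + u) - f y - dotp (grad f y) u - dotp u u / 2.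

Definition excess_rate y u (t : R) :=
  dotp (grad f (y + t *: u) - grad f y) u - t * dotp u u.

Lemma excess_ge0 y u : 0 <= excess y u.
Proof. by have := ssc_lower hf (y + u) y; rewrite [y + u - y]addrC addKr /excess; lra. Qed.

Lemma excess_le y u : excess y u <= dotp u u / 2.
Proof. by have := ssc_upper hf (y + u) y; rewrite [y + u - y]addrC addKr /excess; lra. Qed.

Lemma excess_rate_ge0 y u t : 0 <= t -> 0 <= excess_rate y u t.
Proof.
rewrite le_eqVlt => /predU1P[<-|t0].
  by rewrite /excess_rate scale0r addr0 subrr dotp0l mul0r subr0.
(* Monotonicity is applied to the displacement [t *: u] and divided by [t], hence the separate
   treatment of [t = 0]. *)
have := grad_monotone hf y (t *: u); rewrite /excess_rate.
rewrite dotpZl !dotpZr [t * (t * _)]mulrA -mulrA ler_pM2l//; lra.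
Qed.

Lemma excess_rate_le y u t : 0 <= t -> t <= 1 -> excess_rate y u t <= dotp u u.
Proof.
rewrite le_eqVlt => /predU1P[<- _|t0 t1].
  by rewrite /excess_rate scale0r addr0 subrr dotp0l mul0r subr0 dotp_ge0.
have := grad_lipschitz_dir hf y (t *: u); rewrite /excess_rate.
rewrite dotpZl !dotpZr mulrCA ler_pM2l// => h.
have : t * dotp u u <= dotp u u by rewrite ler_piMl ?dotp_ge0.
lra.
Qed.

Lemma is_derive_excess y u (t : R) :
  is_derive t 1 (fun s : R => excess y (s *: u)) (excess_rate y u t).
Proof.
have -> : (fun s : R => excess y (s *: u)) =
   (fun s : R => f (y + s *: u)) - cst (f y) - (dotp (grad f y) u) *: (@id R)
     - (dotp u u / 2) *: ((@id R) * (@id R)).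
  apply/funext => s; rewrite /excess !fctE dotpZr dotpZl dotpZr /GRing.scale/=.
  by field.
have D1 := is_derive_ray (df (y + t *: u)).
apply: is_derive_eq.
by rewrite /excess_rate dotpDl dotpNl /GRing.scale/=; field.
Qed.

Lemma continuous_dotp (g : R -> 'rV[R]_d) u :
  continuous g -> continuous (fun t => dotp (g t) u).
Proof.
move=> ctg.
have -> : (fun t => dotp (g t) u) =
    \sum_(i < d) (fun t => g t ord0 i * u ord0 i : R^o).
  by apply/funext => t; rewrite fct_sumE.
elim/big_ind : _ => [t|h k ch ck t|i _ t]; first exact: cvg_cst.
  by apply: cvgD; [exact: ch|exact: ck].
apply: cvgM; last exact: cvg_cst.
apply: (@cvg_comp _ _ _ g (fun v : 'rV[R]_d => v ord0 i)); first exact: ctg.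
exact: coord_continuous.
Qed.

Lemma continuous_excess_rate y u : continuous (excess_rate y u).
Proof.
move=> t; rewrite /excess_rate; apply: cvgB; last first.
  by apply: cvgM; [exact: cvg_id|exact: cvg_cst].
apply: (@continuous_dotp (fun s => grad f (y + s *: u) - grad f y)) => {}t.
apply: cvgB; last exact: cvg_cst.
apply: (@cvg_comp _ _ _ (fun s : R => y + s *: u) (grad f)); last exact: cg.
by apply: cvgD; [exact: cvg_cst|apply: cvgZr_tmp; exact: cvg_id].
Qed.

Lemma integral_excess_rate y u :
  (\int[lebesgue_measure]_(t in `[0%R, 1%R]) (excess_rate y u t)%:E =
   (excess y u)%:E)%E.
Proof.
have E0 : excess y (0 *: u) = 0.
  by rewrite scale0r /excess addr0 subrr dotp0r dotp0l mul0r !subr0.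
have Dx t : derivable (fun s : R => excess y (s *: u)) t 1.
  by have [] := is_derive_excess y u t.
have cx : continuous (fun s : R => excess y (s *: u)).
  by move=> t; apply/differentiable_continuous/derivable1_diffP.
rewrite (@continuous_FTC2 _ _ (fun s : R => excess y (s *: u)))//.
- by rewrite scale1r E0 sube0.
- exact/continuous_subspaceT/continuous_excess_rate.
- by split => [t _||]; [exact: Dx|apply: cvg_at_right_filter; exact: cx|apply: cvg_at_left_filter; exact: cx].
- by move=> t _; rewrite derive1E; have [] := is_derive_excess y u t.
Qed.

Lemma measurable_excess y : measurable_fun setT (excess y).
Proof.
apply: measurable_funB; last first.
  by apply: measurable_funM => //; exact: measurable_dotp.
apply: measurable_funB; last exact: measurable_dotp.
apply: measurable_funB => //.
have -> : (fun u => f (y + u)) = f \o (fun u => u + y).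
  by apply/funext => u /=; rewrite addrC.
exact: measurableT_comp ssc_measurable (measurable_rV_add y).
Qed.

End excess.

(** * Gibbs measures as normalised acceptance weights *)

Section gibbs_facts.
Context {R : realType} {d : nat}.
Variable f : 'rV[R]_d -> R.
Hypothesis hf : smooth_strongly_convex 2 1 f.
Implicit Types (x y u v : 'rV[R]_d) (D : set 'rV[R]_d).
Local Open Scope ereal_scope.

Let mf := ssc_measurable hf.

Lemma measurable_expRN : measurable_fun setT (fun x => expR (- f x)).
Proof. by apply: measurableT_comp => //; exact: measurableT_comp. Qed.

(** Here [v] is the displacement from the Gaussian centre [y - grad f y]; the displacement from [y]
    is [v - grad f y]. The second factor is the probability of accepting the proposal. *)
Definition accept_weight y v : R :=
  (gaussian 2^-1 v * expR (- excess f y (v - grad f y)))%R.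

Definition accept_mass y D : \bar R :=
  \int[lebesgue_rV d]_v (accept_weight y v * \1_D (v + (y - grad f y)))%:E.

Lemma accept_weight_ge0 y v : (0 <= accept_weight y v)%R.
Proof. by rewrite mulr_ge0 ?expR_ge0. Qed.

Lemma measurable_accept_weight y : measurable_fun setT (accept_weight y).
Proof.
apply: measurable_funM; first exact: measurable_gaussian.
apply: measurableT_comp => //; apply: measurableT_comp => //.
exact: measurableT_comp (measurable_excess hf y) (measurable_rV_add _).
Qed.

Lemma measurable_accept_indic y D : measurable D -> measurable_fun setT
  (fun v => accept_weight y v * \1_D (v + (y - grad f y)))%R.
Proof.
move=> mD; apply: measurable_funM; first exact: measurable_accept_weight.
exact: measurableT_comp (measurable_indic mD) (measurable_rV_add _).
Qed.

(** Completing the square: the linear and quadratic terms of the excess cancel against the Gaussian,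
    leaving [expR (- f)] at the proposed point times a factor that depends on [y] only. *)
Lemma accept_weightE y v :
  (accept_weight y v = expR (f y - dotp (grad f y) (grad f y) / 2) *
    expR (- f (v + (y - grad f y))))%R.
Proof.
rewrite /accept_weight /gaussian -!expRD; congr expR.
rewrite /excess [(y + _)%R]addrCA; set g := grad f y.
by rewrite !dotpE (dotpC v g); field.
Qed.

Lemma accept_massE y D : measurable D ->
  accept_mass y D = (expR (f y - dotp (grad f y) (grad f y) / 2))%:E *
    \int[lebesgue_rV d]_(x in D) (expR (- f x))%:E.
Proof.
move=> mD.
have mh : measurable_fun setT (fun x => (expR (- f x) * \1_D x)%:E).
  apply/measurable_EFinP/measurable_funM; first exact: measurable_expRN.
  exact: measurable_indic.
have h0 x : 0 <= (expR (- f x) * \1_D x)%:E.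
  by rewrite lee_fin mulr_ge0 ?expR_ge0.
have -> : \int[lebesgue_rV d]_(x in D) (expR (- f x))%:E =
    \int[lebesgue_rV d]_x (expR (- f x) * \1_D x)%:E.
  rewrite integral_mkcond; apply: eq_integral => x _.
  by rewrite patchE indicE; case: ifPn => _; rewrite ?mulr1 ?mulr0.
rewrite -(ge0_integral_rV_shift (y - grad f y) mh h0).
rewrite -ge0_integralZl//.
- by apply: eq_integral => v _; rewrite accept_weightE -mulrA EFinM.
- exact: measurableT_comp mh (measurable_rV_add _).
Qed.

(** The excess lies between 0 and half of [|v - g|^2], where [g] is the gradient at [y], and that
    half is at most [|v|^2 + |g|^2]. With the Gaussian exponent 1/2 this yields the exponent 3/2 and
    the factor [expR (- dotp g g)]; the integral [J] ensures finiteness. *)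
Lemma accept_mass_bounds y (I J : R) :
  \int[lebesgue_rV d]_v (gaussian (3 / 2) v)%:E = I%:E ->
  \int[lebesgue_rV d]_v (gaussian 2^-1 v)%:E = J%:E ->
  exists2 al : R, accept_mass y setT = al%:E &
    (expR (- dotp (grad f y) (grad f y)) * I <= al)%R.
Proof.
move=> HI HJ; set g := grad f y.
have m0 v : 0 <= (accept_weight y v * \1_setT (v + (y - grad f y)))%:E.
  by rewrite lee_fin mulr_ge0 ?accept_weight_ge0.
have mm : measurable_fun setT
    (fun v => (accept_weight y v * \1_setT (v + (y - grad f y)))%:E).
  by apply/measurable_EFinP; apply: measurable_accept_indic; exact: measurableT.
have mJ : accept_mass y setT <= J%:E.
  rewrite -HJ; apply: ge0_le_integral => //.
    by apply/measurable_EFinP; exact: measurable_gaussian.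
  move=> v _; rewrite indicT mulr1 lee_fin ler_piMr ?expR_ge0//.
  by rewrite -expR0 ler_expR oppr_le0 excess_ge0.
have Im : (expR (- dotp g g) * I)%:E <= accept_mass y setT.
  rewrite EFinM -HI -ge0_integralZl//; first last.
  - by move=> v _; rewrite lee_fin expR_ge0.
  - by apply/measurable_EFinP; exact: measurable_gaussian.
  apply: ge0_le_integral => //.
  - by move=> v _; rewrite mule_ge0// lee_fin expR_ge0.
  - apply: measurable_funeM; apply/measurable_EFinP; exact: measurable_gaussian.
  move=> v _; rewrite indicT mulr1 -EFinM lee_fin.
  rewrite /accept_weight /gaussian -!expRD ler_expR -/g.
  have := excess_le hf y (v - g); have := dotp_sub_le v g; lra.
exists (fine (accept_mass y setT)).
  rewrite fineK// ge0_fin_numE; last exact: integral_ge0.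
  exact: le_lt_trans mJ (ltry _).
rewrite -lee_fin fineK// ge0_fin_numE; last exact: integral_ge0.
exact: le_lt_trans mJ (ltry _).
Qed.

(** The acceptance mass around the point 0 is positive and finite, and it is a positive multiple of
    the partition function. *)
Lemma partition_functionP :
  exists2 Z : R, (0 < Z)%R & partition_function f = Z%:E.
Proof.
have [I I0 HI] := @integral_gaussian R d (3 / 2) ltac:(lra).
have [J J0 HJ] := @integral_gaussian R d 2^-1 ltac:(lra).
have [al aE alI] := accept_mass_bounds 0 HI HJ.
have al0 : (0 < al)%R.
  by apply: lt_le_trans alI; rewrite mulr_gt0 ?expR_gt0.
move: aE; rewrite accept_massE//.
set k := expR _ => aE.
have k0 : (0 < k)%R by exact: expR_gt0.
exists (k^-1 * al)%R; first by rewrite mulr_gt0 ?invr_gt0.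
rewrite EFinM -aE muleA -EFinM mulVf ?lt0r_neq0// mul1e.
by rewrite /partition_function.
Qed.

Lemma gibbs_ge0 D : 0 <= gibbs f D.
Proof.
have [Z Z0 ZE] := partition_functionP.
rewrite /gibbs ZE/=; apply: mule_ge0; first by rewrite lee_fin invr_ge0 ltW.
by apply: integral_ge0 => x _; rewrite lee_fin expR_ge0.
Qed.

Lemma gibbs_setC D : measurable D -> gibbs f D + gibbs f (~` D) = 1.
Proof.
move=> mD; have [Z Z0 ZE] := partition_functionP.
rewrite /gibbs ZE/= -ge0_muleDr; first last.
- by apply: integral_ge0 => x _; rewrite lee_fin expR_ge0.
- by apply: integral_ge0 => x _; rewrite lee_fin expR_ge0.
rewrite -ge0_integral_setU//; first last.
- by rewrite disj_set2E setICr.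
- by rewrite setUv; apply/measurable_EFinP; exact: measurable_expRN.
- exact: measurableC.
rewrite setUv -/(partition_function f) ZE -EFinM mulVf ?lt0r_neq0//.
Qed.

(** Exactness of rejection: the factor in [accept_weightE] does not depend on the proposal, so it
    cancels after normalisation. *)
Lemma gibbs_accept y D : measurable D ->
  accept_mass y D = accept_mass y setT * gibbs f D.
Proof.
move=> mD; have [Z Z0 ZE] := partition_functionP.
rewrite !accept_massE// -/(partition_function f) /gibbs ZE/= -!muleA.
by congr (_ * _); rewrite muleA -EFinM mulfV ?lt0r_neq0// mul1e.
Qed.

End gibbs_facts.

(** * Sources of randomness *)

Section density_law.
Context d (T : measurableType d) (R : realType).
Variables (mu : {measure set T -> \bar R}) (r : T -> R).
Local Open Scope ereal_scope.

(** The proofs are arguments so that a probability structure can be attached to the set function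
    itself. *)
Definition density_law (mr : measurable_fun setT r) (r0 : forall x, (0 <= r x)%R)
  (r1 : \int[mu]_x (r x)%:E = 1) (A : set T) : \bar R :=
  \int[mu]_(x in A) (r x)%:E.

Variables (mr : measurable_fun setT r) (r0 : forall x, (0 <= r x)%R).
Variable r1 : \int[mu]_x (r x)%:E = 1.

Local Notation P := (density_law mr r0 r1).

Let P0 : P set0 = 0. Proof. exact: integral_set0. Qed.

Let P_ge0 A : 0 <= P A.
Proof. by apply: integral_ge0 => x _; rewrite lee_fin. Qed.

Let P_sigma_additive : semi_sigma_additive P.
Proof.
apply: semi_sigma_additive_nng_induced; first exact/measurable_EFinP.
by move=> x; rewrite lee_fin.
Qed.

HB.instance Definition _ := isMeasure.Build _ _ _ P P0 P_ge0 P_sigma_additive.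

HB.instance Definition _ := @Measure_isProbability.Build _ _ R P r1.

Import HBNNSimple.

(** The identity is linear and stable under increasing limits, so it reduces to indicators through
    the simple approximations of [h]. *)
Lemma ge0_integral_density_law (h : T -> \bar R) :
  measurable_fun setT h -> (forall x, 0 <= h x) ->
  \int[P]_x h x = \int[mu]_x (h x * (r x)%:E).
Proof.
move=> mh h0; pose g := nnsfun_approx measurableT mh.
have gh x : (fun n => (g n x)%:E) @ \oo --> h x.
  by apply: cvg_nnsfun_approx => // y _; exact: h0.
have ndg x : {homo (fun n => (g n x)%:E) : m n / (m <= n)%N >-> m <= n}.
  by move=> m n mn; rewrite lee_fin; exact/lefP/nd_nnsfun_approx.
transitivity (limn (fun n => \int[P]_x (g n x)%:E)).
  rewrite -monotone_convergence//.
    by apply: eq_integral => x _; exact/esym/cvg_lim.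
  - by move=> n; exact/measurable_EFinP/measurable_funP.
  - by move=> n x _; rewrite lee_fin.
transitivity (limn (fun n => \int[mu]_x ((g n x)%:E * (r x)%:E))); last first.
  rewrite -monotone_convergence//.
  - apply: eq_integral => x _; apply/cvg_lim => //.
    by apply: cvgeZr.
  - move=> n; apply: emeasurable_funM; last exact/measurable_EFinP.
    exact/measurable_EFinP/measurable_funP.
  - by move=> n x _; rewrite mule_ge0// lee_fin.
  - by move=> x _ m n mn; rewrite lee_wpmul2r ?lee_fin//; exact: ndg.
congr (limn _); apply/funext => n.
transitivity (\sum_(k \in range (g n)) \int[mu]_x
    (k%:E * ((\1_(g n @^-1` [set k]) x)%:E * (r x)%:E))); last first.
  rewrite -ge0_integral_fsum//.
  - apply: eq_integral => x _; rewrite [in RHS]fimfunE -fsumEFin//.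
    rewrite ge0_mule_fsuml//; last first.
      by move=> k; rewrite EFinM nnfun_muleindic_ge0.
    by apply: eq_fsbigr => k _; rewrite EFinM muleA.
  - move=> k; apply: measurable_funeM; apply: emeasurable_funM.
      exact/measurable_EFinP.
    exact/measurable_EFinP.
  - move=> k x _; rewrite muleA mule_ge0 ?lee_fin//.
    exact: nnfun_muleindic_ge0.
rewrite integralT_nnsfun sintegralE; apply: eq_fsbigr => k /[!inE] -[x _ kx].
have k0 : 0 <= k%:E by rewrite lee_fin -kx.
rewrite ge0_integralZl//.
- congr (_ * _).
  transitivity (\int[mu]_(x in g n @^-1` [set k]) (r x)%:E) => //.
  rewrite integral_mkcond.
  apply: eq_integral => y _; rewrite patchE indicE.
  by case: ifPn => _; rewrite ?mul1e ?mul0e.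
- by apply: emeasurable_funM; exact/measurable_EFinP.
- by move=> y _; rewrite mule_ge0 ?lee_fin.
Qed.

End density_law.

Section tuple_law.
Context d (T : measurableType d) (R : realType) (P : probability T R).
Local Open Scope ereal_scope.

Definition cons_pair n (p : T * n.-tuple T) : n.+1.-tuple T :=
  [the n.+1.-tuple T of p.1 :: p.2].

Lemma measurable_cons_pair n : measurable_fun setT (@cons_pair n).
Proof. exact: measurable_cons. Qed.

HB.instance Definition _ n :=
  isMeasurableFun.Build _ _ _ _ (@cons_pair n) (@measurable_cons_pair n).

Fixpoint tuple_law n : probability (n.-tuple T) R :=
  match n with
  | 0 => @dirac _ (0.-tuple T) [tuple] R
  | m.+1 => distribution (P \x tuple_law m) (@cons_pair m)
  end.

Lemma ge0_integral_tuple_law0 (h : 0.-tuple T -> \bar R) :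
  measurable_fun setT h -> \int[tuple_law 0]_w h w = h [tuple].
Proof. by move=> mh; rewrite integral_dirac// diracT mul1e. Qed.

(** Conditioning on the first block, the form required by inductions on the number of rounds. *)
Lemma ge0_integral_tuple_lawS n (h : n.+1.-tuple T -> \bar R) :
  measurable_fun setT h -> (forall w, 0 <= h w) ->
  \int[tuple_law n.+1]_w h w =
  \int[P]_b \int[tuple_law n]_w h [the n.+1.-tuple T of b :: w].
Proof.
move=> mh h0; rewrite (ge0_integral_distribution (@cons_pair n) mh h0).
rewrite fubini_tonelli1; [by []| |by move=> x; exact: h0].
exact: measurableT_comp mh (@measurable_cons_pair n).
Qed.

End tuple_law.

(** * Coins whose bias is known only as a mean *)

Section coin.
Context {R : realType}.
Local Open Scope ereal_scope.

Definition unit_law : probability (measurableTypeR R) R := uniform_prob (@ltr01 R).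

Lemma integral_unit_law (h : R -> \bar R) :
  measurable_fun setT h -> (forall x, 0 <= h x) ->
  \int[unit_law]_x h x = \int[lebesgue_measure]_(x in `[0%R, 1%R]) h x.
Proof. by move=> mh h0; rewrite integral_uniform// subr0 invr1 mul1e. Qed.

Lemma integral_threshold (M p : R) (a b : \bar R) :
  (0 < M)%R -> (0 <= p)%R -> (p <= M)%R -> 0 <= a -> 0 <= b ->
  \int[unit_law]_v (if (v * M <= p)%R then a else b) =
  (p / M)%:E * a + (1 - p / M)%:E * b.
Proof.
move=> M0 p0 pM a0 b0.
have mb : measurable_fun [set: R] (fun v : R => (v * M <= p)%R).
  by apply: measurable_fun_ler => //; exact: measurable_funM.
rewrite integral_unit_law; first last.
- by move=> x; case: ifP.
- exact: measurable_fun_ifT.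
have pM0 : (0 <= p / M)%R by rewrite divr_ge0// ltW.
have pM1 : (p / M <= 1)%R by rewrite ler_pdivrMr// mul1r.
have E : `[0%R, 1%R]%classic = `[0%R, (p / M)%R] `|` `](p / M)%R, 1%R] :> set R.
  by apply: itv_bndbnd_setU; rewrite bnd_simp.
rewrite E ge0_integral_setU//=; first last.
- apply/disj_setPS => x/=; rewrite !in_itv/= => -[/andP[_ h1] /andP[h2 _]].
  by move: (lt_le_trans h2 h1); rewrite ltxx.
- by move=> x _; case: ifP.
- by apply: measurable_funTS; exact: measurable_fun_ifT.
congr (_ + _).
  rewrite (eq_integral (cst a)); last first.
    move=> x; rewrite inE/= in_itv/= => /andP[_ xp].
    by rewrite -ler_pdivlMr// xp.
  rewrite integral_cst//=; rewrite lebesgue_measure_itv/= lte_fin muleC.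
  case: ltP => [_|h]; first by rewrite sube0.
  by rewrite (le_anti (introT andP (conj h pM0))).
rewrite (eq_integral (cst b)); last first.
  move=> x; rewrite inE/= in_itv/= => /andP[xp _].
  by rewrite -ler_pdivlMr// leNgt xp.
rewrite integral_cst//= lebesgue_measure_itv/= lte_fin muleC.
case: ltP => [_|h]; first by rewrite EFinB.
by rewrite (le_anti (introT andP (conj h pM1))) subrr.
Qed.

(** A coin of bias [e / M] is tossed without knowing [e]: only [phi] at one uniform point is
    compared with a second uniform variable times [M]. Given [t] the bias is [phi t / M], and the
    mean over [t] is [e / M]. *)
Lemma integral_coin (M : R) (phi : R -> R) (a b : \bar R) (e : R) :
  (0 < M)%R -> measurable_fun setT phi ->
  (forall t, (0 <= t)%R -> (t <= 1)%R -> (0 <= phi t <= M)%R) ->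
  0 <= a -> 0 <= b ->
  \int[lebesgue_measure]_(t in `[0%R, 1%R]) (phi t)%:E = e%:E ->
  \int[unit_law]_t \int[unit_law]_v (if (v * M <= phi t)%R then a else b) =
  (e / M)%:E * a + (1 - e / M)%:E * b.
Proof.
move=> M0 mphi phi01 a0 b0 He.
have mthr : measurable_fun [set: R * R] (fun z => (z.2 * M <= phi z.1)%R).
  apply: measurable_fun_ler; first by apply: measurable_funM.
  exact: measurableT_comp mphi measurable_fst.
have mif : measurable_fun [set: R * R]
    (fun z => if (z.2 * M <= phi z.1)%R then a else b).
  exact: measurable_fun_ifT.
rewrite integral_unit_law; first last.
- by move=> x; apply: integral_ge0 => v _; case: ifP.
- apply: (measurable_fun_fubini_tonelli_F
    (fun z : measurableTypeR R * measurableTypeR R =>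
      if (z.2 * M <= phi z.1)%R then a else b)) => //.
  by move=> z; case: ifP.
have mq : measurable_fun [set: R] (fun t => (phi t / M)%R).
  exact: measurable_funM.
have q01 t : `[0%R, 1%R]%classic t -> (0 <= phi t / M <= 1)%R.
  rewrite /= in_itv/= => /andP[t0 t1]; have /andP[p0 pM] := phi01 t t0 t1.
  apply/andP; split; first by rewrite divr_ge0// ltW.
  by rewrite ler_pdivrMr// mul1r.
have Ie : \int[lebesgue_measure]_(t in `[0%R, 1%R]) (phi t / M)%:E = (e / M)%:E.
  under eq_integral do rewrite mulrC EFinM.
  rewrite ge0_integralZl//=.
  - by rewrite He mulrC EFinM.
  - by apply: measurable_funTS; exact/measurable_EFinP.
  - by move=> t; rewrite in_itv/= => /andP[t0 t1]; have /andP[] := phi01 t t0 t1.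
  - by rewrite lee_fin invr_ge0 ltW.
have Ie' : \int[lebesgue_measure]_(t in `[0%R, 1%R]) (1 - phi t / M)%:E =
    (1 - e / M)%:E.
  rewrite EFinB -Ie; apply/esym/eqP; rewrite sube_eq//.
  - rewrite -ge0_integralD//=.
    + rewrite (eq_integral (cst 1)); last first.
        by move=> t _; rewrite -EFinD subrK.
      by rewrite integral_cst//= lebesgue_measure_itv/= lte_fin ltr01 sube0 mule1.
    + by move=> t /q01/andP[_ h]; rewrite lee_fin subr_ge0.
    + by apply: measurable_funTS; apply/measurable_EFinP/measurable_funB.
    + by move=> t /q01/andP[h _]; rewrite lee_fin.
    + by apply: measurable_funTS; exact/measurable_EFinP.
  - by rewrite Ie fin_num_adde_defl.
transitivity (\int[lebesgue_measure]_(t in `[0%R, 1%R])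
   ((phi t / M)%:E * a + (1 - phi t / M)%:E * b)).
  apply: eq_integral => t; rewrite inE/= in_itv/= => /andP[t0 t1].
  by have /andP[p0 pM] := phi01 t t0 t1; exact: integral_threshold.
rewrite ge0_integralD//=; first last.
- apply: measurable_funTS; apply: emeasurable_funM => //.
  by apply/measurable_EFinP/measurable_funB.
- by move=> t /q01/andP[_ h]; rewrite mule_ge0// lee_fin subr_ge0.
- by apply: measurable_funTS; apply: emeasurable_funM => //; exact/measurable_EFinP.
- by move=> t /q01/andP[h _]; rewrite mule_ge0// lee_fin.
congr (_ + _).
- rewrite ge0_integralZr ?Ie//=.
  + by apply: measurable_funTS; exact/measurable_EFinP.
  + by move=> t /q01/andP[h _]; rewrite lee_fin.
- rewrite ge0_integralZr ?Ie'//=.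
  + by apply: measurable_funTS; apply/measurable_EFinP/measurable_funB.
  + by move=> t /q01/andP[_ h]; rewrite lee_fin subr_ge0.
Qed.

End coin.

(** * Algorithms run on independent blocks of randomness *)

Section run_measurability.
Context {R : realType} (d : nat).
Local Notation X := 'rV[R]_d.
Variables (A : algorithm R d) (f : X -> R).
Hypothesis mgrad : measurable_fun setT (grad f).
Local Notation tr := (@transcript R d A f).

(** Describes [stop_time], defined by a classical case analysis and a minimum, through finitely many
    stopping decisions, from which measurability is read off. *)
Definition stops_at (t : nat) (w : seed A) : Prop :=
  (forall s, (s < t)%N -> ~~ stop (w, tr s w)) /\ stop (w, tr t w).

Lemma stop_timeP w t : stop_time f w = Some t <-> stops_at t w.
Proof.
rewrite /stop_time; case: pselect => [ex|nex]; last first.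
  by split=> // -[_ st]; case: nex; exists t.
case: ex_minnP => n stn minn; split.
  move=> [<-]; split=> // s sn; apply/negP => /minn.
  by rewrite leqNgt sn.
move=> [sil st]; congr Some; apply/eqP; rewrite eqn_leq minn//= leqNgt.
by apply/negP => /sil; rewrite stn.
Qed.

Lemma measurable_transcript t : measurable_fun setT (tr t).
Proof.
elim: t => [|t IH].
  rewrite (_ : tr 0 = cst [tuple])//.
have mq : measurable_fun setT (fun w => query (w, tr t w)).
  apply: (measurableT_comp (@measurable_query _ _ A t)).
  exact: measurable_fun_pair.
apply: measurable_cons => //.
apply: measurable_fun_pair => //.
exact: (measurableT_comp mgrad).
Qed.

Lemma measurable_stop_run t : measurable [set w | stop (w, tr t w)].
Proof.
have mst : measurable_fun setT (fun w => stop (w, tr t w)).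
  apply: (measurableT_comp (@measurable_stop _ _ A t)).
  by apply: measurable_fun_pair => //; exact: measurable_transcript.
by rewrite -[X in measurable X]setTI; exact: (mst measurableT [set true]).
Qed.

Lemma measurable_stops_at t : measurable (stops_at t).
Proof.
rewrite (_ : stops_at t = \bigcap_(s < t) ~` [set w | stop (w, tr s w)] `&`
                          [set w | stop (w, tr t w)]); last first.
  apply/seteqP; split => w /= [sil st]; split => // s /= st'.
    by apply/negP/sil.
  by apply/negP/sil.
apply: measurableI; last exact: measurable_stop_run.
by apply: bigcap_measurableType => s _; exact/measurableC/measurable_stop_run.
Qed.

Lemma measurable_stops_in t (D : set X) : measurable D ->
  measurable [set w | stops_at t w /\ D (output (w, tr t w))].
Proof.
move=> mD; apply: measurableI; first exact: measurable_stops_at.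
have mo : measurable_fun setT (fun w => output (w, tr t w)).
  apply: (measurableT_comp (@measurable_output _ _ A t)).
  by apply: measurable_fun_pair => //; exact: measurable_transcript.
by rewrite -[X in measurable X]setTI; exact: mo.
Qed.

Lemma measurable_final : measurable_fun setT (final (A := A) f).
Proof.
move=> _ D mD; rewrite setTI.
(* Decomposition according to the stopping time; the second piece collects the runs that never stop,
   for which [final] is 0 by convention. *)
rewrite (_ : _ @^-1` _ = (\bigcup_t [set w | stops_at t w /\ D (output (w, tr t w))]) `|`
    (~` (\bigcup_t stops_at t) `&` [set w | D 0])).
  apply: measurableU.
    by apply: bigcupT_measurable => t; exact: measurable_stops_in.
  apply: measurableI.
    by apply/measurableC/bigcupT_measurable => t; exact: measurable_stops_at.
  have [D0|D0] := pselect (D 0).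
    by rewrite (_ : [set _ | _] = setT)//; apply/seteqP; split.
  by rewrite (_ : [set _ | _] = set0)//; apply/seteqP; split.
apply/seteqP; split => w; rewrite /preimage/= /final.
  case E : (stop_time f w) => [t|] Dw; first by left; exists t => //; split => //; apply/stop_timeP.
  by right; split => // -[t _ /stop_timeP]; rewrite E.
case=> [[t _ [/stop_timeP -> //]]|[none D0]].
by case E : (stop_time f w) => [t|] //; case: none; exists t => //; apply/stop_timeP.
Qed.

Lemma num_queries_gtP w t : (t%:R%:E < num_queries f w)%E <->
  ~ exists2 s, (s <= t)%N & stops_at s w.
Proof.
rewrite /num_queries; case E : (stop_time f w) => [s|].
  rewrite lte_fin ltr_nat; split.
    move=> ts [u ut /stop_timeP]; rewrite E => -[su].
    by move: ts; rewrite su ltnNge ut.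
  by move=> h; rewrite ltnNge; apply/negP => st; apply: h; exists s => //; apply/stop_timeP.
rewrite ltry; split=> // _ [s _ /stop_timeP]; by rewrite E.
Qed.

Lemma measurable_num_queries_gt t : measurable [set w | (t%:R%:E < num_queries (A := A) f w)%E].
Proof.
rewrite (_ : [set _ | _] = ~` (\bigcup_(s in [set s | (s <= t)%N]) stops_at s)).
  by apply: measurableC; apply: bigcup_measurable => s _; exact: measurable_stops_at.
apply/seteqP; split => w /=.
  by move/num_queries_gtP => h [s st sw]; apply: h; exists s.
by move=> h; apply/num_queries_gtP => -[s st sw]; apply: h; exists s.
Qed.

End run_measurability.

(** * Round-based machines and their encoding as algorithms *)

Section machine.
Context {R : realType} {d' : nat} {dS dB : measure_display}.
Local Notation X := 'rV[R]_d'.+1.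
Variables (S : measurableType dS) (B : measurableType dB).

(** A Markovian description: each round consumes one fresh block of randomness and one gradient and
    updates a state. Since acceptance is absorbing, a run may be continued after it without effect,
    so all runs can be given the same length. *)
Record machine := Machine {
  init : S ;
  probe : B * S -> X ;
  update : B * S * X -> S ;
  accepted : S -> bool ;
  result : S -> X ;
  measurable_probe : measurable_fun setT probe ;
  measurable_update : measurable_fun setT update ;
  measurable_accepted : measurable_fun setT accepted ;
  measurable_result : measurable_fun setT result ;
  accepted_init : ~~ accepted init ;
  accepted_absorbing : forall b s g, accepted s -> update (b, s, g) = s }.

Variables (P : probability B R) (A : machine) (m : nat).

Let N := m.+1.
Let W := N.-tuple B.

(** [inord] sends indices beyond [m] to 0, which makes the function total. *)
Definition block (w : W) (i : nat) : B := tnth w (inord i).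

Lemma measurable_block i : measurable_fun setT (block ^~ i).
Proof. exact: measurable_tnth. Qed.

(** The state is recomputed from the transcript. A round occupies two records, most recent first:
    the announcement on top, then the probe with its reply, which is why the reply is taken under
    one [behead]. The function is consulted at even lengths, that is, between rounds. *)
Fixpoint state (t : nat) : W * t.-tuple (X * X) -> S :=
  match t with
  | u.+2 => fun p => update A (block p.1 u./2,
      @state u (p.1, [tuple of behead (behead p.2)]),
      (thead [tuple of behead p.2]).2)
  | _ => fun=> init A
  end.

Lemma measurable_thead dT (T : measurableType dT) n :
  measurable_fun setT (fun h : n.+1.-tuple T => thead h).
Proof. exact: measurable_tnth. Qed.

Lemma nat2_ind (Q : nat -> Prop) :
  Q 0%N -> Q 1%N -> (forall n, Q n -> Q n.+2) -> forall n, Q n.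
Proof.
move=> Q0 Q1 QS n; suff [] : Q n /\ Q n.+1 by [].
by elim: n => // n [Qn QnS]; split => //; exact: QS.
Qed.

Lemma measurable_state t : measurable_fun setT (@state t).
Proof.
elim/nat2_ind: t => [||t IH]; [exact: measurable_cst|exact: measurable_cst|].
apply: (measurableT_comp (measurable_update A)).
apply: measurable_fun_pair; last first.
  apply: measurableT_comp => //.
  apply: (measurableT_comp (@measurable_thead _ _ t)).
  exact: (measurableT_comp (@measurable_behead _ _ t.+1)).
apply: measurable_fun_pair.
  exact: (measurableT_comp (measurable_block t./2)).
apply: (measurableT_comp IH); apply: measurable_fun_pair => //.
apply: (measurableT_comp (@measurable_behead _ _ t)).
exact: (measurableT_comp (@measurable_behead _ _ t.+1)).
Qed.

Definition work_query t (p : W * t.-tuple (X * X)) : X :=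
  probe A (block p.1 t./2, state p).

(** The disjunct [u./2 == m] forces the stop when the last block is used up. *)
Definition flag u (p : W * u.+1.-tuple (X * X)) : bool :=
  accepted A (update A (block p.1 u./2,
    state (p.1, [tuple of behead p.2]), (thead p.2).2)) || (u./2 == m).

(* The stopping decision is published as a query of its own: the number of
   queries must be readable off the transcript, which does not show the seed. *)
Definition machine_query t : W * t.-tuple (X * X) -> X :=
  match t with
  | 0 => @work_query 0
  | u.+1 => fun p => if odd u then work_query p
                     else if flag p then const_mx 1 else 0
  end.

(** It reads the announcement from the transcript alone, without the seed; [odd u] selects the
    lengths at which the latest query is an announcement. *)
Definition flagged t : t.-tuple (X * X) -> bool :=
  match t with
  | 0 => fun=> false
  | u.+1 => fun h => odd u && ((thead h).1 ord0 ord0 == 1)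
  end.

Definition machine_stop t (p : W * t.-tuple (X * X)) : bool := flagged p.2.

Definition machine_output t (p : W * t.-tuple (X * X)) : X :=
  result A (state p).

Lemma measurable_work_query t : measurable_fun setT (@work_query t).
Proof.
apply: (measurableT_comp (measurable_probe A)).
apply: measurable_fun_pair; last exact: measurable_state.
exact: (measurableT_comp (measurable_block t./2)).
Qed.

Lemma measurable_flag u : measurable_fun setT (@flag u).
Proof.
apply: measurable_or => //; apply: (measurableT_comp (measurable_accepted A)).
apply: (measurableT_comp (measurable_update A)).
apply: measurable_fun_pair; last first.
  apply: measurableT_comp => //.
  exact: (measurableT_comp (@measurable_thead _ _ u)).
apply: measurable_fun_pair.
  exact: (measurableT_comp (measurable_block u./2)).
apply: (measurableT_comp (@measurable_state u)); apply: measurable_fun_pair => //.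
exact: (measurableT_comp (@measurable_behead _ _ u)).
Qed.

Lemma measurable_machine_query t : measurable_fun setT (@machine_query t).
Proof.
case: t => [|u]; first exact: measurable_work_query.
rewrite /machine_query; case: (odd u); first exact: measurable_work_query.
by apply: measurable_fun_ifT => //; exact: measurable_flag.
Qed.

Lemma measurable_flagged t : measurable_fun setT (@flagged t).
Proof.
case: t => [|u]; first exact: measurable_cst.
rewrite /flagged; case: (odd u) => /=; last exact: measurable_cst.
apply: measurable_fun_eqr => //.
apply: (measurableT_comp (measurable_coord ord0)).
by apply: measurableT_comp => //; exact: measurable_thead.
Qed.

Lemma measurable_machine_stop t : measurable_fun setT (@machine_stop t).
Proof. exact: (measurableT_comp (@measurable_flagged t)). Qed.

Lemma measurable_machine_output t : measurable_fun setT (@machine_output t).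
Proof. exact: (measurableT_comp (measurable_result A) (@measurable_state t)). Qed.

Definition machine_algorithm : algorithm R d'.+1 :=
  @Algorithm R d'.+1 _ W (tuple_law P N) machine_query machine_stop
    machine_output measurable_machine_query measurable_machine_stop
    measurable_machine_output.

Lemma machine_query_even t (p : W * t.-tuple (X * X)) :
  ~~ odd t -> machine_query p = work_query p.
Proof.
case: t p => // t p ot; have {}ot : odd t by move: ot; rewrite /= negbK.
by rewrite /machine_query ot.
Qed.

Section run_machine.
Variable f : X -> R.

Definition step (s : S) (b : B) : S := update A (b, s, grad f (probe A (b, s))).

Definition state_at (w : seq B) (i : nat) : S := foldl step (init A) (take i w).

Local Notation tr := (@transcript R d'.+1 machine_algorithm f).

Lemma state_transcript (w : W) i : (i <= N)%N ->
  state (w, tr i.*2 w) = state_at w i.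
Proof.
elim: i => [_|i IH iN]; first by rewrite /state_at take0.
rewrite /state_at (take_nth (block w 0)) ?size_tuple// -cats1 foldl_cat/=.
rewrite -/(state_at w i) -IH ?(ltnW iN)//.
have bE : nth (block w 0) w i = block w i.*2./2.
  by rewrite doubleK [RHS](tnth_nth (block w 0)) inordK.
rewrite /step bE; congr update; congr (_, _, _).
- by congr (state (_, _)); exact: val_inj.
- by congr (grad f _); rewrite machine_query_even ?odd_double.
Qed.

Lemma stop_transcript_odd (w : W) t : odd t -> machine_stop (w, tr t w) = false.
Proof. by case: t => [|t]//= /negbTE ot; rewrite /machine_stop/= ot. Qed.

Lemma stop_transcript_even (w : W) i : (i < N)%N ->
  machine_stop (w, tr i.+1.*2 w) = accepted A (state_at w i.+1) || (i == m).
Proof.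
move=> iN; rewrite -state_transcript// doubleS.
rewrite /machine_stop/= odd_double/=.
transitivity (flag (w, tr i.*2.+1 w)).
  by rewrite /=; case: flag; rewrite mxE ?eqxx// eq_sym oner_eq0.
rewrite /flag doubleK; congr (accepted A _ || _).
congr update; congr (_, _, _) => //.
by congr (state (_, _)); exact: val_inj.
Qed.

Lemma state_at_accepted (w : seq B) i j : (i <= j)%N ->
  accepted A (state_at w i) -> state_at w j = state_at w i.
Proof.
move=> ij acc; rewrite /state_at.
have -> : take j w = take i w ++ drop i (take j w).
  by rewrite -{1}(cat_take_drop i (take j w)) take_takel.
rewrite foldl_cat; move: acc; rewrite /state_at.
move: (foldl _ _ (take i w)) (drop _ _) => s; elim => //= b l IH acc.
by rewrite /step accepted_absorbing// IH.
Qed.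

(** Written as a sum over rounds so that its expectation is an accumulated running cost. By
    absorption it is also the index of the first accepting state, or [N] if none comes before. *)
Definition pending (w : seq B) : nat :=
  \sum_(i < N) ~~ accepted A (state_at w i).

Lemma pendingP (w : seq B) :
  [/\ (0 < pending w <= N)%N,
     forall i, (i < pending w)%N -> ~~ accepted A (state_at w i) &
     (pending w < N)%N -> accepted A (state_at w (pending w))].
Proof.
set p := pending w; pose j := find (fun i => accepted A (state_at w i)) (iota 0 N).
have jN : (j <= N)%N by rewrite -[leqRHS](size_iota 0 N) find_size.
have before i : (i < j)%N -> ~~ accepted A (state_at w i).
  move=> ij; have := before_find 0%N ij.
  by rewrite nth_iota ?(leq_trans ij)// add0n => ->.
have after : (j < N)%N -> accepted A (state_at w j).
  move=> jlt; have := @nth_find _ 0%N (fun i => accepted A (state_at w i)) (iota 0 N).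
  by rewrite has_find size_iota => /(_ jlt); rewrite nth_iota.
have j0 : (0 < j)%N.
  rewrite lt0n; apply/eqP => j0; have := after.
  rewrite j0 /state_at take0/= => /(_ isT).
  by rewrite (negbTE (accepted_init A)).
have pj : p = j.
  rewrite /p /pending -(big_mkord xpredT (fun i => nat_of_bool (~~ accepted A (state_at w i)))).
  rewrite (big_cat_nat _ (n := j))//= [X in (X + _)%N]big_nat_cond.
  rewrite (eq_bigr (fun=> 1%N)); last first.
    by move=> i /andP[/andP[_ ij] _]; rewrite before.
  rewrite -big_nat_cond sum_nat_const_nat muln1 subn0.
  rewrite big_nat_cond big1 ?addn0// => i /andP[/andP[ji iN] _].
  have jN' := leq_ltn_trans ji iN.
  by rewrite (state_at_accepted ji (after jN')) after.
by rewrite pj j0 jN.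
Qed.

(** The announcement closing a round reports the state reached by that round; no stop can occur
    between a probe and its announcement, hence the even value. *)
Lemma stop_time_machine (w : W) :
  stop_time (A := machine_algorithm) f w = Some (pending w).*2.
Proof.
have [/andP[j0 jN] before after] := pendingP w.
move: (pending w) j0 jN before after => j j0 jN before after.
have stopj : machine_stop (w, tr j.*2 w).
  rewrite -(prednK j0) stop_transcript_even; last by rewrite -ltnS prednK.
  rewrite prednK//; have [/after -> //|] := ltnP j N; rewrite leq_eqVlt.
  move=> /predU1P[<-|]; first by rewrite /= eqxx orbT.
  by rewrite ltnNge jN.
rewrite /stop_time; case: pselect => [ex|]; last by case; exists j.*2.
congr Some; case: ex_minnP => k stopk mink.
apply/eqP; rewrite eqn_leq mink//=.
rewrite leqNgt; apply/negP => kj.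
case ok : (odd k); first by move: stopk; rewrite /= stop_transcript_odd.
have kE : k = k./2.*2 by rewrite -[LHS]odd_double_half ok.
move: stopk kj; rewrite kE ltn_double; case: (k./2) => [//|i] stopi ij.
move: stopi; rewrite [stop _]stop_transcript_even; last exact: leq_trans (ltnW ij) jN.
rewrite (negbTE (before _ ij))/= => /eqP im.
by move: (leq_trans ij jN); rewrite im ltnn.
Qed.

(** Absorption allows the output to be read after all [N] rounds instead of at the random stopping
    time. *)
Lemma final_machine (w : W) :
  final (A := machine_algorithm) f w = result A (state_at w N).
Proof.
have [/andP[_ jN] _ after] := pendingP w.
rewrite /final stop_time_machine /= /machine_output state_transcript//.
congr result; have [/after acc|Nj] := ltnP (pending w) N.
  by rewrite (state_at_accepted jN acc).
by congr state_at; apply/eqP; rewrite eqn_leq jN Nj.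
Qed.

End run_machine.
End machine.

Section machine_stopping.
Context {R : realType} {d' : nat} {dS dB : measure_display}.
Context {S : measurableType dS} {B : measurableType dB}.
Local Notation X := 'rV[R]_d'.+1.
Variables (P : probability B R) (A : @machine R d' _ _ S B) (m : nat).
Variable f : X -> R.
Local Notation alg := (machine_algorithm P A m).
Local Notation tr := (@transcript R d'.+1 alg f).

Lemma num_queries_machine w :
  num_queries (A := alg) f w = (pending A m f w).*2%:R%:E.
Proof. by rewrite /num_queries stop_time_machine. Qed.

Lemma num_queries_machine_leP w t :
  (num_queries (A := alg) f w <= t%:R%:E)%E <->
  exists2 k, (k <= t)%N & flagged (tr k w).
Proof.
rewrite num_queries_machine lee_fin ler_nat.
have := @stop_time_machine _ _ _ _ _ _ P A m f w.
rewrite /stop_time; case: pselect => // ex [].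
case: ex_minnP => k stopk mink <-; split => [kt|[j jt stopj]].
  by exists k.
exact: leq_trans (mink _ stopj) jt.
Qed.

(** Having stopped by time [t] means that one of the first [t] queries is a positive announcement.
    The set [Y] of transcripts of length [t] with this property is built by induction, removing the
    latest record. *)
Lemma machine_stopping_time : is_stopping_time f (num_queries (A := alg) f).
Proof.
move=> t.
have [Y mY YE] : exists2 Y, measurable Y &
    forall w, (exists2 k, (k <= t)%N & flagged (tr k w)) <-> Y (tr t w).
  elim: t => [|t [Y mY YE]].
    exists [set h | flagged (h : 0.-tuple _)] => [|w].
      by rewrite -[X in measurable X]setTI; exact: measurable_flagged.
    split => [[k]|fl]; last by exists 0%N.
    by rewrite leqn0 => /eqP ->.
  exists ([set h | flagged (h : t.+1.-tuple _)] `|`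
          (fun h : t.+1.-tuple (X * X) => [tuple of behead h]) @^-1` Y) => [|w].
    apply: measurableU.
      by rewrite -[X in measurable X]setTI; exact: measurable_flagged.
    by rewrite -[X in measurable X]setTI; exact: measurable_behead.
  split.
    move=> [k]; rewrite leq_eqVlt => /predU1P[->|kt] fl; first by left.
    right; rewrite /preimage/=.
    rewrite (_ : [tuple of _] = tr t w); last exact: val_inj.
    by apply/YE; exists k.
  case => [fl|]; first by exists t.+1.
  rewrite /preimage/= (_ : [tuple of _] = tr t w); last exact: val_inj.
  by move/YE => [k kt fl]; exists k => //; exact: leqW.
exists Y => //; rewrite setTI; apply/seteqP; split => w /=.
  by move/YE/num_queries_machine_leP.
by move/num_queries_machine_leP/YE.
Qed.

End machine_stopping.

(** * Expected values of machines and their supersolutions *)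

Section machine_value.
Context {R : realType} {d' : nat} {dS dB : measure_display}.
Context {S : measurableType dS} {B : measurableType dB}.
Local Notation X := 'rV[R]_d'.+1.
Variables (P : probability B R) (A : @machine R d' _ _ S B).
Variable f : X -> R.
Hypothesis mgrad : measurable_fun setT (grad f).
Local Open Scope ereal_scope.

Lemma measurable_step : measurable_fun setT (fun p : S * B => step A f p.1 p.2).
Proof.
apply: (measurableT_comp (measurable_update A)).
have mswap : measurable_fun setT (fun p : S * B => (p.2, p.1)).
  exact: measurable_fun_pair.
apply: measurable_fun_pair => //.
apply: (measurableT_comp mgrad).
exact: (measurableT_comp (measurable_probe A)).
Qed.

Variables (c h : S -> \bar R).
Hypothesis mc : measurable_fun setT c.
Hypothesis mh : measurable_fun setT h.
Hypothesis c0 : forall s, 0 <= c s.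
Hypothesis h0 : forall s, 0 <= h s.

Fixpoint value (s : S) (w : seq B) : \bar R :=
  if w is b :: w' then c s + value (step A f s b) w' else h s.

Lemma value_ge0 s w : 0 <= value s w.
Proof. by elim: w s => //= b w IH s; rewrite adde_ge0. Qed.

Lemma measurable_value n :
  measurable_fun setT (fun p : S * n.-tuple B => value p.1 p.2).
Proof.
elim: n => [|n IH].
  rewrite (_ : (fun _ => _) = h \o fst).
    exact: (measurableT_comp mh).
  by apply/funext => -[s w]/=; rewrite (tuple0 w).
rewrite (_ : (fun _ => _) = (fun p : S * n.+1.-tuple B =>
    c p.1 + value (step A f p.1 (thead p.2)) [tuple of behead p.2])).
  apply: emeasurable_funD; first exact: (measurableT_comp mc).
  have mG : measurable_fun setT (fun p : S * n.+1.-tuple B =>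
      (step A f p.1 (thead p.2), [tuple of behead p.2])).
    apply: measurable_fun_pair.
      have mT : measurable_fun setT (fun p : S * n.+1.-tuple B => (p.1, thead p.2)).
        apply: measurable_fun_pair => //.
        exact: (measurableT_comp (@measurable_thead _ _ n)).
      exact: (measurableT_comp measurable_step mT).
    exact: (measurableT_comp (@measurable_behead _ _ n)).
  exact: (measurableT_comp IH mG).
by apply/funext => -[s w]/=; case/tupleP: w => b w /=; rewrite theadE.
Qed.

Lemma measurable_value_at s n :
  measurable_fun setT (fun w : n.-tuple B => value s w).
Proof. exact: (measurable_fun_pair2 s (@measurable_value n)). Qed.

Variables (Inv : S -> Prop) (V : S -> \bar R).
Hypothesis Inv_step : forall s b, Inv s -> Inv (step A f s b).
Hypothesis V_terminal : forall s, Inv s -> h s <= V s.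
Hypothesis mV : forall s, Inv s -> measurable_fun setT (fun b => V (step A f s b)).
Hypothesis V_super : forall s, Inv s -> c s + \int[P]_b V (step A f s b) <= V s.

(** Supermartingale argument by induction on the number of rounds, conditioning on the first block.
    The invariant confines the hypotheses on [V] to the states that can be reached. *)
Lemma value_le n s : Inv s -> \int[tuple_law P n]_w value s w <= V s.
Proof.
elim: n s => [|n IH] s Is.
  rewrite ge0_integral_tuple_law0; last first.
    exact: measurable_value_at.
  exact: V_terminal.
rewrite ge0_integral_tuple_lawS; first last.
- by move=> w; exact: value_ge0.
- exact: measurable_value_at.
have mv : measurable_fun setT
    (fun p : B * n.-tuple B => value (step A f s p.1) p.2).
  have mT : measurable_fun setT (fun p : B * n.-tuple B => (s, p.1)).
    exact: measurable_fun_pair.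
  have mG : measurable_fun setT (fun p : B * n.-tuple B => (step A f s p.1, p.2)).
    apply: measurable_fun_pair => //.
    exact: (measurableT_comp measurable_step mT).
  exact: (measurableT_comp (@measurable_value n) mG).
have mF := measurable_fun_fubini_tonelli_F (m2 := tuple_law P n) _ mv
   (fun p => value_ge0 _ _).
apply: le_trans (V_super Is).
rewrite (eq_integral (fun b => c s +
    \int[tuple_law P n]_w value (step A f s b) w)); last first.
  move=> b _; rewrite /= ge0_integralD//.
  - by rewrite integral_cst// [X in c s * X](_ : _ = 1) ?mule1//; exact: probability_setT.
  - by move=> w _; exact: value_ge0.
  - exact: measurable_value_at.
rewrite ge0_integralD//; last by move=> b _; apply: integral_ge0 => w _; exact: value_ge0.
rewrite integral_cst// [X in c s * X](_ : _ = 1); last exact: probability_setT.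
rewrite mule1 leeD2l//.
apply: ge0_le_integral => //.
- by move=> b _; apply: integral_ge0 => w _; exact: value_ge0.
- exact: mV.
- by move=> b _; apply: IH; exact: Inv_step.
Qed.

End machine_value.

Section machine_bound.
Context {R : realType} {d' : nat} {dS dB : measure_display}.
Context {S : measurableType dS} {B : measurableType dB}.
Local Notation X := 'rV[R]_d'.+1.
Variables (P : probability B R) (A : @machine R d' _ _ S B).
Local Open Scope ereal_scope.

(* [V] then dominates the expected sum of the running cost [c] and the terminal
   reward [h], however many steps are made. *)
Definition supersolution (f : X -> R) (Inv : S -> Prop) (c h V : S -> \bar R) :
    Prop :=
  [/\ forall s, Inv s -> h s <= V s,
      forall s, Inv s -> measurable_fun setT (fun b => V (step A f s b)) &
      forall s, Inv s -> c s + \int[P]_b V (step A f s b) <= V s].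

Definition waiting (s : S) : \bar R := (~~ accepted A s)%:R%:E.

Definition hit (D : set X) (s : S) : \bar R :=
  (accepted A s)%:R%:E * (\1_D (result A s))%:E.

Lemma measurable_waiting : measurable_fun setT waiting.
Proof.
rewrite (_ : waiting = fun s => if accepted A s then 0 else 1).
  by apply: measurable_fun_ifT => //; exact: measurable_accepted.
by apply/funext => s; rewrite /waiting; case: accepted.
Qed.

Lemma measurable_hit D : measurable D -> measurable_fun setT (hit D).
Proof.
move=> mD; apply: emeasurable_funM.
  rewrite (_ : (fun _ => _) = fun s => if accepted A s then 1 else 0).
    by apply: measurable_fun_ifT => //; exact: measurable_accepted.
  by apply/funext => s; case: accepted.
apply/measurable_EFinP.
exact: (measurableT_comp (measurable_indic mD) (measurable_result A)).
Qed.

Variable f : X -> R.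
Hypothesis mgrad : measurable_fun setT (grad f).

Lemma value_terminal (h : S -> \bar R) s (w : seq B) :
  value A f (cst 0) h s w = h (foldl (step A f) s w).
Proof. by elim: w s => //= b w IH s; rewrite add0e IH. Qed.

Lemma measurable_foldl_step s n :
  measurable_fun setT (fun w : n.-tuple B => foldl (step A f) s w).
Proof.
move: s; suff H : measurable_fun setT
    (fun p : S * n.-tuple B => foldl (step A f) p.1 p.2).
  by move=> s; exact: (measurable_fun_pair2 s H).
elim: n => [|n IH].
  rewrite (_ : (fun _ => _) = fst)//.
  by apply/funext => -[s w]/=; rewrite (tuple0 w).
have mT : measurable_fun setT (fun p : S * n.+1.-tuple B => (p.1, thead p.2)).
  apply: measurable_fun_pair => //.
  exact: (measurableT_comp (@measurable_thead _ _ n)).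
have mG : measurable_fun setT (fun p : S * n.+1.-tuple B =>
    (step A f p.1 (thead p.2), [tuple of behead p.2])).
  apply: measurable_fun_pair.
    exact: (measurableT_comp (measurable_step A mgrad) mT).
  exact: (measurableT_comp (@measurable_behead _ _ n)).
have := measurableT_comp IH mG; congr (measurable_fun _ _).
by apply/funext => -[s w]/=; case/tupleP: w => b w /=; rewrite theadE.
Qed.

Lemma measurable_terminal (h : S -> \bar R) s n : measurable_fun setT h ->
  measurable_fun setT (fun w : n.-tuple B => h (foldl (step A f) s w)).
Proof.
by move=> mh; exact: (measurableT_comp mh (@measurable_foldl_step s n)).
Qed.

Lemma value_running (c : S -> \bar R) s (w : seq B) :
  value A f c (cst 0) s w = \sum_(i < size w) c (foldl (step A f) s (take i w)).
Proof.
elim: w s => [|b w IH] s /=; first by rewrite big_ord0.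
by rewrite big_ord_recl/= IH.
Qed.

Variables (m : nat) (K eps : R).
Let N := m.+1.
Hypothesis KN : (K <= eps * N%:R)%R.

Variable Inv : S -> Prop.
Hypothesis Inv_init : Inv (init A).
Hypothesis Inv_step : forall s b, Inv s -> Inv (step A f s b).
Hypothesis gibbs0 : forall D, 0 <= gibbs f D.
Hypothesis gibbsC : forall D, measurable D -> gibbs f D + gibbs f (~` D) = 1.
Hypothesis hitV : forall D, measurable D -> exists2 V,
  supersolution f Inv (cst 0) (hit D) V & V (init A) <= gibbs f D.
Hypothesis waitU : exists2 U,
  supersolution f Inv waiting (cst 0) U & U (init A) <= K%:E.

Local Notation alg := (machine_algorithm P A m).
Local Notation law := (tuple_law P N).

Let state_atN (w : N.-tuple B) : state_at A f w N = foldl (step A f) (init A) w.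
Proof. by rewrite /state_at take_oversize// size_tuple. Qed.

Let waiting0 s : 0 <= waiting s. Proof. by rewrite lee_fin. Qed.

Let hit0 D s : 0 <= hit D s. Proof. by rewrite mule_ge0 ?lee_fin. Qed.

Lemma value_pending (w : N.-tuple B) :
  value A f waiting (cst 0) (init A) w = (pending A m f w)%:R%:E.
Proof.
rewrite value_running size_tuple /pending natr_sum -sumEFin.
by apply: eq_bigr => i _.
Qed.

Lemma integral_pending : \int[law]_w (pending A m f w)%:R%:E <= K%:E.
Proof.
have [U [Uh mU Us] UK] := waitU; apply: le_trans UK.
have := value_le mgrad (measurable_waiting) (measurable_cst 0) waiting0
  (fun=> lexx 0) Inv_step Uh mU Us N Inv_init.
by congr (_ <= _); apply: eq_integral => w _; rewrite value_pending.
Qed.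

(** Markov inequality: a run that is not accepted after [N] rounds has [pending] equal to [N], whose
    mean is at most [K], and [K <= eps * N]. *)
Lemma integral_waiting : \int[law]_w waiting (foldl (step A f) (init A) w) <= eps%:E.
Proof.
have mw : measurable_fun setT (fun w : N.-tuple B =>
    waiting (foldl (step A f) (init A) w)).
  by apply: measurable_terminal => //; exact: measurable_waiting.
have N0 : (0 < N%:R :> R)%R by [].
rewrite -(@lee_pmul2l _ N%:R%:E)//.
rewrite -ge0_integralZl//.
apply: (@le_trans _ _ K%:E); last by rewrite -EFinM lee_fin mulrC; exact: KN.
apply: le_trans integral_pending; apply: ge0_le_integral => //.
- by move=> w _; rewrite mule_ge0.
- exact: measurable_funeM.
- under eq_fun do rewrite -value_pending.
  by apply: measurable_value_at => //; exact: measurable_waiting.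
- move=> w _; rewrite /waiting -state_atN.
  case: (boolP (accepted A (state_at A f w N))) => [_|nacc] /=.
    by rewrite mule0 lee_fin.
  rewrite mule1 lee_fin ler_nat leqNgt; apply: contra nacc => pN.
  have [/andP[_ jN] _ /(_ pN) acc] := pendingP A m f w.
  by rewrite (state_at_accepted jN acc).
Qed.

(** An output in [D] comes either from an accepted run, accounted for by the supersolution of [hit],
    or from a run cut off before acceptance, an event of probability at most [eps]. *)
Lemma output_law_le D : measurable D -> output_law alg f D <= gibbs f D + eps%:E.
Proof.
move=> mD; have [V [Vh mV Vs] VD] := hitV mD.
have := value_le mgrad (measurable_cst 0) (measurable_hit mD) (fun=> lexx 0)
  (hit0 D) Inv_step Vh mV Vs N Inv_init.
move=> /le_trans/(_ VD) hD.
apply: le_trans (leeD hD integral_waiting).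
rewrite -ge0_integralD//; first last.
- by apply: measurable_terminal => //; exact: measurable_waiting.
- apply: measurable_value_at => //; exact: measurable_hit.
- by move=> w _; apply: value_ge0.
rewrite (_ : output_law alg f D =
    \int[law]_w (\1_D (result A (foldl (step A f) (init A) w)))%:E).
  apply: ge0_le_integral => //.
  - apply/measurable_EFinP.
    have mr : measurable_fun setT (fun s => \1_D (result A s) : R).
      exact: (measurableT_comp (measurable_indic mD) (measurable_result A)).
    exact: (measurableT_comp mr (@measurable_foldl_step (init A) N)).
  - apply: emeasurable_funD; first by apply: measurable_value_at => //; exact: measurable_hit.
    by apply: measurable_terminal => //; exact: measurable_waiting.
  - move=> w _; rewrite value_terminal /hit /waiting; case: accepted => /=.
      by rewrite mul1e adde0.
    by rewrite mul0e add0e lee_fin indicE lern1 leq_b1.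
rewrite (eq_integral (fun w => (\1_(final (A := alg) f @^-1` D) w)%:E)); last first.
  move=> w _; rewrite !indicE; congr ((nat_of_bool _)%:R%:E).
  by apply/idP/idP; rewrite !inE/= final_machine state_atN.
rewrite integral_indic ?setIT//.
by rewrite -[X in measurable X]setTI; exact: (measurable_final (A := alg) mgrad).
Qed.

(** Both laws have total mass 1, so the upper estimate for the complement of [D] is the lower
    estimate for [D]. *)
Lemma tv_dist_machine : tv_dist (output_law alg f) (gibbs f) <= eps%:E.
Proof.
apply: ub_ereal_sup => _ [D mD <-].
have mDC := measurableC mD.
have h1 := output_law_le mD; have h2 := output_law_le mDC.
have h3 := gibbsC mD; have h4 := gibbs0 D; have h5 := gibbs0 (~` D).
have h6 : output_law alg f D + output_law alg f (~` D) = 1.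
  rewrite /output_law /pushforward -measureU//=.
  - by rewrite -preimage_setU setUv preimage_setT; exact: probability_setT.
  - by rewrite -[X in measurable X]setTI; exact: (measurable_final (A := alg) mgrad).
  - by rewrite -[X in measurable X]setTI; exact: (measurable_final (A := alg) mgrad).
  - by rewrite -preimage_setI setICr preimage_set0.
have h7 : 0 <= output_law alg f D by exact: (measure_ge0 law).
have h8 : 0 <= output_law alg f (~` D) by exact: (measure_ge0 law).
move: h1 h2 h3 h4 h5 h6 h7 h8.
move: (output_law alg f D) (output_law alg f (~` D)) (gibbs f D) (gibbs f (~` D)) => a a' g g'.
case: a => [a||]; case: a' => [a'||]; case: g => [g||]; case: g' => [g'||] //=; rewrite ?lee_fin -?EFinD -?EFinN.
move=> h1 h2 [h3] h4 h5 [h6] h7 h8.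
by rewrite ler_norml; lra.
Qed.

Lemma expected_queries_machine : expected_queries alg f <= (2 * K)%:E.
Proof.
rewrite /expected_queries (eq_integral (fun w : N.-tuple B => 2%:E * (pending A m f w)%:R%:E)).
  rewrite ge0_integralZl//; first by rewrite EFinM lee_wpmul2l// integral_pending.
  under eq_fun do rewrite -value_pending.
  by apply: measurable_value_at => //; exact: measurable_waiting.
by move=> w _; rewrite num_queries_machine -muln2 natrM mulrC EFinM.
Qed.

Lemma ae_num_queries_machine : {ae law, forall w, num_queries (A := alg) f w < +oo}.
Proof. by apply: aeW => w; rewrite num_queries_machine ltry. Qed.

End machine_bound.

(** * The sampler *)

Section measurable_misc.
Context d (T : measurableType d) (R : realType).

Lemma measurable_fun_nat_param d2 (T2 : measurableType d2) (F : nat -> T -> T2) :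
  (forall n, measurable_fun setT (F n)) ->
  measurable_fun setT (fun p : T * nat => F p.2 p.1).
Proof.
move=> mF _ Y mY; rewrite setTI.
rewrite (_ : _ @^-1` _ = \bigcup_n ((F n @^-1` Y) `*` [set n])).
  apply: bigcupT_measurable => n; apply: measurableX => //.
  by rewrite -[X in measurable X]setTI; exact: mF.
apply/seteqP; split => [[x n] /= Yx|[x n] [k _ /= [Yx ->]]//].
by exists n.
Qed.

Lemma measurable_rVD n (f g : T -> 'rV[R]_n) : measurable_fun setT f ->
  measurable_fun setT g -> measurable_fun setT (fun x => f x + g x).
Proof.
move=> mf mg; apply: measurable_fun_rVP => i; under eq_fun do rewrite mxE.
apply: measurable_funD.
  exact: (measurableT_comp (measurable_coord i) mf).
exact: (measurableT_comp (measurable_coord i) mg).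
Qed.

Lemma measurable_rVZ n (c : T -> R) (g : T -> 'rV[R]_n) : measurable_fun setT c ->
  measurable_fun setT g -> measurable_fun setT (fun x => c x *: g x).
Proof.
move=> mf mg; apply: measurable_fun_rVP => i; under eq_fun do rewrite mxE.
apply: measurable_funM => //.
exact: (measurableT_comp (measurable_coord i) mg).
Qed.

Lemma measurable_rVB n (f g : T -> 'rV[R]_n) : measurable_fun setT f ->
  measurable_fun setT g -> measurable_fun setT (fun x => f x - g x).
Proof.
move=> mf mg; under eq_fun do rewrite -scaleN1r.
by apply: measurable_rVD => //; exact: measurable_rVZ.
Qed.

End measurable_misc.

(** * Poisson sums *)

Section poisson_sums.
Context {R : realType}.
Local Open Scope ereal_scope.

Lemma poisson_total (M : R) : (0 < M)%R ->
  \sum_(n <oo) (poisson_pmf M n)%:E = 1.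
Proof.
move=> M0; rewrite -(probability_setT (poisson_prob M 0)).
rewrite nneseries_esumT.
  by transitivity (poisson_prob M 0 setT) => //; rewrite /poisson_prob M0.
by move=> n; rewrite lee_fin poisson_pmf_ge0.
Qed.

(** For [q > 0] the series is the stated constant times the total mass of the Poisson law of
    parameter [M * q]; for [q = 0] only the term of index 0 remains. *)
Lemma poisson_pgf (M q : R) : (0 < M)%R -> (0 <= q)%R ->
  \sum_(n <oo) (q ^+ n * poisson_pmf M n)%:E = (expR (- (M * (1 - q))))%:E.
Proof.
move=> M0; rewrite le_eqVlt => /predU1P[<-|q0].
  rewrite nneseries_recl//; last first.
    by move=> n; rewrite lee_fin mulr_ge0 ?poisson_pmf_ge0// exprn_ge0.
  rewrite eseries0 ?adde0 => [|[]// n _ _]; last by rewrite exprS !mul0r.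
  by rewrite /poisson_pmf M0 expr0 fact0 subr0 mulr1 invr1 !mul1r.
have Mq0 : (0 < M * q)%R by rewrite mulr_gt0.
rewrite -[RHS]mule1 -(poisson_total Mq0) -nneseriesZl; last first.
  by move=> n _; rewrite lee_fin poisson_pmf_ge0.
apply: eq_eseriesr => n _; rewrite -EFinM; congr EFin.
rewrite /poisson_pmf M0 Mq0 exprMn.
rewrite (_ : expR (- M) = expR (- (M * (1 - q))) * expR (- (M * q)))%R; last first.
  by rewrite -expRD; congr expR; ring.
ring.
Qed.

Lemma nneseries_shift1 (u : nat -> \bar R) : (forall n, 0 <= u n) ->
  \sum_(1 <= n <oo) u n = \sum_(n <oo) u n.+1.
Proof.
move=> u0; apply/esym/cvg_lim => //.
have : (fun n => \sum_(1 <= k < n) u k) @ \oo --> \sum_(1 <= n <oo) u n.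
  exact: is_cvg_nneseries.
rewrite -cvg_shiftS; under eq_fun do rewrite big_add1/=.
exact.
Qed.

(** The term [n + 1] of the series is [M] times the Poisson weight of [n]. *)
Lemma poisson_mean (M : R) : (0 < M)%R ->
  \sum_(n <oo) (n%:R * poisson_pmf M n)%:E = M%:E.
Proof.
move=> M0.
have p0 n : 0 <= (n%:R * poisson_pmf M n)%:E.
  by rewrite lee_fin mulr_ge0// poisson_pmf_ge0.
rewrite nneseries_recl//= mul0r add0e nneseries_shift1//.
rewrite (eq_eseriesr (g := fun n => M%:E * (1 ^+ n * poisson_pmf M n)%:E)).
  rewrite nneseriesZl; last first.
    by move=> n _; rewrite lee_fin mulr_ge0 ?poisson_pmf_ge0// exprn_ge0.
  by rewrite poisson_pgf// subrr mulr0 oppr0 expR0 mule1.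
move=> n _; rewrite -EFinM; congr EFin.
rewrite /poisson_pmf M0 factS exprS natrM invfM expr1n.
by field; rewrite pnatr_eq0 -lt0n fact_gt0 nat1r pnatr_eq0.
Qed.

End poisson_sums.

HB.instance Definition _ (R : realType) :=
  @Measure_isSigmaFinite.Build _ _ _ (@counting nat R) (sigma_finite_counting R).

(** * The joint law of a proposal and its number of tests *)

Section proposal_law.
Context {R : realType} (d : nat).
Local Open Scope ereal_scope.
Local Notation X := 'rV[R]_d.

(* [8 = 2 C] where [C = 4] bounds [|grad f y|^2] at the centre [y] reached by
   gradient descent, so that [|z - grad f y|^2 <= rate z]. *)
Definition rate (z : X) : R := (2 * dotp z z + 8)%R.

Lemma rate_gt0 z : (0 < rate z)%R.
Proof. by rewrite /rate; have := dotp_ge0 z; lra. Qed.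

Lemma measurable_rate : measurable_fun setT rate.
Proof.
apply: measurable_funD => //; apply: measurable_funM => //.
exact: measurable_dotp.
Qed.

Definition gaussian_mass : R := fine (\int[lebesgue_rV d]_v (gaussian 2^-1 v)%:E).

Lemma gaussian_massE :
  \int[lebesgue_rV d]_v (gaussian 2^-1 v)%:E = gaussian_mass%:E.
Proof.
by have [J J0 HJ] := @integral_gaussian R d 2^-1 ltac:(lra); rewrite /gaussian_mass HJ.
Qed.

Lemma gaussian_mass_gt0 : (0 < gaussian_mass)%R.
Proof.
by have [J J0 HJ] := @integral_gaussian R d 2^-1 ltac:(lra); rewrite /gaussian_mass HJ.
Qed.

(** The Poisson parameter depends on the Gaussian proposal, so the pair is given by a density with
    respect to Lebesgue times counting measure. It does not involve [f], as must be the case for a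
    seed drawn before any reply. *)
Definition proposal_density (p : X * nat) : R :=
  (gaussian_mass^-1 * gaussian 2^-1 p.1 * poisson_pmf (rate p.1) p.2)%R.

Lemma proposal_density_ge0 p : (0 <= proposal_density p)%R.
Proof.
by rewrite !mulr_ge0 ?poisson_pmf_ge0 ?expR_ge0// invr_ge0 ltW// gaussian_mass_gt0.
Qed.

Lemma measurable_proposal_density : measurable_fun setT proposal_density.
Proof.
apply: (@measurable_fun_nat_param _ X _ _ (fun n z => proposal_density (z, n))) => n.
apply: measurable_funM.
  by apply: measurable_funM => //; exact: measurable_gaussian.
exact: (measurableT_comp (measurable_poisson_pmf n measurableT) measurable_rate).
Qed.

Lemma integral_proposal_base (h : X -> nat -> R) :
  (forall n, measurable_fun setT (h ^~ n)) -> (forall z n, (0 <= h z n)%R) ->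
  \int[lebesgue_rV d \x @counting nat R]_p ((h p.1 p.2)%:E * (proposal_density p)%:E) =
  (gaussian_mass^-1)%:E * \int[lebesgue_rV d]_z ((gaussian 2^-1 z)%:E *
     \sum_(n <oo) (h z n * poisson_pmf (rate z) n)%:E).
Proof.
move=> mh h0.
have mF : measurable_fun setT
    (fun p : X * nat => (h p.1 p.2)%:E * (proposal_density p)%:E).
  apply: emeasurable_funM; apply/measurable_EFinP.
    exact: (@measurable_fun_nat_param _ X _ _ (fun n z => h z n)).
  exact: measurable_proposal_density.
have F0 (p : X * nat) : 0 <= (h p.1 p.2)%:E * (proposal_density p)%:E.
  by rewrite mule_ge0// lee_fin ?proposal_density_ge0.
have g0 : (0 <= gaussian_mass^-1)%R by rewrite invr_ge0 ltW// gaussian_mass_gt0.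
have s0 z n : 0 <= (h z n * poisson_pmf (rate z) n)%:E.
  by rewrite lee_fin mulr_ge0// poisson_pmf_ge0.
transitivity (\int[lebesgue_rV d]_z \int[@counting nat R]_n
    ((h z n)%:E * (proposal_density (z, n))%:E)).
  exact: (fubini_tonelli1 _ mF F0).
rewrite -ge0_integralZl//.
- apply: eq_integral => z _; rewrite ge0_integral_count; last first.
    by move=> n; rewrite mule_ge0// lee_fin ?proposal_density_ge0.
  rewrite muleA -EFinM -nneseriesZl//.
  by apply: eq_eseriesr => n _; rewrite -!EFinM /proposal_density/= mulrCA.
- apply: emeasurable_funM; first by apply/measurable_EFinP; exact: measurable_gaussian.
  apply: ge0_emeasurable_sum => // n _; apply/measurable_EFinP/measurable_funM => //.
  exact: (measurableT_comp (measurable_poisson_pmf n measurableT) measurable_rate).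
- by move=> z _; rewrite mule_ge0// ?lee_fin ?expR_ge0//; exact: nneseries_ge0.
Qed.

Lemma proposal_density_total :
  \int[lebesgue_rV d \x @counting nat R]_p (proposal_density p)%:E = 1.
Proof.
have := @integral_proposal_base (fun _ _ => 1%R) (fun=> measurable_cst _) (fun _ _ => ler01).
under eq_integral do rewrite mul1e.
move=> ->; under eq_integral.
  move=> z _; under eq_eseriesr do rewrite mul1r.
  rewrite poisson_total ?rate_gt0// mule1; over.
by rewrite gaussian_massE -EFinM mulVf// lt0r_neq0// gaussian_mass_gt0.
Qed.

Definition proposal_law : probability (X * nat)%type R :=
  density_law measurable_proposal_density proposal_density_ge0
    proposal_density_total.

Lemma integral_proposal_law (h : X -> nat -> R) :
  (forall n, measurable_fun setT (h ^~ n)) -> (forall z n, (0 <= h z n)%R) ->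
  \int[proposal_law]_p (h p.1 p.2)%:E =
  (gaussian_mass^-1)%:E * \int[lebesgue_rV d]_z ((gaussian 2^-1 z)%:E *
     \sum_(n <oo) (h z n * poisson_pmf (rate z) n)%:E).
Proof.
move=> mh h0; rewrite -integral_proposal_base//.
apply: (ge0_integral_density_law measurable_proposal_density
  proposal_density_ge0 proposal_density_total).
  apply/measurable_EFinP.
  exact: (@measurable_fun_nat_param _ X _ _ (fun n z => h z n)).
by move=> p; rewrite lee_fin.
Qed.

End proposal_law.

Ltac measurable_proj := repeat first
  [ exact: measurable_fst | exact: measurable_snd | exact: measurable_id
  | apply: (measurableT_comp measurable_fst)
  | apply: (measurableT_comp measurable_snd) ].

(** * States and transitions of the sampler *)

Section sampler.
Context {R : realType} (d' : nat).
Local Notation X := 'rV[R]_d'.+1.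
Local Notation T := (measurableTypeR R).

(* A state [((j, n), (y, (g, u)))]: for [j >= 2], gradient descent with [j - 1]
   steps left, currently at [y]; for [j = 1], about to draw a proposal around the
   centre [y]; for [j = 0], the proposal [y + u] has [n] thinning tests left. *)
Local Notation S := ((nat * nat) * (X * (X * X)))%type.
Local Notation B := ((X * nat) * (T * T))%type.

Definition sampler_probe (p : B * S) : X :=
  if p.2.1.1 == 0%N then p.2.2.1 + p.1.2.1 *: p.2.2.2.2 else p.2.2.1.

(* With [g = grad f y] and [r = grad f (y + t *: u)], its integral over [t] in
   [0, 1] is [excess f y u]. *)
Definition test_rate (g u r : X) (t : R) : R := dotp (r - g) u - t * dotp u u.

(** A point of the thinned process ([v * rate] below the test rate) means rejection and sends the
    state back to [j = 1] with the same centre. Here [u + g] is the Gaussian displacement from which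
    the number of tests was drawn, so the threshold uses the same [rate]. *)
Definition sampler_update (p : B * S * X) : S :=
  let: (((z, n'), (t, v)), ((j, n), (y, (g, u))), r) := p in
  if j == 0%N then
    if n == 0%N then ((j, n), (y, (g, u)))
    else if v * rate (u + g) <= test_rate g u r t
         then ((1%N, 0%N), (y, (g, u))) else ((0%N, n.-1), (y, (g, u)))
  else if j == 1%N then ((0%N, n'), (y, (r, z - r)))
  else ((j.-1, 0%N), (y - 2^-1 *: r, (g, u))).

Definition sampler_accepted (s : S) : bool := (s.1.1 == 0%N) && (s.1.2 == 0%N).

Definition sampler_result (s : S) : X := s.2.1 + s.2.2.2.

Lemma measurable_sampler_probe : measurable_fun setT sampler_probe.
Proof.
apply: measurable_fun_ifT.
- by apply: measurable_fun_eqn => //; measurable_proj.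
- apply: measurable_rVD; first by measurable_proj.
  by apply: measurable_rVZ; measurable_proj.
- by measurable_proj.
Qed.

Lemma measurable_of_nat dT (U : measurableType dT) (f : nat -> U) :
  measurable_fun setT f.
Proof. by []. Qed.

Lemma measurable_sampler_update : measurable_fun setT sampler_update.
Proof.
rewrite (_ : sampler_update = fun p : B * S * X =>
  let: b := p.1.1 in let: s := p.1.2 in
  if s.1.1 == 0%N then
    if s.1.2 == 0%N then s
    else if b.2.2 * rate (s.2.2.2 + s.2.2.1) <= test_rate s.2.2.1 s.2.2.2 p.2 b.2.1
         then ((1%N, 0%N), s.2) else ((0%N, s.1.2.-1), s.2)
  else if s.1.1 == 1%N then ((0%N, b.1.2), (s.2.1, (p.2, b.1.1 - p.2)))
  else ((s.1.1.-1, 0%N), (s.2.1 - 2^-1 *: p.2, s.2.2))).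
  have mj : measurable_fun setT (fun p : B * S * X => p.1.2.1.1) by measurable_proj.
  have mn : measurable_fun setT (fun p : B * S * X => p.1.2.1.2) by measurable_proj.
  have ms : measurable_fun setT (fun p : B * S * X => p.1.2) by measurable_proj.
  have ms2 : measurable_fun setT (fun p : B * S * X => p.1.2.2) by measurable_proj.
  have mr : measurable_fun setT (fun p : B * S * X => p.2) by measurable_proj.
  have mg : measurable_fun setT (fun p : B * S * X => p.1.2.2.2.1) by measurable_proj.
  have mu : measurable_fun setT (fun p : B * S * X => p.1.2.2.2.2) by measurable_proj.
  have mt : measurable_fun setT (fun p : B * S * X => p.1.1.2.1) by measurable_proj.
  have mv : measurable_fun setT (fun p : B * S * X => p.1.1.2.2) by measurable_proj.
  have mz : measurable_fun setT (fun p : B * S * X => p.1.1.1.1) by measurable_proj.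
  have my : measurable_fun setT (fun p : B * S * X => p.1.2.2.1) by measurable_proj.
  have mn' : measurable_fun setT (fun p : B * S * X => p.1.1.1.2) by measurable_proj.
  apply: measurable_fun_ifT; first exact: measurable_fun_eqn.
    apply: measurable_fun_ifT; [exact: measurable_fun_eqn|exact: ms|].
    apply: measurable_fun_ifT.
    - apply: measurable_fun_ler.
        apply: measurable_funM => //.
        apply: (measurableT_comp (@measurable_rate R _)); exact: measurable_rVD.
      apply: measurable_funB; first by apply: measurable_dotp => //; exact: measurable_rVB.
      by apply: measurable_funM => //; exact: measurable_dotp.
    - exact: measurable_fun_pair.
    - apply: measurable_fun_pair => //; apply: measurable_fun_pair => //.
      exact: (measurableT_comp (@measurable_of_nat _ _ predn) mn).
  apply: measurable_fun_ifT; first exact: measurable_fun_eqn.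
    apply: measurable_fun_pair; first exact: measurable_fun_pair.
    apply: measurable_fun_pair => //; apply: measurable_fun_pair => //.
    exact: measurable_rVB.
  apply: measurable_fun_pair.
    apply: measurable_fun_pair => //.
    exact: (measurableT_comp (@measurable_of_nat _ _ predn) mj).
  apply: measurable_fun_pair; last by measurable_proj.
  by apply: measurable_rVB => //; exact: measurable_rVZ.
by apply/funext => -[[[[z n'] [t v]] [[j n] [y [g u]]]] r].
Qed.

Lemma measurable_sampler_accepted : measurable_fun setT sampler_accepted.
Proof.
by apply: measurable_and; apply: measurable_fun_eqn => //; measurable_proj.
Qed.

Lemma measurable_sampler_result : measurable_fun setT sampler_result.
Proof. by apply: measurable_rVD; measurable_proj. Qed.

Lemma sampler_absorbing b s g : sampler_accepted s -> sampler_update (b, s, g) = s.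
Proof.
case: b s => [[z n'] [t v]] [[j n] [y [h u]]].
by rewrite /sampler_accepted/= => /andP[/eqP -> /eqP ->].
Qed.

(** The initial counter [k.+1] stands for [k] descent steps from the origin followed by the draw of
    a proposal. *)
Definition sampler (k : nat) : @machine R d' _ _ S B :=
  @Machine R d' _ _ S B ((k.+1, 0%N), (0, (0, 0))) sampler_probe sampler_update
    sampler_accepted sampler_result measurable_sampler_probe
    measurable_sampler_update measurable_sampler_accepted
    measurable_sampler_result isT sampler_absorbing.

Definition sampler_law : probability B R :=
  (proposal_law d'.+1 \x (unit_law \x unit_law))%E.

End sampler.

Lemma integral_probability_cst d (T : measurableType d) (R : realType)
  (P : probability T R) (r : \bar R) : (\int[P]_x r = r)%E.
Proof.
rewrite [LHS](integral_cst P measurableT) [X in (_ * X)%E](_ : _ = 1%E) ?mule1//.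
exact: probability_setT.
Qed.

Section product_integrals.
Context d1 d2 (T1 : measurableType d1) (T2 : measurableType d2) (R : realType).
Variables (P1 : probability T1 R) (P2 : probability T2 R).
Local Open Scope ereal_scope.

Lemma integral_product_fst (h : T1 -> \bar R) : measurable_fun setT h ->
  (forall x, 0 <= h x) -> \int[P1 \x P2]_p h p.1 = \int[P1]_x h x.
Proof.
move=> mh h0; rewrite fubini_tonelli1//=; last exact: (measurableT_comp mh).
apply: eq_integral => x _; rewrite /fubini_F/= integral_cst//.
by rewrite [X in _ * X](_ : _ = 1) ?mule1//; exact: probability_setT.
Qed.

Lemma integral_product_snd (h : T2 -> \bar R) : measurable_fun setT h ->
  (forall x, 0 <= h x) -> \int[P1 \x P2]_p h p.2 = \int[P2]_x h x.
Proof.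
move=> mh h0; rewrite fubini_tonelli1//=; last exact: (measurableT_comp mh).
rewrite (eq_integral (cst (\int[P2]_x h x)))//.
rewrite integral_cst//.
by rewrite [X in _ * X](_ : _ = 1) ?mule1//; exact: probability_setT.
Qed.

End product_integrals.

(** * Potential functions for the sampler *)

Section sampler_analysis.
Context {R : realType} (d' : nat).
Local Notation X := 'rV[R]_d'.+1.
Local Notation T := (measurableTypeR R).
Local Notation S := ((nat * nat) * (X * (X * X)))%type.
Local Notation B := ((X * nat) * (T * T))%type.
Variables (f : X -> R) (xs : X) (k : nat).
Hypothesis hf : smooth_strongly_convex 2 1 f.
Hypothesis fxs : minimizer f xs.
Local Notation A := (@sampler R d' k).

(** Each descent step halves the gap to the minimum while the counter drops by one, so the gap is at
    most 1 when proposals begin. *)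
Definition sampler_inv (s : S) : Prop :=
  if s.1.1 is j.+1 then f s.2.1 - f xs <= 2 ^+ j
  else s.2.2.1 = grad f s.2.1 /\ f s.2.1 - f xs <= 1.

Lemma step_descent j n y w b : step A f ((j.+2, n), (y, w)) b =
  ((j.+1, 0%N), (y - 2^-1 *: grad f y, w)).
Proof. by case: b w => [[z n'] [t v]] [g u]. Qed.

Lemma step_fresh n y w b : step A f ((1%N, n), (y, w)) b =
  ((0%N, b.1.2), (y, (grad f y, b.1.1 - grad f y))).
Proof. by case: b w => [[z n'] [t v]] [g u]. Qed.

Lemma step_test n y u b : step A f ((0%N, n.+1), (y, (grad f y, u))) b =
  if b.2.2 * rate (u + grad f y) <= excess_rate f y u b.2.1
  then ((1%N, 0%N), (y, (grad f y, u))) else ((0%N, n), (y, (grad f y, u))).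
Proof. by case: b => [[z n'] [t v]]. Qed.

Lemma step_accepted y w b : step A f ((0%N, 0%N), (y, w)) b = ((0%N, 0%N), (y, w)).
Proof. by case: b w => [[z n'] [t v]] [g u]. Qed.

Lemma sampler_inv_step s b : sampler_inv s -> sampler_inv (step A f s b).
Proof.
case: s => [[[|[|j]] n] [y [g u]]].
- move=> [gE fy]; have {gE}-> : g = grad f y by []; case: n fy => [|n] fy; first by rewrite step_accepted.
  by rewrite step_test; case: ifP => _ //; rewrite /sampler_inv/= expr0.
- by rewrite step_fresh /sampler_inv/= expr0.
- rewrite step_descent /sampler_inv/= => fy.
  have := gradient_step_contraction hf y xs; move: fy; rewrite exprS; lra.
Qed.

(* The probability that the proposal [y + u] passes one thinning test. *)
Definition survive (y g u : X) : R := 1 - excess f y u / rate (u + g).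

Lemma excess_le_rate y u : f y - f xs <= 1 ->
  dotp u u <= rate (u + grad f y).
Proof.
move=> fy; have := grad_gap hf y fxs; have := dotp_sub_le (u + grad f y) (grad f y).
rewrite addrK /rate; lra.
Qed.

Lemma survive01 y u : f y - f xs <= 1 -> 0 <= survive y (grad f y) u <= 1.
Proof.
move=> fy; have := excess_le_rate u fy; have := excess_le hf y u.
have e0 := excess_ge0 hf y u; have M0 := rate_gt0 (u + grad f y); have := dotp_ge0 u.
move=> u0 eu uM; rewrite /survive.
have h : excess f y u / rate (u + grad f y) <= 1.
  by rewrite ler_pdivrMr// mul1r; lra.
have h0 : 0 <= excess f y u / rate (u + grad f y) by rewrite divr_ge0// ltW.
by rewrite subr_ge0 h/=; lra.
Qed.

Lemma measurable_survive y g : measurable_fun setT (survive y g).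
Proof.
apply: measurable_funB => //; apply: measurable_funM.
  exact: measurable_excess.
have mr := measurableT_comp (@measurable_rate R _) (measurable_rV_add g).
have := measurableT_comp (@measurable_powR R (-1)) mr.
congr (measurable_fun _ _); apply/funext => u /=.
by rewrite powR_inv1// ltW// rate_gt0.
Qed.

Lemma measurable_excess_rate y u : measurable_fun setT (excess_rate f y u).
Proof. by apply: continuous_measurable_fun; exact: continuous_excess_rate. Qed.

Local Open Scope ereal_scope.
Local Notation PB := (@sampler_law R d').
Local Notation PZ := (@proposal_law R d'.+1).
Local Notation gm := (@gaussian_mass R d'.+1).

(** Poisson thinning: with [n] Poisson of parameter [rate z], the mean of
    [(1 - excess / rate z) ^ n] is [expR (- excess)], and the choice of parameter drops out. *)
Lemma integral_survive_pow y (a : X -> R) : (f y - f xs <= 1)%R ->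
  measurable_fun setT a -> (forall z, (0 <= a z)%R) ->
  \int[PZ]_p (survive y (grad f y) (p.1 - grad f y) ^+ p.2 * a p.1)%:E =
  gm^-1%:E * \int[lebesgue_rV d'.+1]_z (accept_weight f y z * a z)%:E.
Proof.
move=> fy ma a0.
have s0 u : (0 <= survive y (grad f y) u)%R by have /andP[] := survive01 u fy.
rewrite (@integral_proposal_law R _ (fun z n =>
  survive y (grad f y) (z - grad f y) ^+ n * a z)%R); first last.
- by move=> z n; rewrite mulr_ge0// exprn_ge0.
- move=> n; apply: measurable_funM => //; apply: measurable_funX.
  exact: (measurableT_comp (measurable_survive y _) (measurable_rV_add (- grad f y))).
congr (_ * _); apply: eq_integral => z _.
set q := survive _ _ _.
under eq_eseriesr do rewrite mulrAC mulrC EFinM.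
rewrite nneseriesZl; last first.
  by move=> n _; rewrite lee_fin mulr_ge0 ?poisson_pmf_ge0// exprn_ge0// s0.
rewrite (poisson_pgf (rate_gt0 z) (s0 _)) -!EFinM; congr EFin.
rewrite /accept_weight [(a z * _)%R]mulrC mulrA; congr (_ * expR (- _) * _)%R.
rewrite /q /survive subKr subrK mulrCA divff ?mulr1//.
by rewrite lt0r_neq0// rate_gt0.
Qed.

Section potential.
Variables (dl rho : R) (a : X -> R).
Hypotheses (dl0 : (0 <= dl)%R) (rho0 : (0 <= rho)%R).
Hypotheses (ma : measurable_fun setT a) (a0 : forall x, (0 <= a x)%R).

(** The charge [n%:R * dl] covers all planned tests although a failed test cancels the rest; the
    true value is thus overestimated, but the formula stays explicit. *)
Definition pending_value (n : nat) (y g u : X) : R :=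
  (n%:R * dl + (survive y g u ^+ n * a (y + u) + (1 - survive y g u ^+ n) * rho))%R.

(* [dl] is the cost per round, [a] the reward on acceptance, [rho] the value of
   starting afresh. *)
Definition potential (s : S) : R :=
  if s.1.1 is j.+1 then (j%:R * dl + rho)%R
  else pending_value s.1.2 s.2.1 s.2.2.1 s.2.2.2.

Hypothesis fresh_le : forall y, (f y - f xs <= 1)%R ->
  dl%:E + \int[PZ]_p (pending_value p.2 y (grad f y) (p.1 - grad f y))%:E <= rho%:E.

Lemma pending_value_ge0 n y u : (f y - f xs <= 1)%R ->
  (0 <= pending_value n y (grad f y) u)%R.
Proof.
move=> fy; have /andP[s0 s1] := survive01 u fy.
rewrite !addr_ge0 ?mulr_ge0 ?exprn_ge0// subr_ge0.
by rewrite exprn_ile1.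
Qed.

Lemma measurable_pending_value y g : measurable_fun setT
  (fun p : X * nat => pending_value p.2 y g (p.1 - g)).
Proof.
apply: (@measurable_fun_nat_param _ X _ _ (fun n z => pending_value n y g (z - g))) => n.
have ms : measurable_fun setT (fun z : X => survive y g (z - g)).
  exact: (measurableT_comp (measurable_survive y g) (measurable_rV_add (- g)%R)).
apply: measurable_funD => //; apply: measurable_funD.
  apply: measurable_funM; first exact: measurable_funX.
  have -> : (fun z => a (y + (z - g))%R) = a \o (fun z => z + (y - g))%R.
    by apply/funext => z /=; rewrite addrCA.
  exact: (measurableT_comp ma (measurable_rV_add _)).
apply: measurable_funM => //; apply: measurable_funB => //.
exact: measurable_funX.
Qed.

Lemma potential_terminal s : sampler_inv s ->
  (sampler_accepted s)%:R%:E * (a (sampler_result s))%:E <= (potential s)%:E.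
Proof.
case: s => [[[|j] n] [y [g u]]]; rewrite -EFinM lee_fin /potential/=.
  move=> [gE fy]; have {gE}-> : g = grad f y by [].
  have {}fy : (f y - f xs <= 1)%R by [].
  case: n => [|n]; last by rewrite mul0r pending_value_ge0.
  by rewrite /pending_value /sampler_result/= mul0r add0r expr0 subrr mul0r addr0.
by move=> _; rewrite mul0r addr_ge0// mulr_ge0.
Qed.

Lemma measurable_potential_step s : sampler_inv s ->
  measurable_fun setT (fun b => (potential (step A f s b))%:E).
Proof.
move=> Is; apply/measurable_EFinP; case: s Is => [[[|[|j]] n] [y [g u]]].
- move=> [gE fy]; have {gE}-> : g = grad f y by [].
  have {}fy : (f y - f xs <= 1)%R by [].
  case: n => [|n]; first by
    under eq_fun do rewrite step_accepted; exact: measurable_cst.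
  under eq_fun do rewrite step_test (fun_if potential).
  apply: measurable_fun_ifT => //; apply: measurable_fun_ler.
    by apply: measurable_funM => //; measurable_proj.
  have mt : measurable_fun setT (fun b : B => b.2.1) by measurable_proj.
  exact: (measurableT_comp (measurable_excess_rate y u) mt).
- move=> _; under eq_fun do rewrite step_fresh.
  have mb : measurable_fun setT (fun b : B => b.1) by measurable_proj.
  exact: (measurableT_comp (measurable_pending_value y (grad f y)) mb).
- by move=> _; under eq_fun do rewrite step_descent; exact: measurable_cst.
Qed.

Lemma potential_super s : sampler_inv s ->
  dl%:E * waiting A s + \int[PB]_b (potential (step A f s b))%:E <= (potential s)%:E.
Proof.
case: s => [[[|[|j]] n] [y [g u]]].
- move=> [gE fy]; have {gE}-> : g = grad f y by [].
  have {}fy : (f y - f xs <= 1)%R by [].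
  case: n => [|n].
    under eq_integral do rewrite step_accepted.
    by rewrite integral_probability_cst /waiting mule0 add0e.
  pose M := rate (u + grad f y); have M0 : (0 < M)%R by exact: rate_gt0.
  have mx : measurable_fun setT (excess_rate f y u).
    exact: measurable_excess_rate.
  have p0 := pending_value_ge0 n u fy.
  rewrite (eq_integral (fun b : B => (fun q : T * T =>
      if (q.2 * M <= excess_rate f y u q.1)%R then rho%:E
      else (pending_value n y (grad f y) u)%:E) b.2)); last first.
    move=> b _; rewrite step_test; case: ifP => _ //.
    by rewrite /potential/= mul0r add0r.
  have mif : measurable_fun setT (fun q : T * T =>
      if (q.2 * M <= excess_rate f y u q.1)%R then rho%:E
      else (pending_value n y (grad f y) u)%:E).
    apply: measurable_fun_ifT => //; apply: measurable_fun_ler.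
      exact: measurable_funM.
    exact: (measurableT_comp mx).
  have if0 (q : T * T) : 0 <= (if (q.2 * M <= excess_rate f y u q.1)%R then rho%:E
      else (pending_value n y (grad f y) u)%:E).
    by case: ifP; rewrite lee_fin.
  rewrite (integral_product_snd _ _ mif if0) (fubini_tonelli1 _ mif if0).
  rewrite (integral_coin (e := excess f y u) M0 mx)//; first last.
  - exact: integral_excess_rate.
  - move=> t t0 t1; rewrite excess_rate_ge0//=.
    exact: le_trans (excess_rate_le hf y u t0 t1) (excess_le_rate u fy).
  rewrite -!EFinM -!EFinD lee_fin /waiting/= /potential/= /pending_value.
  rewrite -/M exprS -[n.+1%:R]natr1.
  have -> : survive y (grad f y) u = (1 - excess f y u / M)%R by [].
  have /andP[_ +] := survive01 u fy; rewrite /survive -/M lerBlDr lerDl.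
  move: (excess f y u / M)%R => q q0; move: ((1 - q) ^+ n)%R => w.
  have nq : (0 <= q * (n%:R * dl))%R by rewrite !mulr_ge0.
  (* The surplus: with probability [q] the test fails and the [n] remaining charges are waived. *)
  by rewrite -subr_ge0 (_ : (_ - _)%R = (q * (n%:R * dl))%R)//; ring.
- move=> fy; have {}fy : (f y - f xs <= 1)%R by move: fy; rewrite /sampler_inv/= expr0.
  under eq_integral do rewrite step_fresh.
  rewrite (_ : potential _ = rho); last by rewrite /potential/= mul0r add0r.
  apply: le_trans (fresh_le fy); rewrite /waiting/= mule1 leeD2l//.
  rewrite (@integral_product_fst _ _ _ _ R _ _ (fun p : X * nat =>
     (pending_value p.2 y (grad f y) (p.1 - grad f y))%:E))//.
  + by apply/measurable_EFinP; exact: measurable_pending_value.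
  + by move=> p; rewrite lee_fin pending_value_ge0.
- move=> _; under eq_integral do rewrite step_descent.
  rewrite integral_probability_cst /waiting/= mule1 -EFinD lee_fin /potential/=.
  by rewrite -natr1; lra.
Qed.

End potential.

End sampler_analysis.

Section sampler_constants.
Context {R : realType} (d : nat).
Local Notation X := 'rV[R]_d.
Local Open Scope ereal_scope.
Local Notation PZ := (@proposal_law R d).
Local Notation gm := (@gaussian_mass R d).

(** The mean number of tests of a proposal is the Gaussian mean of [rate], a quantity depending on
    the dimension only. *)
Lemma proposal_meanP : exists2 m : R, (0 <= m)%R &
  \int[PZ]_p (p.2%:R : R)%:E = m%:E.
Proof.
have [I4 I40 HI4] := @integral_gaussian R d 4^-1 ltac:(lra).
have mg b : measurable_fun setT (fun z : X => (gaussian b z)%:E).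
  by apply/measurable_EFinP; exact: measurable_gaussian.
have gm0 := @gaussian_mass_gt0 R d.
have lb : 0 <= \int[PZ]_p (p.2%:R : R)%:E by apply: integral_ge0 => p _; rewrite lee_fin.
have ub : \int[PZ]_p (p.2%:R : R)%:E <= (gm^-1 * (8 * (I4 + gm)))%:E.
  rewrite (@integral_proposal_law R _ (fun z n => n%:R))//.
  rewrite EFinM; apply: lee_wpmul2l; first by rewrite lee_fin invr_ge0 ltW.
  under eq_integral do rewrite poisson_mean ?rate_gt0//.
  rewrite [leRHS]EFinM (EFinD I4) -HI4 -gaussian_massE -ge0_integralD//; first last.
  - by move=> z _; rewrite lee_fin expR_ge0.
  - by move=> z _; rewrite lee_fin expR_ge0.
  rewrite -ge0_integralZl//; first last.
  - by move=> z _; rewrite -EFinD lee_fin addr_ge0 ?expR_ge0.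
  - exact: emeasurable_funD.
  apply: ge0_le_integral => //.
  - by move=> z _; rewrite -EFinM lee_fin mulr_ge0 ?expR_ge0// ltW// rate_gt0.
  - by apply: emeasurable_funM => //; apply/measurable_EFinP; exact: measurable_rate.
  - by apply: measurable_funeM; exact: emeasurable_funD.
  move=> z _; rewrite -EFinD -!EFinM lee_fin /rate.
  (* The quadratic growth of [rate] is absorbed by widening the Gaussian exponent from 1/2 to
     1/4. *)
  have h : (dotp z z / 4 <= expR (dotp z z / 4))%R.
    by apply: le_trans (expR_ge1Dx _); rewrite lerDr.
  have -> : gaussian 4^-1 z = (gaussian 2^-1 z * expR (dotp z z / 4))%R.
    by rewrite /gaussian -expRD; congr expR; field.
  have : (0 <= gaussian 2^-1 z)%R by exact: expR_ge0.
  nra.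
exists (fine (\int[PZ]_p (p.2%:R : R)%:E)); first exact: fine_ge0.
by rewrite fineK// ge0_fin_numE//; exact: le_lt_trans ub (ltry _).
Qed.

End sampler_constants.

Section fresh.
Context {R : realType} (d' : nat).
Local Notation X := 'rV[R]_d'.+1.
Variables (f : X -> R) (xs : X).
Hypothesis hf : smooth_strongly_convex 2 1 f.
Hypothesis fxs : minimizer f xs.
Local Open Scope ereal_scope.
Local Notation PZ := (@proposal_law R d'.+1).
Local Notation gm := (@gaussian_mass R d'.+1).

Lemma integral_pending_value (dl rho : R) (a : X -> R) (m be al : R) y :
  (0 <= dl)%R -> (0 <= rho)%R -> (forall x, (0 <= a x)%R) ->
  measurable_fun setT a ->
  (f y - f xs <= 1)%R ->
  \int[PZ]_p (p.2%:R : R)%:E = m%:E ->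
  \int[PZ]_p (survive f y (grad f y) (p.1 - grad f y) ^+ p.2)%:E = be%:E ->
  \int[PZ]_p (survive f y (grad f y) (p.1 - grad f y) ^+ p.2
     * a (y + (p.1 - grad f y)))%:E = al%:E ->
  \int[PZ]_p (pending_value f dl rho a p.2 y (grad f y) (p.1 - grad f y))%:E =
  (m * dl + (al + (1 - be) * rho))%:E.
Proof.
move=> dl0 rho0 a0 ma fy Hm Hb Ha; set g := grad f y.
pose q (p : X * nat) := (survive f y g (p.1 - g) ^+ p.2)%R.
have mq : measurable_fun setT q.
  apply: (@measurable_fun_nat_param _ X _ _ (fun n z => survive f y g (z - g) ^+ n)%R) => n.
  apply: measurable_funX.
  exact: (measurableT_comp (measurable_survive hf y g) (measurable_rV_add (- g)%R)).
have q01 p : (0 <= q p <= 1)%R.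
  have /andP[s0 s1] := survive01 hf fxs (p.1 - g) fy.
  by rewrite /q exprn_ge0//= exprn_ile1.
have mn : measurable_fun setT (fun p : X * nat => p.2%:R : R).
  exact: (measurableT_comp (@measurable_of_nat _ _ (fun n => n%:R : R)) measurable_snd).
have mya : measurable_fun setT (fun p : X * nat => a (y + (p.1 - g))%R).
  apply: (measurableT_comp ma); apply: measurable_rVD => //.
  by apply: measurable_rVB.
have Hb' : \int[PZ]_p (1 - q p)%:E = (1 - be)%:E.
  rewrite EFinB -Hb; apply/esym/eqP; rewrite sube_eq//.
  - rewrite -ge0_integralD//=.
    + rewrite (eq_integral (cst 1)) ?integral_probability_cst// => p _.
      by rewrite -EFinD subrK.
    + by move=> p _; rewrite lee_fin subr_ge0; have /andP[] := q01 p.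
    + by apply/measurable_EFinP/measurable_funB.
    + by move=> p _; rewrite lee_fin; have /andP[] := q01 p.
    + exact/measurable_EFinP.
  - by rewrite Hb fin_num_adde_defl.
under eq_integral do rewrite /pending_value EFinD EFinD EFinM (EFinM (1 - _)).
rewrite ge0_integralD//; first last.
- apply: emeasurable_funD.
    by apply/measurable_EFinP/measurable_funM.
  by apply: emeasurable_funM => //; apply/measurable_EFinP/measurable_funB.
- move=> p _; have /andP[h0 h1] := q01 p.
  by rewrite adde_ge0// ?mule_ge0// lee_fin ?mulr_ge0// subr_ge0.
- by apply: emeasurable_funM => //; exact/measurable_EFinP.
- by move=> p _; rewrite mule_ge0// lee_fin.
rewrite ge0_integralZr//; last by exact/measurable_EFinP.
rewrite Hm ge0_integralD//; first last.
- by apply: emeasurable_funM => //; apply/measurable_EFinP/measurable_funB.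
- by move=> p _; have /andP[h0 h1] := q01 p; rewrite mule_ge0// lee_fin// subr_ge0.
- by apply/measurable_EFinP/measurable_funM.
- by move=> p _; have /andP[h0 h1] := q01 p; rewrite lee_fin mulr_ge0.
rewrite ge0_integralZr//; first last.
- by move=> p _; have /andP[h0 h1] := q01 p; rewrite lee_fin subr_ge0.
- by apply/measurable_EFinP/measurable_funB.
by rewrite Ha Hb' -!EFinM -!EFinD.
Qed.

Lemma integral_survive_accept y (D : set X) : (f y - f xs <= 1)%R ->
  measurable D ->
  \int[PZ]_p (survive f y (grad f y) (p.1 - grad f y) ^+ p.2
     * \1_D (y + (p.1 - grad f y)))%:E = gm^-1%:E * accept_mass f y D.
Proof.
move=> fy mD; rewrite /accept_mass -(integral_survive_pow hf fxs fy).
- by apply: eq_integral => p _; rewrite addrCA.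
- exact: (measurableT_comp (measurable_indic mD) (measurable_rV_add _)).
- by [].
Qed.

Lemma integral_survive y : (f y - f xs <= 1)%R ->
  \int[PZ]_p (survive f y (grad f y) (p.1 - grad f y) ^+ p.2)%:E =
  gm^-1%:E * accept_mass f y setT.
Proof.
move=> fy; rewrite -integral_survive_accept//.
by apply: eq_integral => p _; rewrite indicT mulr1.
Qed.

End fresh.

(** * Output law and expected cost of the sampler *)

Section sampler_bound.
Context {R : realType} (d' : nat).
Local Notation X := 'rV[R]_d'.+1.
Local Open Scope ereal_scope.
Local Notation PB := (@sampler_law R d').
Local Notation PZ := (@proposal_law R d'.+1).
Local Notation gm := (@gaussian_mass R d'.+1).

Section fixed_target.
Variables (f : X -> R) (xs : X) (k : nat) (m I : R).
Hypothesis hf : smooth_strongly_convex 2 1 f.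
Hypothesis fxs : minimizer f xs.
Hypothesis m0 : (0 <= m)%R.
Hypothesis Hm : \int[PZ]_p (p.2%:R : R)%:E = m%:E.
Hypothesis I0 : (0 < I)%R.
Hypothesis HI : \int[lebesgue_rV d'.+1]_v (gaussian (3 / 2) v)%:E = I%:E.
Local Notation A := (@sampler R d' k).

(** A bound on the acceptance probability that is uniform in [f]: a gap of at most 1 forces a
    squared gradient of at most 4, whence the exponent -4. *)
Definition acceptance_lower : R := (gm^-1 * (expR (- 4) * I))%R.

(** Solution of [1 + m + (1 - p) * rho = rho] for the acceptance bound [p]: one round to draw the
    proposal, [m] tests on average, and a new start after rejection. *)
Definition restart_value : R := ((1 + m) / acceptance_lower)%R.

Lemma acceptance_lower_gt0 : (0 < acceptance_lower)%R.
Proof. by rewrite !mulr_gt0 ?invr_gt0 ?gaussian_mass_gt0 ?expR_gt0. Qed.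

Lemma restart_value_ge0 : (0 <= restart_value)%R.
Proof. by rewrite divr_ge0 ?addr_ge0// ltW// acceptance_lower_gt0. Qed.

Lemma acceptance_probP y : (f y - f xs <= 1)%R ->
  exists2 be : R, gm^-1%:E * accept_mass f y setT = be%:E &
    (acceptance_lower <= be)%R.
Proof.
move=> fy; have [al alE alI] := accept_mass_bounds hf y HI (gaussian_massE d'.+1).
exists (gm^-1 * al)%R; first by rewrite alE.
rewrite /acceptance_lower ler_pM2l ?invr_gt0 ?gaussian_mass_gt0//.
apply: le_trans alI; rewrite ler_pM2r// ler_expR lerN2.
by have := grad_gap hf y fxs; lra.
Qed.

(** Without running cost the restart value [gibbs f D] satisfies the renewal equation exactly: by
    [gibbs_accept], acceptance inside [D] has probability [be * gibbs f D], and rejection, of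
    probability [1 - be], starts afresh. *)
Lemma hit_supersolution (D : set X) : measurable D -> exists2 V,
  supersolution PB A f (sampler_inv f xs) (cst 0) (hit A D) V &
  V (init A) <= gibbs f D.
Proof.
move=> mD.
have [nu nuE] : exists nu : R, gibbs f D = nu%:E.
  exists (fine (gibbs f D)); rewrite fineK// ge0_fin_numE ?gibbs_ge0//.
  by rewrite (le_lt_trans _ (ltry 1))// -(gibbs_setC hf mD) leeDl// gibbs_ge0.
have nu0 : (0 <= nu)%R by rewrite -lee_fin -nuE gibbs_ge0.
have mI : measurable_fun setT (\1_D : X -> R) by exact: measurable_indic.
have fresh y : (f y - f xs <= 1)%R -> 0%:E + \int[PZ]_p (pending_value f 0 nu \1_D
    p.2 y (grad f y) (p.1 - grad f y))%:E <= nu%:E.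
  move=> fy; have [be beE _] := acceptance_probP fy.
  have Hb := integral_survive hf fxs fy; rewrite beE in Hb.
  have Ha := integral_survive_accept hf fxs fy mD.
  rewrite (gibbs_accept hf y mD) muleA beE nuE -EFinM in Ha.
  rewrite (integral_pending_value hf fxs _ nu0 _ mI fy Hm Hb Ha)//.
  by rewrite add0e lee_fin; lra.
exists (fun s => (potential f 0 nu \1_D s)%:E).
  split => s Is.
  - exact: (potential_terminal hf fxs (lexx 0) nu0 _ Is).
  - exact: (measurable_potential_step k hf 0 nu mI Is).
  - have := potential_super k hf fxs (lexx 0) nu0 mI _ fresh Is.
    by rewrite mul0e; apply.
by rewrite nuE /potential/= mulr0 add0r.
Qed.

(** Unit cost per round and no reward. The true acceptance probability is at least
    [acceptance_lower], so the renewal equation holds as an inequality. *)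
Lemma wait_supersolution : exists2 U,
  supersolution PB A f (sampler_inv f xs) (waiting A) (cst 0) U &
  U (init A) <= (k%:R + restart_value)%:E.
Proof.
have r0 := restart_value_ge0.
have m1 : measurable_fun setT (cst 0%R : X -> R) by exact: measurable_cst.
have fresh y : (f y - f xs <= 1)%R -> 1%:E + \int[PZ]_p (pending_value f 1
    restart_value (cst 0%R) p.2 y (grad f y) (p.1 - grad f y))%:E <= restart_value%:E.
  move=> fy; have [be beE lbe] := acceptance_probP fy.
  have Hb := integral_survive hf fxs fy; rewrite beE in Hb.
  have Ha : \int[PZ]_p (survive f y (grad f y) (p.1 - grad f y) ^+ p.2
     * (cst 0%R : X -> R) (y + (p.1 - grad f y)))%:E = 0%:E.
    by apply: integral0_eq => p _; rewrite mulr0.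
  rewrite (integral_pending_value hf fxs _ r0 _ m1 fy Hm Hb Ha)//.
  have : (acceptance_lower * restart_value = 1 + m)%R.
    by rewrite /restart_value mulrC divfK// lt0r_neq0// acceptance_lower_gt0.
  have : (acceptance_lower * restart_value <= be * restart_value)%R by rewrite ler_wpM2r.
  rewrite -EFinD lee_fin mulrBl; lra.
exists (fun s => (potential f 1 restart_value (cst 0%R) s)%:E).
  split => s Is.
  - have := potential_terminal hf fxs ler01 r0 (fun=> lexx 0) Is.
    by rewrite mule0.
  - exact: (measurable_potential_step k hf 1 restart_value m1 Is).
  - have := potential_super k hf fxs ler01 r0 m1 (fun=> lexx 0) fresh Is.
    by rewrite mul1e.
by rewrite /potential/= mulr1.
Qed.

End fixed_target.

(** At the origin the gap to the minimum is at most the squared distance to the minimizer, hence at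
    most [r ^+ 2]; so [k] halvings suffice as soon as [r ^+ 2 <= 2 ^+ k]. *)
Lemma minimax_cost_upper : exists2 K : R, (0 <= K)%R &
  forall (r eps : R) (k : nat), (0 <= r)%R -> (0 < eps)%R -> (r ^+ 2 <= 2 ^+ k)%R ->
  minimax_cost (centered_class 2 1 (0%R : X) r) eps <= (2 * (k%:R + K))%:E.
Proof.
have [m m0 Hm] := @proposal_meanP R d'.+1.
have [I I0 HI] := @integral_gaussian R d'.+1 (3 / 2) ltac:(lra).
pose K := restart_value m I; have K0 : (0 <= K)%R by exact: restart_value_ge0.
exists K => // r eps k r0 eps0 rk.
(* Here alone [eps] enters: the cut is late enough for the mean number of rounds to be at most [eps]
   times its length, while that mean is bounded without reference to [N]. *)
pose N := Num.bound ((k%:R + K) / eps).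
have KN : (k%:R + K <= eps * N.+1%:R)%R.
  rewrite -ler_pdivrMl// mulrC; apply: ltW.
  apply: (lt_le_trans (archi_boundP _)); last by rewrite ler_nat.
  by rewrite divr_ge0 ?addr_ge0// ltW.
have target f : centered_class 2 1 (0%R : X) r f -> exists xs,
    [/\ smooth_strongly_convex 2 1 f, minimizer f xs &
        sampler_inv f xs (init (@sampler R d' k))].
  move=> [hf [xs [[mxs _] dxs]]]; exists xs; split => //.
  rewrite /sampler_inv/=; apply: le_trans rk.
  apply: le_trans (minimizer_gap hf 0 mxs) _.
  move: dxs; rewrite subr0 sub0r dotpNl dotpNr opprK -enorm_sqr => dxs.
  by rewrite ler_pXn2r// nnegrE// sqrtr_ge0.
apply: (@le_trans _ _ (ereal_sup [set expected_queries
    (machine_algorithm PB (@sampler R d' k) N) f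
    | f in centered_class 2 1 (0%R : X) r])).
  apply: ereal_inf_lbound; exists (machine_algorithm PB (@sampler R d' k) N) => //.
  move=> f /target[xs [hf mxs Is]]; split.
  - exact: ae_num_queries_machine.
  - exact: machine_stopping_time.
  - apply: (tv_dist_machine (measurable_grad hf) KN Is).
    + by move=> s b; exact: sampler_inv_step.
    + by move=> D; exact: gibbs_ge0.
    + by move=> D mD; exact: gibbs_setC.
    + by move=> D mD; exact: (hit_supersolution k hf mxs Hm I0 HI mD).
    + by have [U ? ?] := wait_supersolution k hf mxs m0 Hm I0 HI; exists U.
apply: ub_ereal_sup => _ [f /target[xs [hf mxs Is]] <-].
apply: (expected_queries_machine (measurable_grad hf) N Is).
- by move=> s b; exact: sampler_inv_step.
- by have [U ? ?] := wait_supersolution k hf mxs m0 Hm I0 HI; exists U.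
Qed.

End sampler_bound.

(** * Hard functions on a tree of intervals *)

Section positive_part.
Context {R : realType}.
Implicit Types x y a : R.

Definition pos x : R := Num.max x 0.

Definition ppos x : R := pos x ^+ 2 / 2.

Lemma pos_def x : (0 <= x /\ pos x = x) \/ (x <= 0 /\ pos x = 0).
Proof. by rewrite /pos; case: (leP x 0) => h; [right|left; split => //; exact: ltW]. Qed.

(** The ramp [pos (x - a) - pos (x - a')] has slope between 0 and 1; [bend] is a line plus small
    multiples of two such ramps. *)
Lemma pos_sub_le a a' x y : a <= a' -> x <= y ->
  [/\ 0 <= pos (y - a') - pos (x - a'),
      pos (y - a') - pos (x - a') <= pos (y - a) - pos (x - a) &
      pos (y - a) - pos (x - a) <= y - x].
Proof.
move=> aa xy.
case: (pos_def (y - a)) => -[? ->]; case: (pos_def (x - a)) => -[? ->];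
case: (pos_def (y - a')) => -[? ->]; case: (pos_def (x - a')) => -[? ->];
by split; lra.
Qed.

Lemma ppos_quadratic x h : `|ppos (x + h) - ppos x - h * pos x| <= h ^+ 2 / 2.
Proof.
rewrite ler_norml /ppos.
case: (pos_def (x + h)) => -[? ->]; case: (pos_def x) => -[? ->];
by apply/andP; split; nra.
Qed.

Lemma is_derive_ppos x : is_derive x 1 ppos (pos x).
Proof.
have H : (fun h : R => h^-1 *: ((ppos \o shift x) (h *: 1) - ppos x)) @ 0^' --> pos x.
  apply/cvgrPdist_lt => e e0; near=> h.
  have h0 : h != 0 by near: h; exact: nbhs_dnbhs_neq.
  have := ppos_quadratic x h; rewrite /= /GRing.scale/= mulr1 [h + x]addrC => hq.
  rewrite (_ : pos x - _ = - (h^-1 * (ppos (x + h) - ppos x - h * pos x))); last first.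
    by field.
  rewrite normrN normrM normfV mulrC ltr_pdivrMr ?normr_gt0//.
  apply: le_lt_trans hq _.
  have he : `|h| < e by near: h; exact: dnbhs0_lt.
  rewrite -(real_normK (num_real h)); have : 0 < `|h| by rewrite normr_gt0.
  nra.
by apply: DeriveDef; [apply/cvg_ex; exists (pos x)|exact: cvg_lim].
Unshelve. all: by end_near. Qed.

Lemma is_derive_ppos_shift a x : is_derive x 1 (fun y => ppos (y - a)) (pos (x - a)).
Proof.
have D1 : is_derive ((fun y : R => y - a) x) 1 ppos (pos (x - a)).
  exact: is_derive_ppos.
have D2 : is_derive x 1 (fun y : R => y - a) 1.
  have -> : (fun y : R => y - a) = (@id R) - cst a by [].
  by apply: is_derive_eq; rewrite subr0.
by have := @is_derive1_comp R ppos (fun y => y - a) x _ _ D1 D2; rewrite mulr1.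
Qed.

End positive_part.

(** * Piecewise quadratic functions indexed by words *)

Section hard.
Context {R : realType}.
Implicit Types (x y c l : R) (s : bool) (b p : seq bool).

Definition child c l s : R := if s then c + l / 8 else c - l / 8.

(* Piecewise linear, equal to [3/2 (x - c)] outside [c - l, c + l] and to
   [3/2 (x - c')] on the child interval [c' - l/8, c' + l/8], with slopes 21/16
   and 7/4 in between. *)
Definition bend c l s x : R :=
  if s then 3 / 2 * (x - c) - 3 / 16 * (pos (x - (c - l)) - pos (x - c))
            + 4^-1 * (pos (x - (c + l / 4)) - pos (x - (c + l)))
  else 3 / 2 * (x - c) + 4^-1 * (pos (x - (c - l)) - pos (x - (c - l / 4)))
            - 3 / 16 * (pos (x - c) - pos (x - (c + l))).

Definition pbend c l s x : R :=
  if s then 3 / 4 * (x - c) ^+ 2 - 3 / 16 * (ppos (x - (c - l)) - ppos (x - c))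
            + 4^-1 * (ppos (x - (c + l / 4)) - ppos (x - (c + l)))
  else 3 / 4 * (x - c) ^+ 2 + 4^-1 * (ppos (x - (c - l)) - ppos (x - (c - l / 4)))
            - 3 / 16 * (ppos (x - c) - ppos (x - (c + l))).

(** The derivative of [hard]. The correction in parentheses vanishes outside the child interval;
    inside it, where [bend] is [3 / 2 * (x - c')], it substitutes the derivative attached to the
    rest of the word. *)
Fixpoint hardd b c l x : R :=
  if b is s :: b' then
    let c' := child c l s in
    bend c l s x + (hardd b' c' (l / 8) x - 3 / 2 * (x - c'))
  else 3 / 2 * (x - c).

Fixpoint hard b c l x : R :=
  if b is s :: b' then
    let c' := child c l s in
    pbend c l s x + (hard b' c' (l / 8) x - 3 / 4 * (x - c') ^+ 2)
  else 3 / 4 * (x - c) ^+ 2.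

Fixpoint hard_center b c l : R :=
  if b is s :: b' then hard_center b' (child c l s) (l / 8) else c.

(** Slope 21/16 over a length [l] and 7/4 over a length [3 l / 4] compensate:
    [3/16 * l = 1/4 * (3/4 * l)]. *)
Lemma bend_outside c l s x : 0 < l -> l <= `|x - c| -> bend c l s x = 3 / 2 * (x - c).
Proof.
move=> l0; rewrite /bend; case: (lerP 0 (x - c)) => xc.
  rewrite ger0_norm// => lx; case: s;
  by rewrite /pos !max_l; lra.
rewrite ltr0_norm// => lx; case: s; by rewrite /pos !max_r; lra.
Qed.

(** Between the two modified stretches the line is displaced by [3/16 * l = 3/2 * (l / 8)], which
    moves its zero to the child centre. *)
Lemma bend_inside c l s x : 0 < l -> `|x - child c l s| <= l / 8 ->
  bend c l s x = 3 / 2 * (x - child c l s).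
Proof.
move=> l0; rewrite ler_norml /bend /child; case: s => /andP[h1 h2].
  rewrite /pos (max_l (_ : 0 <= x - (c - l))); last lra.
  rewrite (max_l (_ : 0 <= x - c)); last lra.
  rewrite !max_r; lra.
rewrite /pos (max_l (_ : 0 <= x - (c - l))); last lra.
rewrite (max_l (_ : 0 <= x - (c - l / 4))); last lra.
rewrite !max_r; lra.
Qed.

Lemma bend_slope c l s x y : 0 < l -> x <= y ->
  y - x <= bend c l s y - bend c l s x <= 2 * (y - x).
Proof.
move=> l0 xy; rewrite /bend; case: s.
  have [] := @pos_sub_le R (c - l) c x y ltac:(lra) xy.
  have [] := @pos_sub_le R (c + l / 4) (c + l) x y ltac:(lra) xy.
  lra.
have [] := @pos_sub_le R (c - l) (c - l / 4) x y ltac:(lra) xy.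
have [] := @pos_sub_le R c (c + l) x y ltac:(lra) xy.
lra.
Qed.

Lemma hardd_outside b c l x : 0 < l -> l <= `|x - c| -> hardd b c l x = 3 / 2 * (x - c).
Proof.
elim: b c l => //= s b IH c l l0 lx.
rewrite IH ?bend_outside//; [ring|lra|].
by move: lx; rewrite /child; case: s; case: (lerP 0 (x - c)) => h lx;
  rewrite ?(ger0_norm h) ?(ltr0_norm h) in lx; rewrite ler_normr; apply/orP;
  (try by left; lra); right; lra.
Qed.

Lemma hardd_inside s b c l x : 0 < l -> `|x - child c l s| <= l / 8 ->
  hardd (s :: b) c l x = hardd b (child c l s) (l / 8) x.
Proof. by move=> l0 h /=; rewrite bend_inside//; ring. Qed.

(** The slope bounds are additive over adjacent segments. Cutting at the ends of the child interval
    leaves pieces on which the function is either [bend] or the derivative attached to the shorter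
    word. *)
Lemma hardd_slope b c l x y : 0 < l -> x <= y ->
  y - x <= hardd b c l y - hardd b c l x <= 2 * (y - x).
Proof.
elim: b c l x y => [|s b IH] c l x y l0 xy; first by rewrite /=; lra.
have l8 : 0 < l / 8 by lra.
pose c' := child c l s.
pose slope u v := v - u <= hardd (s :: b) c l v - hardd (s :: b) c l u <= 2 * (v - u).
have out u v : u <= v -> (v <= c' - l / 8) || (c' + l / 8 <= u) -> slope u v.
  move=> uv h; rewrite /slope /= !hardd_outside//.
  - by have := bend_slope c s l0 uv; rewrite -/c'; lra.
  - by rewrite -/c' ler_normr; apply/orP; case/orP: h => ?; [right|left]; lra.
  - by rewrite -/c' ler_normr; apply/orP; case/orP: h => ?; [right|left]; lra.
have inn u v : u <= v -> c' - l / 8 <= u -> v <= c' + l / 8 -> slope u v.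
  move=> uv u1 v1; rewrite /slope !hardd_inside//; first exact: IH.
    by rewrite -/c' ler_norml; lra.
  by rewrite -/c' ler_norml; lra.
have glue u v w : u <= v -> v <= w -> slope u v -> slope v w -> slope u w.
  by rewrite /slope => ? ? /andP[? ?] /andP[? ?]; lra.
rewrite -/(slope x y).
have left v : x <= v -> v <= c' - l / 8 -> slope x v by move=> ? h; apply: out; rewrite ?h.
have [y1|y1] := lerP y (c' - l / 8); first exact: left.
have mid u v : u <= v -> c' - l / 8 <= u -> slope u v.
  move=> uv u1; have [v1|v1] := lerP v (c' + l / 8); first exact: inn.
  have [u2|u2] := lerP (c' + l / 8) u; first by apply: out => //; rewrite u2 orbT.
  apply: (glue _ (c' + l / 8)); [lra|lra|apply: inn; lra|apply: out; [lra|]].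
  by rewrite lexx orbT.
have [x1|x1] := lerP (c' - l / 8) x; first exact: mid.
by apply: (glue _ (c' - l / 8)); [lra|lra|apply: left; lra|apply: mid; lra].
Qed.

Lemma hard_center_dist b c l : 0 < l -> `|hard_center b c l - c| < l.
Proof.
elim: b c l => [|s b IH] c l l0 /=; first by rewrite subrr normr0.
have := IH (child c l s) (l / 8) ltac:(lra); rewrite !ltr_norml /child; case: s; lra.
Qed.

Lemma hardd_center b c l : 0 < l -> hardd b c l (hard_center b c l) = 0.
Proof.
elim: b c l => [|s b IH] c l l0; first by rewrite /= subrr mulr0.
rewrite [hard_center _ _ _]/= hardd_inside ?IH//; first lra.
by apply: ltW; apply: hard_center_dist; lra.
Qed.

Lemma is_derive_sq (k c x : R) :
  is_derive x 1 (fun y => k / 2 * (y - c) ^+ 2) (k * (x - c)).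
Proof.
have -> : (fun y => k / 2 * (y - c) ^+ 2) =
    (k / 2) *: (((@id R) - cst c) * ((@id R) - cst c)).
  by apply/funext => y; rewrite /GRing.scale/= !fctE expr2.
by apply: is_derive_eq; rewrite /GRing.scale/= !fctE; field.
Qed.

Lemma is_derive_pbend c l s x : is_derive x 1 (pbend c l s) (bend c l s x).
Proof.
pose P a := fun y : R => ppos (y - a).
have D a : is_derive x 1 (P a) (pos (x - a)) by exact: is_derive_ppos_shift.
have Q : is_derive x 1 (fun y => 3 / 4 * (y - c) ^+ 2) (3 / 2 * (x - c)).
  by have := is_derive_sq (3 / 2) c x; rewrite (_ : 3 / 2 / 2 = 3 / 4 :> R)//; field.
rewrite /bend; case: s.
- exact: (is_deriveD
    (is_deriveB Q (is_deriveZ (3 / 16) (is_deriveB (D (c - l)) (D c))))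
    (is_deriveZ 4^-1 (is_deriveB (D (c + l / 4)) (D (c + l))))).
- exact: (is_deriveB
    (is_deriveD Q (is_deriveZ 4^-1 (is_deriveB (D (c - l)) (D (c - l / 4)))))
    (is_deriveZ (3 / 16) (is_deriveB (D c) (D (c + l))))).
Qed.

Lemma is_derive_hard b c l x : is_derive x 1 (hard b c l) (hardd b c l x).
Proof.
have Q a : is_derive x 1 (fun y => 3 / 4 * (y - a) ^+ 2) (3 / 2 * (x - a)).
  by have := is_derive_sq (3 / 2) a x; rewrite (_ : 3 / 2 / 2 = 3 / 4 :> R)//; field.
elim: b c l => [|s b IH] c l; first exact: Q.
exact: (is_deriveD (is_derive_pbend c l s x)
  (is_deriveB (IH (child c l s) (l / 8)) (Q (child c l s)))).
Qed.

(* The only branch of the interval tree that a query at [x] can descend. *)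
Fixpoint branch m c l x : seq bool :=
  if m is m'.+1 then
    let s := c < x in s :: branch m' (child c l s) (l / 8) x
  else [::].

Fixpoint agreement b p : nat :=
  if (b, p) is (s :: b', s' :: p') then
    if s == s' then (agreement b' p').+1 else 0%N
  else 0%N.

(** Where a word leaves the branch of [x] it enters the child interval on the other side of the
    centre, which does not contain [x] in its interior; all deeper bits are then invisible at [x].
    Two words leaving at the same depth carry the same bit there. *)
Lemma hardd_agreement m b b' c l x : 0 < l -> size b = m -> size b' = m ->
  agreement b (branch m c l x) = agreement b' (branch m c l x) ->
  hardd b c l x = hardd b' c l x.
Proof.
elim: m b b' c l => [|m IH] [|s b] [|s' b'] c l //= l0 [sb] [sb'].
have off t : t != (c < x) -> l / 8 <= `|x - child c l t|.
  rewrite /child ler_normr; case: (ltP c x) => h; case: t => // _; apply/orP.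
    by left; lra.
  by right; lra.
have l8 : 0 < l / 8 by lra.
case: eqP => [->|/eqP sN]; case: eqP => [->|/eqP s'N] //.
  by move=> [e]; rewrite (IH b b').
move=> _; have -> : s' = s by move: sN s'N; case: s; case: s'; case: (c < x).
by rewrite !hardd_outside//; exact: off.
Qed.

End hard.

(** * From slopes in one variable to the function class *)

Section one_dimensional.
Context {R : realType}.
Variables (phi psi : R -> R).
Hypothesis Dphi : forall x : R, is_derive x 1 phi (psi x).
Hypothesis slope : forall x y, x <= y -> y - x <= psi y - psi x <= 2 * (y - x).

Lemma slope_continuous : continuous psi.
Proof.
move=> x; apply/cvgrPdist_lt => e e0; near=> y.
have : `|x - y| < e / 2.
  by near: y; apply/nbhs_ballP; exists (e / 2) => //=; rewrite divr_gt0.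
have [xy|yx] := leP x y.
  by have := slope xy; rewrite !ltr_norml; lra.
by have := slope (ltW yx); rewrite !ltr_norml; lra.
Unshelve. all: by end_near. Qed.

Lemma mean_value x y : exists2 c,
  (x <= c <= y) || (y <= c <= x) & phi y - phi x = psi c * (y - x).
Proof.
have cphi : continuous phi.
  move=> z; apply/differentiable_continuous/derivable1_diffP.
  by have [] := Dphi z.
have mvt a b : a < b ->
    exists2 c, c \in `]a, b[%R & phi b - phi a = psi c * (b - a).
  by move=> ab; apply: MVT => //; exact: continuous_subspaceT.
have [/mvt|/mvt|->] := ltgtP x y.
- case=> c; rewrite in_itv/= => /andP[h1 h2] E; exists c => //.
  by rewrite (ltW h1) (ltW h2).
- case=> c; rewrite in_itv/= => /andP[h1 h2] E; exists c; last lra.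
  by rewrite (ltW h1) (ltW h2) orbT.
- by exists y; rewrite ?lexx// !subrr mulr0.
Qed.

End one_dimensional.

Section bregman.
Context {R : realType}.
Variables (phi psi : R -> R).
Hypothesis Dphi : forall x : R, is_derive x 1 phi (psi x).
Hypothesis slope : forall x y, x <= y -> y - x <= psi y - psi x <= 2 * (y - x).

(** Mean value theorem for [phi] minus [k / 2] times the square of the distance to [y], with [k = 1]
    for the lower bound and [k = 2] for the upper one. *)
Lemma bregman_bounds x y :
  (x - y) ^+ 2 / 2 <= phi x - phi y - psi y * (x - y) <= (x - y) ^+ 2.
Proof.
have Dk (k a t : R) : is_derive t 1 (fun s => phi s - k / 2 * (s - a) ^+ 2)
    (psi t - k * (t - a)).
  exact: (is_deriveB (Dphi t) (is_derive_sq k a t)).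
apply/andP; split.
  have [c hc] := mean_value (Dk 1 y) y x; rewrite subrr expr0n/= mulr0 subr0 => E.
  suff : 0 <= (psi c - 1 * (c - y) - psi y) * (x - y).
    by move: E; rewrite mul1r => E; nra.
  case/orP: hc => /andP[h1 h2].
    by have /andP[s1 s2] := slope h1; rewrite mulr_ge0//; lra.
  have /andP[s1 s2] := slope h2; rewrite -mulrNN mulr_ge0//; lra.
have [c hc] := mean_value (Dk 2 y) y x; rewrite subrr expr0n/= mulr0 subr0 => E.
suff : (psi c - 2 * (c - y) - psi y) * (x - y) <= 0.
  by move: E; rewrite divff// mul1r => E; nra.
case/orP: hc => /andP[h1 h2].
  by have /andP[s1 s2] := slope h1; rewrite mulr_le0_ge0//; lra.
by have /andP[s1 s2] := slope h2; rewrite mulr_ge0_le0//; lra.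
Qed.

End bregman.

Section separable.
Context {R : realType} (d : nat).
Variables (phi psi : 'I_d -> R -> R).
Hypothesis Dphi : forall i (x : R), is_derive x 1 (phi i) (psi i x).
Hypothesis slope : forall i x y,
  x <= y -> y - x <= psi i y - psi i x <= 2 * (y - x).

Definition separable (v : 'rV[R]_d) : R := \sum_(i < d) phi i (v ord0 i).

Lemma differentiable_separable v : differentiable separable v.
Proof.
have -> : separable = \sum_(i < d) (phi i \o (fun v : 'rV[R]_d => v ord0 i)).
  by apply/funext => w; rewrite fct_sumE.
apply: differentiable_sum => i; apply: differentiable_comp.
  exact: differentiable_coord.
by apply/derivable1_diffP; have [] := Dphi i (v ord0 i).
Qed.

Lemma grad_separable v : grad separable v = \row_i psi i (v ord0 i).
Proof.
apply/rowP => i; rewrite !mxE.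
have H (h : R) : separable (h *: delta_mx ord0 i + v) - separable v =
    phi i (h *: 1 + v ord0 i) - phi i (v ord0 i).
  rewrite /separable (bigD1 i)//= [X in _ - X](bigD1 i)//= !mxE !eqxx/=.
  rewrite (eq_bigr (fun j => phi j (v ord0 j))); last first.
    move=> j /negbTE ji; rewrite !mxE eqxx ji/= mulr0 add0r//.
  by rewrite opprD addrACA subrr addr0.
have := derive_val (is_derive := Dphi i (v ord0 i)) => <-.
rewrite /derive (_ : (fun h : R => h^-1 *: ((separable \o shift v)
    (h *: delta_mx ord0 i) - separable v)) = (fun h : R => h^-1 *:
    ((phi i \o shift (v ord0 i)) (h *: 1) - phi i (v ord0 i))))//.
by apply/funext => h /=; rewrite H.
Qed.

Lemma separable_ssc : smooth_strongly_convex 2 1 separable.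
Proof.
split; first split; first exact: differentiable_separable.
  move=> v; apply/(@cvg_ballP R _ _ (nbhs v) (nbhs_filter v)) => e e0.
  pose nb i : set 'rV[R]_d := [set w | `|psi i (v ord0 i) - psi i (w ord0 i)| < e].
  have nbi i : nbhs v (nb i).
    have : (fun w : 'rV[R]_d => psi i (w ord0 i)) @ v --> psi i (v ord0 i).
      apply: (@cvg_comp _ _ _ (fun w : 'rV[R]_d => w ord0 i) (psi i)).
        exact: coord_continuous.
      exact: (slope_continuous (slope i)).
    by move=> cv; have := cv _ (nbhsx_ballx (psi i (v ord0 i)) e e0).
  have : \forall w \near v, forall i, nb i w.
    by apply: (@filter_forall _ _ _ (nbhs v) (nbhs_filter v)) => i; exact: nbi.
  apply: filterS => w nw; rewrite !grad_separable; split => // a i.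
  by rewrite !mxE; exact: nw.
move=> x y.
have E : separable x - separable y - dotp (grad separable y) (x - y) =
    \sum_(i < d) (phi i (x ord0 i) - phi i (y ord0 i)
       - psi i (y ord0 i) * (x ord0 i - y ord0 i)).
  rewrite grad_separable /separable /dotp -!sumrB; apply: eq_bigr => i _.
  by rewrite !mxE.
have N : enorm (x - y) ^+ 2 = \sum_(i < d) (x ord0 i - y ord0 i) ^+ 2.
  by rewrite enorm_sqr; apply: eq_bigr => i _; rewrite !mxE expr2.
rewrite E N !mulr_sumr; apply/andP; split; apply: ler_sum => i _;
  have /andP[h1 h2] := bregman_bounds (Dphi i) (slope i) (x ord0 i) (y ord0 i).
  by rewrite mul1r mulrC.
by rewrite divff// mul1r.
Qed.

End separable.

Section hard_centers.
Context {R : realType}.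
Implicit Types (c l : R) (b : seq bool).

Lemma hard_center_le b c l : 0 < l ->
  `|hard_center b c l - c| <= l - l / 8 ^+ size b.
Proof.
elim: b c l => [|s b IH] c l l0 /=; first by rewrite subrr normr0 expr0; lra.
have := IH (child c l s) (l / 8) ltac:(lra).
have -> : l / 8 ^+ (size b).+1 = l / 8 / 8 ^+ size b by rewrite exprS invfM mulrA.
rewrite !ler_norml /child; move: (l / 8 / _) => e; case: s; lra.
Qed.

(** At the first differing bit the two child intervals only touch, and each final centre keeps the
    distance [l / 8 ^+ size b] from the ends of its own interval. *)
Lemma hard_center_separated b b' c l : 0 < l -> size b = size b' -> b != b' ->
  2 * (l / 8 ^+ size b) <= `|hard_center b c l - hard_center b' c l|.
Proof.
elim: b b' c l => [|s b IH] [|s' b'] c l //= l0 [sb].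
have l8 : 0 < l / 8 by lra.
have -> : l / 8 ^+ (size b).+1 = l / 8 / 8 ^+ size b by rewrite exprS invfM mulrA.
have [<-|ss] := eqVneq s s'; first by rewrite eqseq_cons eqxx/= => bb; exact: IH.
move=> _; have := hard_center_le b (child c l s) l8.
have := hard_center_le b' (child c l s') l8; rewrite -sb.
move: (hard_center b _ _) (hard_center b' _ _) => x y.
move: (l / 8 / _) => e; rewrite !ler_norml ler_normr /child.
by move: ss; case: s; case: s' => // _ h1 h2; apply/orP; [left|right]; lra.
Qed.

End hard_centers.

(** * Gibbs mass of half-spaces and slabs *)

Section gibbs_tails.
Context {R : realType} (d : nat).
Local Notation X := 'rV[R]_d.
Variable f : X -> R.
Hypothesis hf : smooth_strongly_convex 2 1 f.
Local Open Scope ereal_scope.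

Lemma gibbsU (D E : set X) : measurable D -> measurable E -> [disjoint D & E] ->
  gibbs f (D `|` E) = gibbs f D + gibbs f E.
Proof.
move=> mD mE DE; have [Z Z0 ZE] := partition_functionP hf.
rewrite /gibbs ZE/= -ge0_muleDr; first last.
- by apply: integral_ge0 => x _; rewrite lee_fin expR_ge0.
- by apply: integral_ge0 => x _; rewrite lee_fin expR_ge0.
rewrite ge0_integral_setU//.
by apply: measurable_funTS; apply/measurable_EFinP; exact: measurable_expRN.
Qed.

(* Translating by [u] increases [f] by at least [|u|^2 / 2] wherever the slope of
   [f] along [u] is nonnegative. *)
Lemma gibbs_shift (E : set X) u : measurable E ->
  (forall x, E x -> (0 <= dotp (grad f x) u)%R) ->
  gibbs f [set x | E (x - u)%R] <= (expR (- (dotp u u / 2)))%:E.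
Proof.
move=> mE Eu; have [Z Z0 ZE] := partition_functionP hf.
rewrite /gibbs ZE/=.
have mI : measurable_fun [set: X] (\1_E : X -> R) by exact: measurable_indic.
have mh : measurable_fun setT (fun x : X => (\1_E (x - u) * expR (- f x))%:E).
  apply/measurable_EFinP/measurable_funM; last exact: measurable_expRN.
  exact: (measurableT_comp mI (measurable_rV_add (- u)%R)).
have h0 x : 0 <= (\1_E (x - u) * expR (- f x))%:E.
  by rewrite lee_fin mulr_ge0 ?expR_ge0.
have -> : \int[lebesgue_rV d]_(x in [set x | E (x - u)%R]) (expR (- f x))%:E =
    \int[lebesgue_rV d]_x (\1_E (x - u) * expR (- f x))%:E.
  rewrite integral_mkcond; apply: eq_integral => x _.
  rewrite patchE indicE (_ : (x \in _) = ((x - u)%R \in E)).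
    by case: ifPn => _; rewrite ?mul1r ?mul0r.
  by apply/idP/idP; rewrite !inE.
rewrite -(ge0_integral_rV_shift u mh h0).
have -> : (expR (- (dotp u u / 2)))%:E = Z^-1%:E * ((expR (- (dotp u u / 2)))%:E * Z%:E).
  by rewrite -!EFinM mulrCA mulVf ?mulr1// lt0r_neq0.
apply: lee_wpmul2l; first by rewrite lee_fin invr_ge0 ltW.
rewrite -ZE /partition_function -ge0_integralZl//; last first.
  by apply/measurable_EFinP; exact: measurable_expRN.
apply: ge0_le_integral => //.
- exact: (measurableT_comp mh (measurable_rV_add u)).
- by apply: measurable_funeM; apply/measurable_EFinP; exact: measurable_expRN.
move=> x _; rewrite addrK -EFinM lee_fin -expRD indicE.
case: (boolP (x \in E)) => [|_]; last by rewrite mul0r expR_ge0.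
rewrite inE => /Eu xu; rewrite mul1r ler_expR.
by have := ssc_lower hf (x + u)%R x; rewrite [(x + u - x)%R]addrC addKr; lra.
Qed.

End gibbs_tails.

Section hard_family.
Context {R : realType} (d' : nat).
Local Notation X := 'rV[R]_d'.+1.
Variables (l r : R).
Hypotheses (l0 : 0 < l) (lr : l <= r).

Definition hard_fun (b : seq bool) : X -> R :=
  separable (fun i : 'I_d'.+1 => if i == ord0 then hard b 0 l
                                 else fun x => 1 / 2 * (x - 0) ^+ 2).

Let psi (b : seq bool) (i : 'I_d'.+1) : R -> R :=
  if i == ord0 then hardd b 0 l else fun x => 1 * (x - 0).

Let Dpsi b i (x : R) : is_derive x 1
  (if i == ord0 :> 'I_d'.+1 then hard b 0 l else fun x => 1 / 2 * (x - 0) ^+ 2)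
  (psi b i x).
Proof.
by rewrite /psi; case: ifP => _; [exact: is_derive_hard|exact: is_derive_sq].
Qed.

Let slope_psi b i x y : x <= y -> y - x <= psi b i y - psi b i x <= 2 * (y - x).
Proof.
by rewrite /psi; case: ifP => _ xy; [exact: hardd_slope|lra].
Qed.

Lemma hard_fun_ssc b : smooth_strongly_convex 2 1 (hard_fun b).
Proof. exact: (separable_ssc (Dpsi b) (slope_psi b)). Qed.

Lemma grad_hard_fun b v : grad (hard_fun b) v =
  \row_i if i == ord0 then hardd b 0 l (v ord0 i) else v ord0 i.
Proof.
rewrite (grad_separable (Dpsi b)); apply/rowP => i; rewrite !mxE /psi.
by case: ifP => // _; rewrite mul1r subr0.
Qed.

Definition hard_minimizer b : X := hard_center b 0 l *: delta_mx ord0 ord0.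

Lemma grad_hard_minimizer b : grad (hard_fun b) (hard_minimizer b) = 0.
Proof.
rewrite grad_hard_fun; apply/rowP => i; rewrite !mxE.
case: eqP => _; last by rewrite andbF mulr0.
by rewrite eqxx/= mulr1 hardd_center.
Qed.

Lemma dotp_delta (k : R) (v : X) : dotp v (k *: delta_mx ord0 ord0) = k * v ord0 ord0.
Proof.
rewrite /dotp (bigD1 ord0)//= big1 ?addr0 => [|i /negbTE i0]; rewrite !mxE.
  by rewrite !eqxx mulr1 mulrC.
by rewrite i0 andbF !mulr0.
Qed.

Lemma hard_fun_class b : centered_class 2 1 0 r (hard_fun b).
Proof.
have hf := hard_fun_ssc b; have g0 := grad_hard_minimizer b.
have mx : minimizer (hard_fun b) (hard_minimizer b).
  move=> y; have := ssc_lower hf y (hard_minimizer b).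
  by rewrite g0 dotp0l; have := dotp_ge0 (y - hard_minimizer b); lra.
split => //; exists (hard_minimizer b); split.
  split => // y my; apply/eqP; rewrite eq_sym -subr_eq0; apply/eqP/dotp_eq0.
  apply/eqP; rewrite eq_le dotp_ge0 andbT.
  by have := minimizer_dist hf y mx; have := my (hard_minimizer b); lra.
rewrite subr0 /enorm dotp_delta !mxE !eqxx mulr1 -expr2 sqrtr_sqr.
by have := hard_center_dist b 0 l0; rewrite subr0; move: lr; lra.
Qed.

(** With [l = 4 * 8 ^+ m] the final centres are at least 8 apart, so slabs of half-width 4 are
    disjoint. *)
Definition slab (b : seq bool) : set X :=
  [set v | `|v ord0 ord0 - hard_center b 0 l| < 4].

Lemma measurable_slab b : measurable (slab b).
Proof.
rewrite (_ : slab b = (fun v : X => v ord0 ord0) @^-1`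
   `]hard_center b 0 l - 4, hard_center b 0 l + 4[).
  rewrite -[X in measurable X]setTI; apply: measurable_coord => //.
by apply/seteqP; split => v; rewrite /slab/= in_itv/= ltr_norml; lra.
Qed.

Lemma slab_disjoint b b' v : size b = size b' -> l = 4 * 8 ^+ size b ->
  slab b v -> slab b' v -> b = b'.
Proof.
move=> sb lE vb vb'; apply/eqP; apply/negP => /negP bb.
have := hard_center_separated 0 l0 sb bb.
have -> : l / 8 ^+ size b = 4 by rewrite lE mulfK// expf_neq0.
move: vb vb'; rewrite /slab/= !ltr_norml ler_normr => /andP[? ?] /andP[? ?].
by case/orP; lra.
Qed.

(** The complement is the union of two half-spaces bounded by the centre and translated outwards by
    4; each has mass at most [expR (- 8)], itself at most 1/81 because [expR 2 >= 3]. The term 1/10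
    is the total variation tolerance, and 1 - 2/81 - 1/10 exceeds 7/8. *)
Lemma slab_mass b : ((7 / 8)%:E <= gibbs (hard_fun b) (slab b) - 10^-1%:E)%E.
Proof.
have hf := hard_fun_ssc b; set th := hard_center b 0 l.
pose hi : set X := [set v | th <= v ord0 ord0].
pose lo : set X := [set v | v ord0 ord0 <= th].
have mhi : measurable hi.
  rewrite (_ : hi = (fun v : X => v ord0 ord0) @^-1` `[th, +oo[).
    by rewrite -[X in measurable X]setTI; exact: measurable_coord.
  by apply/seteqP; split => v; rewrite /hi/= in_itv/= andbT.
have mlo : measurable lo.
  rewrite (_ : lo = (fun v : X => v ord0 ord0) @^-1` `]-oo, th]).
    by rewrite -[X in measurable X]setTI; exact: measurable_coord.
  by apply/seteqP; split => v; rewrite /lo/= in_itv/=.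
pose e k : X := k *: delta_mx ord0 ord0.
have e0 k (v : X) : (v - e k) ord0 ord0 = v ord0 ord0 - k.
  by rewrite !mxE !eqxx mulr1.
have ee k : dotp (e k) (e k) = k ^+ 2.
  by rewrite dotp_delta !mxE !eqxx mulr1 expr2.
have gth : hardd b 0 l th = 0 by exact: hardd_center.
have Hhi := @gibbs_shift _ _ _ hf hi (e 4) mhi.
have Hlo := @gibbs_shift _ _ _ hf lo (e (- 4)) mlo.
have sE (E : set X) k : measurable E -> measurable [set x | E (x - e k)].
  by move=> mE; rewrite -[X in measurable X]setTI; exact: measurable_rV_add.
have CE : ~` slab b = [set x | hi (x - e 4)] `|` [set x | lo (x - e (- 4))].
  apply/seteqP; split => v; rewrite /slab /hi /lo/= !e0 -/th.
    by move/negP; rewrite -leNgt ler_normr => /orP[] ?; [left|right]; lra.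
  by move=> h; apply/negP; rewrite -leNgt ler_normr; apply/orP; case: h => ?;
    [left|right]; lra.
have disj : [disjoint [set x | hi (x - e 4)] & [set x | lo (x - e (- 4))]].
  by apply/disj_setPS => v; rewrite /hi /lo/= !e0 => -[? ?]; exfalso; lra.
have mid := measurable_slab b.
have := gibbs_setC hf mid; rewrite CE gibbsU//; [|exact: sE|exact: sE].
move: Hhi Hlo; rewrite !ee.
have e8 : expR (- (4 ^+ 2 / 2)) <= 81^-1 :> R.
  rewrite expRN lef_pV2 ?posrE ?expR_gt0//.
  rewrite (_ : 4 ^+ 2 / 2 = 2 + 2 + (2 + 2) :> R); last by field.
  have h3 : 3 <= expR 2 :> R by have := expR_ge1Dx (2 : R); lra.
  rewrite (expRD (2 + 2) (2 + 2)) (expRD 2 2).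
  have h9 : 9 <= expR 2 * expR 2 :> R by nra.
  by move: (expR 2 * expR 2) h9 => z h9; nra.
have e8' : expR (- ((- 4) ^+ 2 / 2)) <= 81^-1 :> R by rewrite sqrrN.
have Hhi' x : hi x -> 0 <= dotp (grad (hard_fun b) x) (e 4).
  rewrite /hi/= => thx; rewrite dotp_delta grad_hard_fun mxE eqxx.
  by have /andP[] := hardd_slope b 0 l0 thx; rewrite gth; lra.
have Hlo' x : lo x -> 0 <= dotp (grad (hard_fun b) x) (e (- 4)).
  rewrite /lo/= => thx; rewrite dotp_delta grad_hard_fun mxE eqxx.
  by have /andP[] := hardd_slope b 0 l0 thx; rewrite gth; lra.
move=> /(_ Hhi') h1 /(_ Hlo') h2.
have := gibbs_ge0 hf [set x | hi (x - e 4)].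
have := gibbs_ge0 hf [set x | lo (x - e (- 4))]; have := gibbs_ge0 hf (slab b).
move: h1 h2; move: (gibbs _ (slab b)) (gibbs _ [set x | hi _]) (gibbs _ [set x | lo _]).
move=> g g1 g2; case: g => [g||]; case: g1 => [g1||]; case: g2 => [g2||] //=.
rewrite ?lee_fin -?EFinD -?EFinN => h1 h2 g0 g10 g20 [gE].
by lra.
Qed.

End hard_family.

Lemma agreement_take k b p : take k b != take k p ->
  agreement b p = agreement (take k b) (take k p).
Proof.
elim: k b p => [|k IH] [|s b] [|s' p] //=; rewrite ?eqxx//.
by rewrite eqseq_cons; case: eqP => //= _ h; rewrite (IH _ _ h).
Qed.

(** * Counting the hard functions found by a fixed seed *)

Section search_count.
Context {R : realType} (d : nat).
Local Notation X := 'rV[R]_d.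
Variables (A : algorithm R d) (m : nat).
Local Notation T := (m.-tuple bool).
Variables (F : T -> X -> R) (D : T -> set X) (br : X -> T) (w : seed A) (tau : nat).
Hypothesis D_disjoint : forall b b' x, D b x -> D b' x -> b = b'.
Hypothesis grad_eq : forall k (b b' : T) x, take k b = take k b' ->
  take k b != take k (br x) -> grad (F b) x = grad (F b') x.

Local Notation tr b t := (@transcript R d A (F b) t w).

Definition silent (b : T) t : Prop := forall s, (s < t)%N -> ~~ stop (w, tr b s).

Definition found (b : T) : Prop := exists2 s, (s <= tau)%N &
  [/\ silent b s, stop (w, tr b s) & D b (output (w, tr b s))].

Definition count_found (S : pred T) : R := \sum_(b : T | S b && `[< found b >]) 1.

Lemma count_found_le1 (S : pred T) :
  (forall b b', S b -> found b -> S b' -> found b' -> b = b') ->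
  count_found S <= 1.
Proof.
move=> SS; rewrite /count_found; case: (pickP (fun b => S b && `[< found b >])).
  move=> b0 /[dup] Sb0 /andP[S0 /asboolP f0].
  rewrite (bigD1 b0)//= big1 ?addr0// => b /andP[/andP[Sb /asboolP fb]].
  by rewrite (SS _ _ Sb fb S0 f0) eqxx.
by move=> none; rewrite big_pred0.
Qed.

Lemma count_found_split (S Q : pred T) :
  count_found S = count_found (fun b => S b && Q b) +
                  count_found (fun b => S b && ~~ Q b).
Proof.
rewrite /count_found (bigID Q)/=.
by congr (_ + _); apply: eq_bigl => b; rewrite andbAC.
Qed.

Lemma transcript_step t b b' : tr b t = tr b' t ->
  grad (F b) (query (w, tr b t)) = grad (F b') (query (w, tr b t)) ->
  tr b t.+1 = tr b' t.+1.
Proof. by move=> e g; rewrite /= -e g. Qed.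

(** Candidates with a common transcript stop together and return the same point, which lies in at
    most one of the disjoint sets [D b]. *)
Lemma count_found_stopped t0 (S : pred T) b0 : S b0 -> stop (w, tr b0 t0) ->
  (forall b b', S b -> S b' -> tr b t0 = tr b' t0) ->
  (forall b, S b -> silent b t0) -> count_found S <= 1.
Proof.
move=> S0 st Str Ssil.
have at_t0 c u : S c -> silent c u -> stop (w, tr c u) -> u = t0.
  move=> Sc silc stc; apply/eqP; rewrite eqn_leq; apply/andP; split.
    rewrite leqNgt; apply/negP => lt.
    by have := silc _ lt; rewrite (Str _ _ Sc S0) st.
  by rewrite leqNgt; apply/negP => lt; have := Ssil _ Sc _ lt; rewrite stc.
apply: count_found_le1 => b b' Sb [s _ [sil sts Ds]] Sb' [s' _ [sil' sts' Ds']].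
move: Ds Ds'; rewrite (at_t0 _ _ Sb sil sts) (at_t0 _ _ Sb' sil' sts').
by rewrite (Str _ _ Sb' Sb); exact: D_disjoint.
Qed.

(* A query separates the candidates only by the depth at which they leave the
   branch of the query point; the weight [(3/2)^n] of a subtree with [n]
   undetermined bits makes the sum over these depths at most twice the weight of
   the tree being searched. *)
Lemma count_found_le t t0 k (S : pred T) : (t0 + t = tau)%N -> (k <= m)%N ->
  (forall b b', S b -> S b' -> tr b t0 = tr b' t0) ->
  (forall b b', S b -> S b' -> take k b = take k b') ->
  (forall b, S b -> silent b t0) ->
  count_found S <= 2 ^+ t * (3 / 2) ^+ (m - k).
Proof.
elim: t t0 k S => [|t IH] t0 k S tE km Str Sk Ssil.
  have pw : 1 <= (3 / 2 : R) ^+ (m - k) by rewrite exprn_ege1//; lra.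
  have [b0 /andP[S0 /asboolP[s st [sil sts _]]]|none] :=
      pickP (fun b => S b && `[< found b >]); last first.
    by rewrite /count_found big_pred0// expr0 mul1r (le_trans _ pw).
  rewrite expr0 mul1r (le_trans _ pw)//.
  have s0 : s = t0.
    apply/eqP; rewrite eqn_leq -{1}(addn0 t0) tE st/= leqNgt; apply/negP => lt.
    by have := Ssil _ S0 _ lt; rewrite sts.
  by rewrite s0 in sts; exact: (count_found_stopped S0 sts).
have pw n : 1 <= (3 / 2 : R) ^+ n by rewrite exprn_ege1//; lra.
have p2 n : 1 <= (2 : R) ^+ n by rewrite exprn_ege1//; lra.
have [b0 S0|Sempty] := pickP S; last first.
  rewrite /count_found big_pred0; last by move=> b; rewrite Sempty.
  by rewrite mulr_ge0// (le_trans ler01).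
have [st|nst] := boolP (stop (w, tr b0 t0)).
  apply: (le_trans (count_found_stopped S0 st Str Ssil)).
  by have := pw (m - k)%N; have := p2 t.+1; nra.
have Ssil1 b : S b -> silent b t0.+1.
  move=> Sb s; rewrite ltnS leq_eqVlt => /predU1P[->|]; last exact: Ssil.
  by rewrite (Str _ _ Sb S0).
pose x := query (w, tr b0 t0).
(* Candidates with a common prefix that already leaves the branch of the query receive the same
   reply: they still share a transcript, and one query of the budget is spent. *)
have IHs k' (S' : pred T) : (k' <= m)%N -> (forall b, S' b -> S b) ->
    (forall b b', S' b -> S' b' -> take k' b = take k' b') ->
    (forall b, S' b -> take k' b != take k' (br x)) ->
    count_found S' <= 2 ^+ t * (3 / 2) ^+ (m - k').
  move=> k'm S'S S'k S'x; apply: (IH t0.+1) => //; first by rewrite addSnnS.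
    move=> b b' Sb Sb'; apply: transcript_step; first by apply: Str; exact: S'S.
    rewrite (Str _ _ (S'S _ Sb) S0); apply: (grad_eq (k := k')).
      exact: S'k.
    exact: S'x.
  by move=> b /S'S; exact: Ssil1.
(* If the common prefix has left the branch, the query separates no candidates and only the budget
   decreases. *)
have [xk|xk] := eqVneq (take k b0) (take k (br x)); last first.
  apply: (@le_trans _ _ (2 ^+ t * (3 / 2) ^+ (m - k))).
    by apply: IHs => // b Sb; rewrite (Sk _ _ Sb S0).
  rewrite exprS; have := pw (m - k)%N; have := p2 t.
  move: (2 ^+ t) (_ ^+ (m - k)) => u v hu hv; nra.
(* Descent along the branch: the words leaving it with [j] undetermined bits weigh [(3/2)^j], and
   the word of the branch itself counts for 1. Summed over [j < n] this is [2 * (3/2)^n - 1]. *)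
have inner n : forall k' (S' : pred T), (m = k' + n)%N -> (forall b, S' b -> S b) ->
    (forall b, S' b -> take k' b = take k' (br x)) ->
    count_found S' <= 2 ^+ t * (2 * (3 / 2) ^+ n - 1).
  elim: n => [|n IHn] k' S' mk S'S S'x.
    apply: (@le_trans _ _ 1); last by rewrite expr0; have := p2 t; lra.
    apply: count_found_le1 => b b' Sb _ Sb' _; apply: val_inj.
    have := S'x _ Sb; rewrite -(S'x _ Sb').
    by rewrite !take_oversize// size_tuple mk addn0.
  have k'm : (k' < m)%N by rewrite mk addnS ltnS leq_addr.
  pose Q (b : T) := nth false b k' == nth false (br x) k'.
  have tk (c : T) : take k'.+1 c = rcons (take k' c) (nth false c k').
    by rewrite (take_nth false)// size_tuple.
  rewrite (count_found_split S' Q).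
  have h1 : count_found (fun b => S' b && Q b) <= 2 ^+ t * (2 * (3 / 2) ^+ n - 1).
    apply: (IHn k'.+1); first by rewrite addSnnS.
      by move=> b /andP[/S'S].
    by move=> b /andP[/S'x e /eqP q]; rewrite !tk e q.
  have h2 : count_found (fun b => S' b && ~~ Q b) <= 2 ^+ t * (3 / 2) ^+ n.
    have -> : n = (m - k'.+1)%N by rewrite mk addnS -addSn addKn.
    apply: IHs => //; first by move=> b /andP[/S'S].
      (* Two bits that both differ from the bit of the branch are equal, so the leaving words share
         one more bit. *)
      move=> b b' /andP[Sb qb] /andP[Sb' qb']; rewrite !tk !S'x//; congr rcons.
      by move: qb qb'; rewrite /Q; do 3 case: nth.
    by move=> b /andP[Sb qb]; rewrite !tk eqseq_rcons negb_and qb orbT.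
  (* The ratio 3/2 is the one for which [2 r^n + r^n = 2 r^(n+1)]. *)
  rewrite exprS; move: h1 h2; move: (2 ^+ t) (_ ^+ n) (count_found _) (count_found _).
  by move=> u v c1 c2 h1 h2; lra.
have := inner (m - k)%N k S ltac:(by rewrite subnKC) (fun _ => id).
move=> /(_ (fun b Sb => etrans (Sk _ _ Sb S0) xk)).
rewrite exprS; have := p2 t; move: (2 ^+ t) (_ ^+ (m - k)) (count_found S).
by move=> u v c hu; lra.
Qed.

Lemma count_found_all : count_found xpredT <= 2 ^+ tau * (3 / 2) ^+ m.
Proof.
have := @count_found_le tau 0 0 xpredT (add0n _) (leq0n _).
by rewrite subn0; apply => // b b' _ _; rewrite !take0.
Qed.

End search_count.

Import HBNNSimple.

(** [c] times the indicator of [G] is a simple function below [f], and the integral is a supremum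
    over such functions. *)
Lemma ge0_markov d (T : measurableType d) (R : realType)
    (mu : {measure set T -> \bar R}) (f : T -> \bar R) (G : set T) (c : R) :
  measurable G -> (0 <= c)%R -> (forall w, 0 <= f w)%E ->
  (forall w, G w -> c%:E <= f w)%E -> (c%:E * mu G <= \int[mu]_w f w)%E.
Proof.
move=> mG c0 f0 cf; rewrite ge0_integralTE//.
apply: ereal_sup_ubound; exists (scale_nnsfun (indic_nnsfun R mG) c0) => /=.
  move=> w; change ((c * \1_G w)%:E <= f w)%E.
  rewrite indicE; case: (boolP (w \in G)) => [|_].
    by rewrite inE mulr1; exact: cf.
  by rewrite mulr0.
have -> : (c%:E * mu G = \int[mu]_w (c * \1_G w)%:E)%E.
  under eq_integral do rewrite EFinM.
  rewrite ge0_integralZl_EFin//. 2: exact/measurable_EFinP/measurable_indic. by rewrite integral_indic// setIT.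
exact: (esym (integralT_nnsfun mu (scale_nnsfun (indic_nnsfun R mG) c0))).
Qed.

(** * Expected cost of finding a random word *)

Section search_cost.
Context {R : realType} (d' : nat).
Local Notation X := 'rV[R]_d'.+1.
Variables (A : algorithm R d'.+1) (C : set (X -> R)) (eps : R) (m : nat).
Hypothesis eps_le : eps <= 10^-1.
Hypothesis m0 : (0 < m)%N.
Hypothesis Aadm : admissible C eps A.
Local Notation l := (4 * 8 ^+ m : R).
Local Notation T := (m.-tuple bool).
Local Notation F := (fun b : T => hard_fun l b : X -> R).
Local Notation D := (fun b : T => slab l b : set X).
Local Notation P := (seed_law A).
Local Notation tau := (m %/ 4)%N.
Hypothesis CF : forall b : T, C (F b).

Let l0 : 0 < l. Proof. by rewrite mulr_gt0// exprn_gt0. Qed.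

Lemma size_branch n (c k x : R) : size (branch n c k x) = n.
Proof. by elim: n c k => //= n IH c k; rewrite IH. Qed.

Definition query_branch (x : X) : T := Tuple (introT eqP (size_branch m 0 l (x ord0 ord0))).

Lemma grad_hard_fun_eq k (b b' : T) x : take k b = take k b' ->
  take k b != take k (query_branch x) -> grad (F b) x = grad (F b') x.
Proof.
move=> e ne; rewrite !grad_hard_fun//.
apply/rowP => i; rewrite !mxE; case: eqP => // ->.
apply: (@hardd_agreement _ m) => //; [exact: size_tuple|exact: size_tuple|].
rewrite (@agreement_take k b) // (@agreement_take k b') -?e//.
Qed.

Definition found_set (b : T) : set (seed A) := [set w | found (A := A) F D w tau b].

Lemma measurable_grad_hard_fun b : measurable_fun setT (grad (F b)).
Proof. apply: measurable_grad; exact: hard_fun_ssc. Qed.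

Lemma measurable_found_set b : measurable (found_set b).
Proof.
rewrite (_ : found_set b = \bigcup_(s in [set s | (s <= tau)%N])
   [set w | stops_at (A := A) (F b) s w /\ D b (output (w, transcript (F b) s w))]).
  apply: bigcup_measurable => s _; apply: measurable_stops_in.
    exact: measurable_grad_hard_fun.
  exact: measurable_slab.
apply/seteqP; split => w /=.
  by move=> [s st [sil sts Ds]]; exists s.
by move=> [s st [[sil sts] Ds]]; exists s.
Qed.

(** The sum over words is exchanged with the integral over the seed; for each seed the counting
    bound applies. *)
Lemma sum_found : \sum_(b : T) fine (P (found_set b)) <= 2 ^+ tau * (3 / 2) ^+ m.
Proof.
rewrite -lee_fin -sumEFin.
have -> : (\sum_(b : T) (fine (P (found_set b)))%:E =
    \int[P]_w \sum_(b : T) (\1_(found_set b) w)%:E)%E.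
  rewrite ge0_integral_sum//; last first.
    by move=> b; exact/measurable_EFinP/measurable_indic/measurable_found_set.
  apply: eq_bigr => b _; rewrite fineK ?fin_num_measure//; last exact: measurable_found_set.
  by rewrite integral_indic ?setIT//; exact: measurable_found_set.
apply: (@le_trans _ _ (\int[P]_w (2 ^+ tau * (3 / 2) ^+ m)%:E)%E).
  apply: ge0_le_integral => //.
  - by move=> w _; apply: sume_ge0 => b _; rewrite lee_fin indicE.
  - apply: emeasurable_sum => b.
    exact/measurable_EFinP/measurable_indic/measurable_found_set.
  move=> w _; rewrite sumEFin lee_fin.
  have := @count_found_all _ _ A m F D query_branch w tau.
  rewrite /count_found big_mkcond/=.
  have -> : \sum_(b : T) \1_(found_set b) w = \sum_(b : T) (if `[< found (A := A) F D w tau b >] then 1 else 0) :> R.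
    apply: eq_bigr => b _; rewrite indicE; case: ifPn => [/asboolP|/asboolPn] h.
      by rewrite mem_set.
    by rewrite memNset.
  apply.
    move=> b b' x Db Db'; apply/val_inj/(@slab_disjoint _ _ l) => //; last 2 first.
    - exact: Db.
    - exact: Db'.
    - by rewrite !size_tuple.
    - by rewrite size_tuple.
  exact: grad_hard_fun_eq.
by rewrite integral_probability_cst.
Qed.

(** The output falls in the slab with probability at least its Gibbs mass minus 1/10; when it does,
    the word was found within the budget or the run exceeded it. *)
Lemma found_or_late b : ((7 / 8)%:E <=
  P (found_set b) + P [set w | tau%:R%:E < num_queries (A := A) (F b) w])%E.
Proof.
have [_ _ tv] := Aadm (CF b).
have mS : measurable (slab l b : set X) by exact: measurable_slab.
have mG := measurable_grad_hard_fun b.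
have mO : measurable (final (A := A) (F b) @^-1` slab l b).
  by rewrite -[X in measurable X]setTI; exact: measurable_final.
have gD : (gibbs (F b) (D b) - 10^-1%:E <= output_law A (F b) (D b))%E.
  have : (`|output_law A (F b) (D b) - gibbs (F b) (D b)| <= 10^-1%:E)%E.
    apply: le_trans (le_trans tv _); last by rewrite lee_fin.
    by apply: ereal_sup_ubound; exists (D b).
  have : (output_law A (F b) (D b)) \is a fin_num by exact: fin_num_measure.
  have : gibbs (F b) (D b) \is a fin_num.
    have hs := hard_fun_ssc d' l0 b.
    have := gibbs_setC hs mS; have := gibbs_ge0 hs (D b).
    have := gibbs_ge0 hs (~` D b); move: (gibbs _ _) (gibbs _ _).
    by move=> [p||] [q||].
  move: (output_law _ _ _) (gibbs _ _) => [p||] // [q||] // _ _.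
  by rewrite -!EFinB !lee_fin ler_norml; lra.
apply: (le_trans (slab_mass d' l0 b)).
apply: (le_trans gD).
have mL := measurable_num_queries_gt A mG tau.
have mE := measurable_found_set b.
apply: (le_trans _ (measureU2 P mE mL)).
rewrite /output_law /pushforward; apply: le_measure; [by rewrite inE|by rewrite inE; exact: measurableU|].
move=> w; rewrite /preimage/= => Dw.
have [[s st ss]|late] := pselect (exists2 s, (s <= tau)%N & stops_at (A := A) (F b) s w).
  left; exists s => //; have [sil sts] := ss; split => //.
  by move: Dw; rewrite /final; have /stop_timeP -> := ss.
by right; apply/num_queries_gtP.
Qed.

(** Since [2 <= (4/3)^4 = 256/81], each unit of [tau] costs no more than four factors 4/3. The extra
    factor 3/4 comes from one unit of slack, [2 <= 3/4 * 256/81], or, when [tau = 0], from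
    [m > 0]. *)
Lemma two_pow_quarter : 2 ^+ tau * (3 / 2) ^+ m <= 2 ^+ m * (3 / 4) :> R.
Proof.
have -> : (2 : R) ^+ m * (3 / 4) = (3 / 2) ^+ m * ((4 / 3) ^+ m * (3 / 4)).
  by rewrite mulrA -exprMn (_ : 3 / 2 * (4 / 3) = 2 :> R)//; field.
rewrite mulrC ler_pM2l; last by rewrite exprn_gt0//; lra.
have q n : 2 ^+ n <= (4 / 3) ^+ (n * 4) :> R.
  rewrite mulnC exprM; apply: lerXn2r; rewrite ?nnegrE ?exprn_ge0//; lra.
have [m4|m4] := ltnP m 4.
  rewrite divn_small// expr0; case: m m0 => // n _; rewrite exprS.
  have : 1 <= (4 / 3 : R) ^+ n by rewrite exprn_ege1//; lra.
  by lra.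
have t0 : (0 < tau)%N by rewrite divn_gt0.
have : (4 / 3) ^+ (tau * 4) <= (4 / 3) ^+ m :> R.
  by apply: ler_weXn2l; [lra|exact: leq_divM].
case: tau t0 => // n _; rewrite exprS mulSn exprD; have := q n.
have -> : (4 / 3) ^+ 4 = 256 / 81 :> R by field.
move: ((4 / 3) ^+ (n * 4)) ((4 / 3) ^+ m) (2 ^+ n : R) (exprn_ge0 n (ler0n R 2)) => u v a a0 au uv.
by lra.
Qed.

(** If every word were late with probability below 1/16, each would be found with probability at
    least 7/8 - 1/16 = 13/16, and the sum over the [2 ^+ m] words would exceed the fraction 3/4
    allowed by the count. *)
Lemma expected_queries_lower :
  exists b : T, ((tau.+1%:R / 16)%:E <= expected_queries A (F b))%E.
Proof.
have [b late] : exists b : T,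
    ((1 / 16)%:E <= P [set w | tau%:R%:E < num_queries (A := A) (F b) w])%E.
  apply/not_existsP => early.
  have hb b : 13 / 16 <= fine (P (found_set b)).
    have := found_or_late b; have /negP := early b; rewrite -ltNge.
    have /fineK <- : P (found_set b) \is a fin_num.
      by apply: fin_num_measure; exact: measurable_found_set.
    case: (P [set w | _]) => [p||]//; rewrite -EFinD lee_fin lte_fin /=.
    by move=> h1 h2; lra.
  have : \sum_(b : T) (13 / 16 : R) <= \sum_(b : T) fine (P (found_set b)).
    exact: ler_sum.
  rewrite sumr_const card_tuple card_bool -[X in X <= _]mulr_natl natrX.
  have := sum_found; have := two_pow_quarter; have : 0 < (2 : R) ^+ m by exact: exprn_gt0.
  by lra.
exists b; rewrite /expected_queries.
have mG := measurable_num_queries_gt A (measurable_grad_hard_fun b) tau.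
(* The number of queries is an integer or infinite, so exceeding [tau] means reaching [tau.+1],
   which keeps the bound positive even for [tau = 0]. *)
have h : ((tau.+1%:R : R)%:E * P [set w | tau%:R%:E < num_queries (A := A) (F b) w] <=
    \int[P]_w num_queries (A := A) (F b) w)%E.
  apply: ge0_markov => //.
    by move=> w; rewrite /num_queries; case: stop_time => // t; rewrite lee_fin.
  move=> w /=; rewrite /num_queries; case: stop_time => // t.
    by rewrite lte_fin ltr_nat lee_fin ler_nat.
  by rewrite leey.
apply: le_trans h; rewrite EFinM lee_wpmul2l//.
by rewrite -(mul1r 16^-1).
Qed.

End search_cost.

(** * Minimax bounds *)

Lemma ln8_gt0 (R : realType) : 0 < ln 8 :> R.
Proof. by rewrite ln_gt0// ltr1n. Qed.

(** The witness is the largest [m] with [4 * 8 ^+ m <= r], and [r >= 64] makes it positive. The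
    exponent comes from [r < 4 * 8 ^+ m.+1 = 2 ^+ (3 * m + 5)], squared. *)
Lemma search_depthP (R : realType) (r : R) : 64 <= r -> exists m,
  [/\ (0 < m)%N, 4 * 8 ^+ m <= r, r ^+ 2 <= 2 ^+ (6 * m + 10),
      m%:R * ln 8 <= ln (1 + r) & ln (1 + r) <= m.+2%:R * ln 8].
Proof.
move=> r64.
have ex : exists n, r < 4 * 8 ^+ n.
  exists (Num.truncn r).+1; have := truncnS_gt r.
  have : (Num.truncn r).+1%:R <= 8 ^+ (Num.truncn r).+1 :> R.
    by rewrite -natrX ler_nat ltnW// ltn_expl.
  by move: (_ ^+ _) (_%:R) => a b; lra.
case: (ex_minnP ex) => -[|[|m]] rm minm.
- by rewrite expr0 in rm; lra.
- by rewrite expr1 in rm; lra.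
have rm' : 4 * 8 ^+ m.+1 <= r.
  by rewrite leNgt; apply/negP => /minm; rewrite ltnn.
have e8 n : ln (8 ^+ n) = n%:R * ln 8 :> R by rewrite lnXn// mulr_natl.
have p8 : 1 <= 8 ^+ m :> R by rewrite exprn_ege1//; lra.
exists m.+1; split => //.
- have -> : 2 ^+ (6 * m.+1 + 10) = (4 * 8 ^+ m.+2) ^+ 2 :> R.
    have -> : (4 : R) = 2 ^+ 2 by ring.
    have -> : (8 : R) = 2 ^+ 3 by ring.
    by rewrite -!exprM -exprD -exprM; congr (_ ^+ _); lia.
  by apply: lerXn2r; rewrite ?nnegrE; lra.
- rewrite -e8 ler_ln; [|by rewrite posrE exprn_gt0|by rewrite posrE; lra].
  by move: rm'; rewrite exprS; lra.
- rewrite -e8 ler_ln; [|by rewrite posrE; lra|by rewrite posrE exprn_gt0].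
  by move: rm; rewrite !exprS; lra.
Qed.

Section minimax_bounds.
Context {R : realType} (d' : nat).
Local Notation X := 'rV[R]_d'.+1.
Local Notation centered r := (centered_class 2 1 (0 : X) r).

(** Stated for any class containing the centred one, so that it also serves the uncentred class. The
    constant 128 is 16 times 8, from [m + 2 <= 8 * (m / 4 + 1)] with integer division. *)
Lemma minimax_cost_lower (C : set (X -> R)) (r eps : R) : 64 <= r ->
  eps <= 10^-1 -> centered r `<=` C ->
  (((128 * ln 8)^-1 * ln (1 + r))%:E <= minimax_cost C eps)%E.
Proof.
move=> r64 epsle rC; have [m [m0 mr _ _ lnr]] := search_depthP r64.
apply: le_ereal_inf_tmp => _ [A Aadm ->].
have [b hb] : exists b : m.-tuple bool, (((m %/ 4).+1%:R / 16)%:E <=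
    expected_queries A (hard_fun (4 * 8 ^+ m) b))%E.
  apply: (expected_queries_lower epsle m0 Aadm) => b.
  apply/rC/hard_fun_class => //.
apply: (@le_trans _ _ ((m %/ 4).+1%:R / 16)%:E).
  have l8 := ln8_gt0 R.
  rewrite lee_fin mulrC ler_pdivrMr; last by lra.
  apply: (le_trans lnr).
  have : m.+2%:R <= 8 * (m %/ 4).+1%:R :> R by rewrite -natrM ler_nat; lia.
  by move: (m.+2%:R : R) ((m %/ 4).+1%:R : R) (ln 8) l8 => u v L L0; nra.
apply: (le_trans hb); apply: ereal_sup_ubound.
exists (hard_fun (4 * 8 ^+ m) b) => //; apply/rC/hard_fun_class => //.
Qed.

Lemma minimax_cost_centered : exists c C : R, [/\ 0 < c, c <= C &
  forall r eps : R, 64 <= r -> 0 < eps -> eps <= 10^-1 ->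
    ((c * ln (1 + r))%:E <= minimax_cost (centered r) eps)%E /\
    (minimax_cost (centered r) eps <= (C * ln (1 + r))%:E)%E].
Proof.
have [K K0 upper] := @minimax_cost_upper R d'; have l8 := ln8_gt0 R.
(* The upper bound is [2 * (6 m + 10 + K)], at most [(32 + 2 K) * m] because [m >= 1]. *)
exists (128 * ln 8)^-1, ((32 + 2 * K) / ln 8); split.
- by rewrite invr_gt0; lra.
- rewrite ler_pdivlMr// invfM -mulrA mulVf ?gt_eqF//; lra.
move=> r eps r64 eps0 epsle; split; first exact: minimax_cost_lower.
have [m [m0 _ mr lnr _]] := search_depthP r64.
apply: le_trans (upper _ _ _ _ eps0 mr) _; first by lra.
rewrite lee_fin mulrAC ler_pdivlMr//.
apply: (@le_trans _ _ ((32 + 2 * K) * (m%:R * ln 8))); last by apply: ler_wpM2l => //; lra.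
rewrite mulrA; apply: ler_wpM2r; first exact: ltW.
rewrite natrD natrM; have : 1 <= m%:R :> R by rewrite ler1n.
by move: (m%:R) => u; nra.
Qed.

Lemma minimax_cost_unbounded (eps : R) : eps <= 10^-1 ->
  minimax_cost (smooth_strongly_convex 2 1 : set (X -> R)) eps = +oo%E.
Proof.
move=> epsle; apply/eqyP => a a0; have l8 := ln8_gt0 R.
(* The radius at which the logarithmic lower bound reaches the given level [a]. *)
pose r := 64 + expR (128 * ln 8 * a).
have r64 : 64 <= r by rewrite lerDl expR_ge0.
apply: le_trans (minimax_cost_lower r64 epsle _); last by move=> f [].
rewrite lee_fin mulrC ler_pdivlMr; last lra.
rewrite mulrC -[X in X <= _]expRK ler_ln; [|by rewrite posrE expR_gt0|by rewrite posrE; lra].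
by rewrite /r; lra.
Qed.

End minimax_bounds.

Theorem proposition5p5 (R : realType) :
  (forall d : nat, (1 <= d)%N ->
     exists c C : R, [/\ 0 < c, c <= C &
       forall r eps : R, 64 <= r -> 0 < eps -> eps <= 10^-1 ->
         ((c * ln (1 + r))%:E
            <= minimax_cost (centered_class 2 1 (0 : 'rV[R]_d) r) eps)%E /\
         (minimax_cost (centered_class 2 1 (0 : 'rV[R]_d) r) eps
            <= (C * ln (1 + r))%:E)%E]) /\
  (forall d : nat, (1 <= d)%N ->
     forall eps : R, 0 < eps -> eps <= 10^-1 ->
       minimax_cost (smooth_strongly_convex 2 1 : set ('rV[R]_d -> R)) eps
         = +oo%E).
Proof.
split=> -[//|d'] _; first exact: minimax_cost_centered.
by move=> eps _; exact: minimax_cost_unbounded.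
Qed.
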